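(* Let $q=q_1+iq_2$, with $q_1,q_2\in\mathbb{Q}$, be a rational point of $\Omega=\{q\in\mathbb{C}:\frac12<\mathrm{Re}\,q<\frac1{\sqrt2},\ \mathrm{Im}\,q>0,\ |q|<\frac1{\sqrt2}\}$. The conformal strings with modulus $q$ are Möbius equivalent to the model string $\gamma_q=(x(t),y(t),z(t)):\mathbb{R}\to\mathbb{R}^3$ (the symmetrical configuration of $q$) given by $$x(t)=\frac{\sqrt2}{r(t)}\mu\sqrt{k(t)^2-\upsilon^2}\cos\Theta_2(t),\quad y(t)=\frac{\sqrt2}{r(t)}\mu\sqrt{k(t)^2-\upsilon^2}\sin\Theta_2(t),\quad z(t)=\frac{\sqrt2}{r(t)}\upsilon\sqrt{\mu^2-k(t)^2}\sin\Theta_1(t),$$ where $$k(t)=\begin{cases}\sqrt a\,\mathrm{cn}\big(\sqrt{a-b}\,t,\frac a{a-b}\big),&b<0,\\ \sqrt a\,\mathrm{dn}\big(\sqrt a\,t,\frac{a-b}a\big),&b>0,\end{cases}\qquad r(t)=\sqrt{\mu^2-\upsilon^2}\,k(t)+\upsilon\sqrt{\mu^2-k(t)^2}\cos\Theta_1(t),$$ $$\mu=\tfrac1{\sqrt2}\sqrt{a+b+\sqrt{4+(a-b)^2}},\qquad \upsilon=\tfrac1{\sqrt2}\sqrt{a+b-\sqrt{4+(a-b)^2}},$$ $$\Theta_1(t)=\int_0^t\frac{\mu}{\mu^2-k(u)^2}\,du,\qquad \Theta_2(t)=\int_0^t\frac{\upsilon}{\upsilon^2-k(u)^2}\,du,$$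 and $a,b$ are the real parameters uniquely determined by $q$ through $\Phi_1(a,b)=-q_1$, $\Phi_2(a,b)=q_2$, $a>0$, $a>b$, $b\ne0$, $ab>1$.
   Context: Conformal geometry of curves. $\mathbb{R}^{4,1}$ is $\mathbb{R}^5$ (coordinates $v^0,\dots,v^4$) with the scalar product $(v,w)=-(v^0w^4+v^4w^0)+\sum_{j=1}^3v^jw^j$, the orientation $dv^0\wedge\cdots\wedge dv^4$ and the positive light cone $\mathcal{L}_+=\{v:(v,v)=0,\ v^0+v^4>0\}$. The Möbius space $\mathcal{M}_3$ is the projectivization of $\mathcal{L}_+$. $\mathbb{R}^3$ is identified with $\mathcal{M}_3$ minus $[e_0]$ by $x\mapsto[\frac{\langle x,x\rangle}{2}e_0+\sum_jx^je_j+e_4]$, with inverse $\mathcal{P}:[v]\mapsto\frac1{v^4}(v^1,v^2,v^3)$. The Möbius group $G$ is the group of linear isometries of $\mathbb{R}^{4,1}$ of determinant $1$, acting on $\mathcal{M}_3$ and hence (where defined) on $\mathbb{R}^3$ as the group of all conformal transformations; $G_+$ is its identity component. Elements $\mathrm{F}\in G_+$ are identified with their columns $(\mathrm{F}_0,\dots,\mathrm{F}_4)$. For a smooth curve $\gamma\subset\mathbb{R}^3$ parametrized by arclength $s$, $\eta_\gamma=(\langle\dddot\gamma,\dddot\gamma\rangle-\langle\ddot\gamma,\ddot\gamma\rangle^2)^{1/4}ds$. The curve is generic if $\eta_\gamma$ vanishes nowhere; the conformal arclength parameter $\zeta$ is then defined up to a constant by $d\zeta=\eta_\gamma$. For an oriented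 generic curve there is a unique $\mathrm{F}:I\to G_+$ with $\mathcal{P}\circ[\mathrm{F}_4]=\gamma$ (the Vessiot frame) such that $$\mathrm{F}^{-1}d\mathrm{F}=\begin{pmatrix}0&1&0&0&0\\k_2&0&0&0&1\\1&0&0&k_1&0\\0&0&-k_1&0&0\\0&k_2&1&0&0\end{pmatrix}\eta_\gamma ;$$ $k_1,k_2$ are the conformal curvatures. The conformal arclength functional is $\mathcal{L}[\gamma]=\int_\gamma\eta_\gamma$ on generic curves. A conformal string is a closed critical curve of $\mathcal{L}$ with non-constant conformal curvatures. Two curves $\gamma,\tilde\gamma$ with trajectories $[\gamma],[\tilde\gamma]$ are Möbius equivalent if $A\cdot[\gamma]=[\tilde\gamma]$ for some $A\in G$. $\mathrm{cn}(\cdot,m),\mathrm{dn}(\cdot,m)$ are Jacobi elliptic functions of parameter $m$ (the square of the modulus). For $a>0$, $a>b$, $b\ne0$ let $k_{(a,b)}$ be the function called $k$ in the claim. A critical curve parametrized by conformal arclength has parameters $(a,b)$ if, up to reversing the orientation along the curve, acting with an orientation-reversing conformal transformation and translating the independent variable, its conformal curvatures are $k_1=k_{(a,b)}$, $k_2=-\frac32k_{(a,b)}^2+\frac{a+b}2$. For $a>0,\ a>b,\ b\neq 0,\ ab>1$, with $\mu,\upsilon$ as in the claim and $\omega$ the minimal period of $k_{(a,b)}$, set $$\Phi_1(a,b)=\frac1{2\pi}\int_0^{\omega}\frac{\mu}{k_{(a,b)}(t)^2-\mu^2}\,dt,\qquad \Phi_2(a,b)=\frac1{2\pi}\int_0^{\omega}\frac{\upsilon}{k_{(a,b)}(t)^2-\upsilon^2}\,dt.$$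 Every conformal string has parameters $(a,b)$ with $a>0$, $a>b$, $ab>1$; its modulus is $q=-\Phi_1(a,b)+i\Phi_2(a,b)$, a rational point of $\Omega$, and $q$ determines $(a,b)$ uniquely. *)

(* Defs.v *)
From Stdlib Require Import Rdefinitions.
From mathcomp Require Import all_boot all_algebra.
From mathcomp Require boolp classical_sets topology normedtype.
From mathcomp Require Import Rstruct Rstruct_topology.

(* The linear algebra uses MathComp matrices over the reals of the standard
   library, the calculus uses Coquelicot; vectors are columns. *)

Set Implicit Arguments.
Unset Strict Implicit.
Unset Printing Implicit Defensive.

Import GRing.Theory.
Local Open Scope ring_scope.

Definition entry (v : 'cV[R]_5) (i : nat) : R := v (inord i) 0.

Definition lorentz (v w : 'cV[R]_5) : R :=
  - (entry v 0 * entry w 4 + entry v 4 * entry w 0)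
  + \sum_(1 <= j < 4) entry v j * entry w j.

Definition moebius_group (A : 'M[R]_5) : Prop :=
  (forall v w : 'cV[R]_5, lorentz (A *m v) (A *m w) = lorentz v w) /\ \det A = 1.

(* The topology library is imported in a module because its notations clash
   with those of Stdlib and Coquelicot. *)
Module IdentityComponent.
Import boolp classical_sets topology normedtype.
Local Open Scope classical_set_scope.

Definition moebius_group_id (A : 'M[R]_5) : Prop :=
  connected_component [set B : 'M[R]_5 | moebius_group B] 1%:M A.

End IdentityComponent.

Definition moebius_group_id := IdentityComponent.moebius_group_id.

Definition col3 (x y z : R) : 'cV[R]_3 := \col_(j < 3) nth 0 [:: x; y; z] j.

Definition dot3 (x y : 'cV[R]_3) : R := \sum_(j < 3) x j 0 * y j 0.

(* The null vector representing the point x of Euclidean space in the Moebius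
   space. *)
Definition embed (x : 'cV[R]_3) : 'cV[R]_5 :=
  \col_(i < 5) nth 0 [:: dot3 x x / 2; x 0 0; x 1 0; x 2 0; 1] i.

Definition proj3 (v : 'cV[R]_5) : 'cV[R]_3 :=
  \col_(j < 3) (entry v j.+1 / entry v 4).

(* Nonzero vectors with the same class in the projective space. The factor may
   be negative: an element of the Moebius group outside the identity component
   exchanges the two nappes of the light cone. *)
Definition same_point (v w : 'cV[R]_5) : Prop :=
  exists c : R, c <> 0 /\ v = c *: w.

Definition curve := R -> 'cV[R]_3.

Definition acts_to (A : 'M[R]_5) (g h : curve) : Prop :=
  forall t, same_point (A *m embed (g t)) (embed (h t)).

Definition moebius_equivalent (g h : curve) : Prop :=
  exists A : 'M[R]_5, moebius_group A /\
    (forall t, exists s, same_point (A *m embed (g t)) (embed (h s))) /\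
    (forall s, exists t, same_point (A *m embed (g t)) (embed (h s))).

From Stdlib Require Import Reals QArith Qreals.
From Coquelicot Require Import Coquelicot.

Local Open Scope ring_scope.

Definition smooth (f : R -> R) : Prop := forall n t, ex_derive_n f n t.

Definition Dcurve (g : curve) : curve :=
  fun t => \col_(j < 3) Derive (fun u => g u j 0) t.

Definition Dframe (F : R -> 'M[R]_5) (t : R) : 'M[R]_5 :=
  \matrix_(i < 5, j < 5) Derive (fun u => F u i j) t.

Definition speed (g : curve) (t : R) : R := sqrt (dot3 (Dcurve g t) (Dcurve g t)).

(* Derivative of X with respect to the arclength of g, for g in an arbitrary
   regular parametrization. *)
Definition Darc (g X : curve) : curve := fun t => (speed g t)^-1 *: Dcurve X t.

(* The conformal arclength element of g is [eta g t dt]; the iterated square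
   root is the fourth root. *)
Definition eta (g : curve) (t : R) : R :=
  let g2 := Darc g (Darc g g) t in
  let g3 := Darc g (Darc g (Darc g g)) t in
  sqrt (sqrt (dot3 g3 g3 - dot3 g2 g2 ^+ 2)) * speed g t.

Definition generic (g : curve) : Prop :=
  (forall j, smooth (fun t => g t j 0)) /\
  (forall t, Dcurve g t <> 0) /\
  (forall t, eta g t <> 0).

Definition vessiot_matrix (k1 k2 : R) : 'M[R]_5 :=
  \matrix_(i < 5, j < 5)
    nth 0 (nth [::] [:: [:: 0 ; 1 ; 0   ; 0 ; 0];
                        [:: k2; 0 ; 0   ; 0 ; 1];
                        [:: 1 ; 0 ; 0   ; k1; 0];
                        [:: 0 ; 0 ; - k1; 0 ; 0];
                        [:: 0 ; k2; 1   ; 0 ; 0]] i) j.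

Definition vessiot_frame (g : curve) (F : R -> 'M[R]_5) (k1 k2 : R -> R) : Prop :=
  (forall i j, smooth (fun t => F t i j)) /\
  forall t,
    moebius_group_id (F t) /\
    entry (col (inord 4) (F t)) 4 <> 0 /\
    proj3 (col (inord 4) (F t)) = g t /\
    invmx (F t) *m Dframe F t = eta g t *: vessiot_matrix (k1 t) (k2 t).

(* The conformal curvatures are functions of the parameter of g; g is oriented
   by increasing parameter. *)
Definition conformal_curvatures (g : curve) (k1 k2 : R -> R) : Prop :=
  generic g /\ exists F, vessiot_frame g F k1 k2.

Local Close Scope ring_scope.
Local Open Scope R_scope.

Definition conformal_arclength_param (g : curve) : Prop :=
  generic g /\ forall t, eta g t = 1.

Fixpoint Cn_2d (n : nat) (f : R -> R -> R) : Prop :=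
  (forall x y, continuity_2d_pt f x y) /\
  match n with
  | O => True
  | S n' =>
      (forall x y, ex_derive (fun u => f u y) x /\ ex_derive (f x) y) /\
      Cn_2d n' (fun x y => Derive (fun u => f u y) x) /\
      Cn_2d n' (fun x y => Derive (f x) y)
  end.

Definition smooth2 (f : R -> R -> R) : Prop := forall n, Cn_2d n f.

(* A smooth variation through generic curves, supported in [l, r]. *)
Definition proper_variation (g : curve) (V : R -> curve) (l r : R) : Prop :=
  (forall j, smooth2 (fun tau t => V tau t j ord0)) /\
  (forall t, V 0 t = g t) /\
  (forall tau t, t <= l \/ r <= t -> V tau t = g t) /\
  (exists e, 0 < e /\ forall tau, Rabs tau < e -> generic (V tau)).

Definition critical (g : curve) : Prop :=
  generic g /\
  forall (V : R -> curve) (l r : R),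
    l < r -> proper_variation g V l r ->
    is_derive (fun tau => RInt (eta (V tau)) l r) 0 0.

Definition closed_curve (g : curve) : Prop :=
  exists T, 0 < T /\ forall t, g (t + T) = g t.

Definition nonconstant_curvatures (g : curve) : Prop :=
  exists k1 k2, conformal_curvatures g k1 k2 /\
    ~ (exists c1 c2, forall t, k1 t = c1 /\ k2 t = c2).

Definition conformal_string (g : curve) : Prop :=
  critical g /\ closed_curve g /\ nonconstant_curvatures g.

(* Jacobi amplitude: inverse of the incomplete elliptic integral of the first
   kind, m being the parameter (the square of the modulus). *)
Definition jacobi_am (u m : R) : R :=
  iota (fun phi : R => RInt (fun th => / sqrt (1 - m * sin th ^ 2)) 0 phi = u).

Definition jacobi_cn (u m : R) : R := cos (jacobi_am u m).
Definition jacobi_dn (u m : R) : R := sqrt (1 - m * sin (jacobi_am u m) ^ 2).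

Definition kab (a b t : R) : R :=
  if Rlt_dec b 0 then sqrt a * jacobi_cn (sqrt (a - b) * t) (a / (a - b))
  else sqrt a * jacobi_dn (sqrt a * t) ((a - b) / a).

Definition mu (a b : R) : R :=
  1 / sqrt 2 * sqrt (a + b + sqrt (4 + (a - b) ^ 2)).
Definition upsilon (a b : R) : R :=
  1 / sqrt 2 * sqrt (a + b - sqrt (4 + (a - b) ^ 2)).

Definition is_period (f : R -> R) (T : R) : Prop :=
  0 < T /\ forall t, f (t + T) = f t.

Definition minimal_period (f : R -> R) : R :=
  iota (fun T : R => is_period f T /\ forall T', is_period f T' -> T <= T').

Definition omega (a b : R) : R := minimal_period (kab a b).

Definition Phi1 (a b : R) : R :=
  1 / (2 * PI) * RInt (fun t => mu a b / (kab a b t ^ 2 - mu a b ^ 2)) 0 (omega a b).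
Definition Phi2 (a b : R) : R :=
  1 / (2 * PI) *
  RInt (fun t => upsilon a b / (kab a b t ^ 2 - upsilon a b ^ 2)) 0 (omega a b).

Definition admissible (a b : R) : Prop := 0 < a /\ b < a /\ b <> 0 /\ 1 < a * b.

(* h arises from g by translating and possibly reversing the parameter and by
   possibly acting with an orientation-reversing conformal transformation. The
   latter are the elements of the Moebius group outside its identity component:
   in odd dimension, minus an isometry of determinant -1 has determinant 1 and
   induces the same transformation of the Moebius space. *)
Definition congruent_up_to_orientation (g h : curve) : Prop :=
  exists e c : R, (e = 1 \/ e = -1) /\
    let g' := fun t => g (e * t + c) in
    (forall t, h t = g' t) \/
    exists A, moebius_group A /\ ~ moebius_group_id A /\ acts_to A g' h.

Definition has_parameters (g : curve) (a b : R) : Prop :=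
  critical g /\ conformal_arclength_param g /\
  exists h, congruent_up_to_orientation g h /\
    conformal_curvatures h (kab a b)
      (fun t => - (3 / 2) * kab a b t ^ 2 + (a + b) / 2).

(* The parametrization of a string is arbitrary: phi passes to a conformal
   arclength parameter. *)
Definition reparametrization (phi : R -> R) : Prop :=
  smooth phi /\ (forall t, 0 < Derive phi t) /\ (forall s, exists t, phi t = s).

Definition has_modulus (g : curve) (q : C) : Prop :=
  exists (phi : R -> R) (a b : R),
    reparametrization phi /\ admissible a b /\
    has_parameters (fun t => g (phi t)) a b /\
    q = (- Phi1 a b + Ci * Phi2 a b)%C.

Definition Omega (q : C) : Prop :=
  1 / 2 < Re q < 1 / sqrt 2 /\ 0 < Im q /\ Cmod q < 1 / sqrt 2.

Definition Theta1 (a b t : R) : R :=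
  RInt (fun u => mu a b / (mu a b ^ 2 - kab a b u ^ 2)) 0 t.
Definition Theta2 (a b t : R) : R :=
  RInt (fun u => upsilon a b / (upsilon a b ^ 2 - kab a b u ^ 2)) 0 t.

Definition radius (a b t : R) : R :=
  sqrt (mu a b ^ 2 - upsilon a b ^ 2) * kab a b t +
  upsilon a b * sqrt (mu a b ^ 2 - kab a b t ^ 2) * cos (Theta1 a b t).

Definition model_string (a b : R) : curve :=
  fun t => col3
    (sqrt 2 / radius a b t * mu a b *
       sqrt (kab a b t ^ 2 - upsilon a b ^ 2) * cos (Theta2 a b t))
    (sqrt 2 / radius a b t * mu a b *
       sqrt (kab a b t ^ 2 - upsilon a b ^ 2) * sin (Theta2 a b t))
    (sqrt 2 / radius a b t * upsilon a b *
       sqrt (mu a b ^ 2 - kab a b t ^ 2) * sin (Theta1 a b t)).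

(* Main.v *)
(** Since [a * b > 1] forces [b > 0], only the dn case occurs.

    The null lift of the model string solves the linear system of the Vessiot
    frame with curvatures [k] and [- 3/2 k^2 + (a+b)/2]: the momentum of the
    string is constant, and in an eigenbasis the rows of the frame become one real
    and two complex rows whose arguments are Theta_1 and Theta_2. Over a period
    of [k] these angles grow by [2 pi q_1] and [- 2 pi q_2], so the string closes
    up.

    A null lift [Y] with [(Y_1, Y_1) = 1] has [eta^4 = (Y_3, Y_3) - (Y_2, Y_2)^2],
    where [Y_i] is the i-th derivative. This gives the conformal invariance of
    [eta], and it turns the first variation of the length into the integral of
    [((Y_3, P_3) + 4 k_2 (Y_2, P_2)) / 2] for a field [P] with [(Y, P) = 0] and
    [(Y_1, P_1) = 0]; by the equations of the frame this is a total derivative.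

    Conversely, two frames with the same curvatures differ by a constant element
    of the Moebius group. It remains to see that the modulus determines (a, b).
    With [a - b] fixed, Phi_1 and Phi_2 increase in [a + b]. With [a * b] fixed,
    the derivatives of [- Phi_1] and Phi_2 in [a + b] are positive multiples of
    the same negative complete integral of the second kind. Combined along the
    corner path through [(a' - b', a * b)], these signs give injectivity. *)

(* Three obstacles shape the development. [eta] is defined by derivatives in Euclidean arclength,
   which a Moebius transformation distorts; a lift scaled to unit speed trades them for derivatives
   in the given parameter, and on lifts the Moebius group acts linearly. The model, the first
   variation and the invariance are therefore all treated on lifts.

   A variation is generic only for small [tau], and square roots are smooth only where the radicand
   is positive. Differentiability is therefore stated on strips open in the first variable, with
   existential partial derivatives, so that closure under each operation is an induction. The same
   classes serve the period integrals, whose parameter is confined to [g < c].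

   The frame has to lie in an identity component that is defined topologically. Its Gram matrix
   leaves the determinant undecided up to sign; the sign is read off at [t = 0], and one-parameter
   subgroups connect the frame to the identity. *)
From mathcomp Require Import ssreflect ssrfun ssrbool.
From Stdlib Require Import Reals Lra Psatz.
From Coquelicot Require Import Coquelicot.
Require Import Defs.
Local Open Scope R_scope.

(** * Differentiability classes on strips *)

(* Coquelicot often leaves equations in a canonical-structure projection of R,
   which ring and field do not recognize. *)
Ltac as_R := lazymatch goal with |- @eq _ ?x ?y => change (@eq R x y) end.

(* The domain restricts the first variable only. *)
Fixpoint CkOn (D : R -> Prop) (n : nat) (f : R -> R -> R) : Prop :=
  (forall x y, D x -> continuity_2d_pt f x y) /\
  match n with
  | O => True
  | S n' => exists fx fy : R -> R -> R,
      (forall x y, D x -> is_derive (fun u => f u y) x (fx x y)) /\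
      (forall x y, D x -> is_derive (f x) y (fy x y)) /\
      CkOn D n' fx /\ CkOn D n' fy
  end.

Lemma CkOn_continuity D n f x y : CkOn D n f -> D x -> continuity_2d_pt f x y.
Proof. by case: n => [|n] [H _]; apply: H. Qed.

Lemma CkOn_pred D n f : CkOn D (S n) f -> CkOn D n f.
Proof.
elim: n f => [|n IH] f; first by case=> H _; split.
case=> H [fx [fy [H1 [H2 [H3 H4]]]]]; split=> //.
by exists fx, fy; split=> //; split=> //; split; apply: IH.
Qed.

Lemma CkOn_const D n c : CkOn D n (fun _ _ => c).
Proof.
elim: n c => [|n IH] c; split=> //; try by move=> *; apply: continuity_2d_pt_const.
exists (fun _ _ => 0), (fun _ _ => 0); split; first by move=> *; exact: is_derive_const.
by split; [move=> *; exact: is_derive_const | split].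
Qed.

Lemma CkOn_fst D n : CkOn D n (fun x _ => x).
Proof.
case: n => [|n]; split=> //; try by move=> *; apply: continuity_2d_pt_id1.
exists (fun _ _ => 1), (fun _ _ => 0); split; first by move=> *; apply: is_derive_id.
split; first by move=> *; apply: is_derive_const.
by split; apply: CkOn_const.
Qed.

Lemma CkOn_snd D n : CkOn D n (fun _ y => y).
Proof.
case: n => [|n]; split=> //; try by move=> *; apply: continuity_2d_pt_id2.
exists (fun _ _ => 0), (fun _ _ => 1); split; first by move=> *; apply: is_derive_const.
split; first by move=> *; apply: is_derive_id.
by split; apply: CkOn_const.
Qed.

Lemma CkOn_plus D n f g : CkOn D n f -> CkOn D n g -> CkOn D n (fun x y => f x y + g x y).
Proof.
elim: n f g => [|n IH] f g.
  by case=> Hf _ [Hg _]; split=> // x y Dx; apply: continuity_2d_pt_plus; [apply: Hf|apply: Hg].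
case=> Hf [fx [fy [F1 [F2 [F3 F4]]]]] [Hg [gx [gy [G1 [G2 [G3 G4]]]]]]; split.
  by move=> x y Dx; apply: continuity_2d_pt_plus; [apply: Hf|apply: Hg].
exists (fun x y => fx x y + gx x y), (fun x y => fy x y + gy x y); split.
  by move=> x y Dx; apply: (is_derive_plus (K := R_AbsRing) (V := R_NormedModule)); [apply: F1|apply: G1].
split.
  by move=> x y Dx; apply: (is_derive_plus (K := R_AbsRing) (V := R_NormedModule)); [apply: F2|apply: G2].
by split; apply: IH.
Qed.

Lemma is_derive_val (f : R -> R) (t l l' : R) : is_derive f t l -> l = l' -> is_derive f t l'.
Proof. by move=> H <-. Qed.

Lemma is_derive_Rmult (f g : R -> R) x df dg :
  is_derive f x df -> is_derive g x dg ->
  is_derive (fun y => f y * g y) x (df * g x + f x * dg).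
Proof. by move=> Hf Hg; apply: (is_derive_mult f g) => // n m; apply: Rmult_comm. Qed.

Lemma CkOn_mult D n f g : CkOn D n f -> CkOn D n g -> CkOn D n (fun x y => f x y * g x y).
Proof.
elim: n f g => [|n IH] f g.
  by case=> Hf _ [Hg _]; split=> // x y Dx; apply: continuity_2d_pt_mult; [apply: Hf|apply: Hg].
move=> Cf Cg; move: (CkOn_pred _ _ _ Cf) (CkOn_pred _ _ _ Cg) => Cf' Cg'.
case: Cf => Hf [fx [fy [F1 [F2 [F3 F4]]]]]; case: Cg => Hg [gx [gy [G1 [G2 [G3 G4]]]]]; split.
  by move=> x y Dx; apply: continuity_2d_pt_mult; [apply: Hf|apply: Hg].
exists (fun x y => fx x y * g x y + f x y * gx x y), (fun x y => fy x y * g x y + f x y * gy x y).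
split; first by move=> x y Dx; apply: (is_derive_Rmult (fun u => f u y) (fun u => g u y)); [apply: F1|apply: G1].
split; first by move=> x y Dx; apply: (is_derive_Rmult (f x) (g x)); [apply: F2|apply: G2].
by split; apply: CkOn_plus; apply: IH.
Qed.

Lemma CkOn_ext D n f g : (forall x y, f x y = g x y) -> CkOn D n f -> CkOn D n g.
Proof.
move=> E; case: n => [|n] [H H']; split=> //.
- by move=> x y Dx; apply: continuity_2d_pt_ext (H x y Dx).
- by move=> x y Dx; apply: continuity_2d_pt_ext (H x y Dx).
case: H' => fx [fy [F1 [F2 [F3 F4]]]]; exists fx, fy; split.
  by move=> x y Dx; apply: is_derive_ext (F1 x y Dx).
split=> //.
by move=> x y Dx; apply: is_derive_ext (F2 x y Dx).
Qed.

Lemma CkOn_opp D n f : CkOn D n f -> CkOn D n (fun x y => - f x y).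
Proof.
move=> Cf; apply: CkOn_ext (CkOn_mult D n _ _ (CkOn_const D n (-1)) Cf) => x y.
by rewrite /=; ring.
Qed.

Lemma CkOn_minus D n f g : CkOn D n f -> CkOn D n g -> CkOn D n (fun x y => f x y - g x y).
Proof. by move=> Cf Cg; apply: CkOn_plus => //; apply: CkOn_opp. Qed.

Lemma CkOn_inv D n f :
  (forall x y, D x -> f x y <> 0) -> CkOn D n f -> CkOn D n (fun x y => / f x y).
Proof.
move=> N0; elim: n => [|n IH].
  by case=> H _; split=> // x y Dx; apply: continuity_2d_pt_inv; [apply: H|apply: N0].
move=> Cf; have {}IH := IH (CkOn_pred _ _ _ Cf).
case: Cf => H [fx [fy [F1 [F2 [F3 F4]]]]]; split.
  by move=> x y Dx; apply: continuity_2d_pt_inv; [apply: H|apply: N0].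
exists (fun x y => (- fx x y) * (/ f x y * / f x y)), (fun x y => (- fy x y) * (/ f x y * / f x y)); split.
  move=> x y Dx; have -> : - fx x y * (/ f x y * / f x y) = - fx x y / f x y ^ 2 by field; apply: N0.
  by apply: (is_derive_inv (fun u => f u y)); [apply: F1|apply: N0].
split.
  move=> x y Dx; have -> : - fy x y * (/ f x y * / f x y) = - fy x y / f x y ^ 2 by field; apply: N0.
  by apply: (is_derive_inv (f x)); [apply: F2|apply: N0].
by split; apply: CkOn_mult; (try by apply: CkOn_opp); apply: CkOn_mult.
Qed.

Lemma CkOn_div D n f g : (forall x y, D x -> g x y <> 0) ->
  CkOn D n f -> CkOn D n g -> CkOn D n (fun x y => f x y / g x y).
Proof. by move=> N0 Cf Cg; apply: CkOn_mult => //; apply: CkOn_inv. Qed.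

Lemma continuity_2d_pt_sqrt f x y :
  continuity_2d_pt f x y -> continuity_2d_pt (fun u v => sqrt (f u v)) x y.
Proof. 
move=> H; apply: (continuity_1d_2d_pt_comp sqrt f) => //.
by apply/continuity_pt_filterlim; apply: continuous_sqrt.
Qed.

Lemma CkOn_sqrt D n f :
  (forall x y, D x -> 0 < f x y) -> CkOn D n f -> CkOn D n (fun x y => sqrt (f x y)).
Proof.
move=> N0; elim: n => [|n IH].
  by case=> H _; split=> // x y Dx; apply: continuity_2d_pt_sqrt; apply: H.
move=> Cf; have {}IH := IH (CkOn_pred _ _ _ Cf).
case: Cf => H [fx [fy [F1 [F2 [F3 F4]]]]]; split.
  by move=> x y Dx; apply: continuity_2d_pt_sqrt; apply: H.
have S0 x y : D x -> 2 * sqrt (f x y) <> 0.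
  by move=> Dx; have := sqrt_lt_R0 _ (N0 x y Dx); lra.
exists (fun x y => fx x y * / (2 * sqrt (f x y))), (fun x y => fy x y * / (2 * sqrt (f x y))); split.
  by move=> x y Dx; apply: (is_derive_sqrt (fun u => f u y)); [apply: F1|apply: N0].
split.
  by move=> x y Dx; apply: (is_derive_sqrt (f x)); [apply: F2|apply: N0].
by split; apply: CkOn_mult => //; apply: CkOn_inv => //; apply: CkOn_mult => //; apply: CkOn_const.
Qed.

Lemma continuity_2d_pt_snd (f : R -> R) x y :
  continuous f y -> continuity_2d_pt (fun _ => f) x y.
Proof.
move=> Hf; apply/continuity_2d_pt_filterlim => /=.
by apply: (filterlim_comp _ _ _ snd f _ (locally y)) => // P [e He]; exists e => z [_ /He].
Qed.

Lemma CkOn_of_derive D n f df :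
  (forall y, is_derive f y (df y)) -> CkOn D n (fun _ => df) -> CkOn D (S n) (fun _ => f).
Proof.
move=> Hf Hdf; split.
  by move=> x y _; apply: continuity_2d_pt_snd; apply: ex_derive_continuous; exists (df y).
exists (fun _ _ => 0), (fun _ => df); split; first by move=> *; exact: is_derive_const.
by split; [|split; [exact: CkOn_const|]].
Qed.

Lemma is_derive_Rscal (f : R -> R) c x df :
  is_derive f x df -> is_derive (fun y => c * f y) x (c * df).
Proof. by move=> H; apply: (is_derive_scal f). Qed.

Lemma CkOn_cos_sin D n c :
  CkOn D n (fun _ y => cos (c * y)) /\ CkOn D n (fun _ y => sin (c * y)).
Proof.
have C1 y : is_derive (fun y => cos (c * y)) y (- c * sin (c * y)) by auto_derive => //; ring.
have C2 y : is_derive (fun y => sin (c * y)) y (c * cos (c * y)) by auto_derive => //; ring.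
elim: n => [|n [IH1 IH2]].
  by split; split=> // x y _; apply: continuity_2d_pt_snd; apply: ex_derive_continuous; eexists.
split.
  apply: CkOn_of_derive (fun y => C1 y) _.
  by apply: (CkOn_mult _ _ (fun _ _ => - c)) => //; exact: CkOn_const.
apply: CkOn_of_derive (fun y => C2 y) _.
by apply: (CkOn_mult _ _ (fun _ _ => c)) => //; exact: CkOn_const.
Qed.

Definition dx (f : R -> R -> R) (x y : R) : R := Derive (fun u => f u y) x.
Definition dy (f : R -> R -> R) (x y : R) : R := Derive (f x) y.

Section OpenStrip.
Variable D : R -> Prop.
Hypothesis oD : open D.

Lemma strip_locally (P : R -> R -> Prop) x y : (forall u v, D u -> P u v) -> D x -> locally_2d P x y.
Proof. by move=> H /oD [e He]; exists e => u v hu _; apply: H; apply: He. Qed.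

Lemma CkOn_ext_on n f g : (forall x y, D x -> f x y = g x y) -> CkOn D n f -> CkOn D n g.
Proof.
move=> E; have C : (forall x y, D x -> continuity_2d_pt f x y) -> forall x y, D x -> continuity_2d_pt g x y.
  move=> H x y Dx; refine (continuity_2d_pt_ext_loc f _ _ _ _ (H x y Dx)).
  exact: strip_locally.
case: n => [|n] [H H']; first by split=> //; apply: C.
split; first exact: C.
case: H' => fx [fy [F1 [F2 [F3 F4]]]]; exists fx, fy; split.
  move=> x y Dx; apply: is_derive_ext_loc (F1 x y Dx).
  by apply: filter_imp (oD x Dx) => u /E.
split=> //.
by move=> x y Dx; apply: is_derive_ext (F2 x y Dx) => t; apply: E.
Qed.

Lemma CkOn_is_derive_dx n f x y : CkOn D (S n) f -> D x -> is_derive (fun u => f u y) x (dx f x y).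
Proof. by case=> _ [fx [fy [F1 _]]] Dx; apply: Derive_correct; exists (fx x y); apply: F1. Qed.

Lemma CkOn_is_derive_dy n f x y : CkOn D (S n) f -> D x -> is_derive (f x) y (dy f x y).
Proof. by case=> _ [fx [fy [_ [F2 _]]]] Dx; apply: Derive_correct; exists (fy x y); apply: F2. Qed.

Lemma CkOn_dx n f : CkOn D (S n) f -> CkOn D n (dx f).
Proof.
case=> _ [fx [fy [F1 [_ [C _]]]]]; apply: CkOn_ext_on C => x y Dx.
by symmetry; apply: is_derive_unique; apply: F1.
Qed.

Lemma CkOn_dy n f : CkOn D (S n) f -> CkOn D n (dy f).
Proof.
case=> _ [fx [fy [_ [F2 [_ C]]]]]; apply: CkOn_ext_on C => x y Dx.
by symmetry; apply: is_derive_unique; apply: F2.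
Qed.

Lemma dx_dy n f x y : CkOn D (S (S n)) f -> D x -> dx (dy f) x y = dy (dx f) x y.
Proof.
move=> C Dx; have Cx := CkOn_dx _ _ C; have Cy := CkOn_dy _ _ C.
apply: (Schwarz f x y).
- apply: strip_locally Dx => u v Du.
  split; first by eexists; exact: CkOn_is_derive_dx C Du.
  split; first by eexists; exact: CkOn_is_derive_dy C Du.
  split; first by eexists; exact: CkOn_is_derive_dx Cy Du.
  by eexists; exact: CkOn_is_derive_dy Cx Du.
- exact: CkOn_continuity (CkOn_dx _ _ Cy) Dx.
- exact: CkOn_continuity (CkOn_dy _ _ Cx) Dx.
Qed.

(** Schwarz's theorem, applied once per derivative in [y]. Through it the variation of the m-th
    derivative of a lift becomes the m-th derivative of a single variation field. *)
Lemma dx_dy_iter n f m x y : CkOn D (S (n + m)) f -> D x ->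
  dx (Nat.iter m dy f) x y = Nat.iter m dy (dx f) x y.
Proof.
elim: m n f y => [|m IH] n f y C Dx //; rewrite Nat.add_succ_r in C.
have CI k p : CkOn D (k + p) f -> CkOn D k (Nat.iter p dy f).
  elim: p k => [|p IHp] k; first by rewrite Nat.add_0_r.
  by rewrite -Nat.add_succ_comm => /IHp /CkOn_dy.
rewrite /= (dx_dy n); last by [].
  by apply: Derive_ext => t; apply: (IH (S n)).
exact: CI.
Qed.

Lemma continuous_dx f x y : CkOn D 1 f -> D x -> continuous (dx f x) y.
Proof.
move=> /CkOn_dx C Dx.
have /continuity_2d_pt_filterlim h := CkOn_continuity _ _ _ x y C Dx.
apply: (filterlim_comp _ _ _ (fun t => (x, t)) (fun z : R * R => dx f (fst z) (snd z)) _ _ _ _ h).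
by move=> P [d Hd]; exists d => z hz; apply: Hd; split=> //; apply: ball_center.
Qed.

Lemma is_derive_RInt_CkOn f x a b : CkOn D 1 f -> D x ->
  is_derive (fun u => RInt (f u) a b) x (RInt (dx f x) a b).
Proof.
move=> C Dx; apply: (is_derive_RInt_param f).
- by apply: filter_imp (oD x Dx) => u Du t _; eexists; exact: CkOn_is_derive_dx C Du.
- by move=> t _; exact: CkOn_continuity (CkOn_dx _ _ C) Dx.
- apply: filter_imp (oD x Dx) => u Du; apply: ex_RInt_continuous => t _.
  by apply: ex_derive_continuous; eexists; exact: CkOn_is_derive_dy C Du.
Qed.

End OpenStrip.

(** * Jacobi elliptic functions *)

Lemma derive_zero_const (f : R -> R) :
  (forall t, is_derive f t 0) -> forall s t, f s = f t.
Proof.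
move=> H s t; have [|c [_]] := MVT_gen f s t (fun _ => 0) (fun x _ => H x).
  by move=> x _; apply: derivable_continuous_pt; exists 0; apply/is_derive_Reals.
by lra.
Qed.

Lemma derive_pos_lt (f f' : R -> R) :
  (forall t, is_derive f t (f' t)) -> (forall t, 0 < f' t) -> forall s t, s < t -> f s < f t.
Proof.
move=> H H0 s t st; have [|c [_]] := MVT_gen f s t f' (fun x _ => H x).
  by move=> x _; apply: derivable_continuous_pt; exists (f' x); apply/is_derive_Reals.
by have := H0 c; nra.
Qed.

(** A slope of at least 1 makes [g] 1-Lipschitz and increasing; this supplies the continuity and the
    bounds that the inverse function theorem requires on [[u - 1, u + 1]]. *)
Lemma is_derive_right_inverse (G G' g : R -> R) :
  (forall x, is_derive G x (G' x)) -> (forall x, 1 <= G' x) -> (forall u, G (g u) = u) ->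
  forall u, is_derive g u (/ G' (g u)).
Proof.
move=> HG H1 Hg u.
have cG x : continuity_pt G x.
  by apply: derivable_continuous_pt; exists (G' x); apply/is_derive_Reals.
have lip v w : Rabs (g v - g w) <= Rabs (v - w).
  have [c [_ E]] := MVT_gen G (g w) (g v) G' (fun x _ => HG x) (fun x _ => cG x).
  rewrite !Hg in E; rewrite E Rabs_mult.
  have := H1 c; have := Rabs_pos (g v - g w).
  by move=> ? ?; rewrite (Rabs_pos_eq (G' c)); nra.
have cg : continuity_pt g u.
  move=> e He; exists e; split=> // v [_]; rewrite /= /R_dist => h.
  by apply: Rle_lt_trans (lip v u) h.
have Prf a : derivable_pt G a by exists (G' a); apply/is_derive_Reals.
have incr v w : v <= w -> g v <= g w.
  move=> h; case: (Rle_lt_dec (g v) (g w)) => // h'.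
  have := derive_pos_lt G G' HG (fun t => Rlt_le_trans _ _ _ Rlt_0_1 (H1 t)) _ _ h'.
  by rewrite !Hg; lra.
have I : g (u - 1) <= g u <= g (u + 1) by split; apply: incr; lra.
have E : derive_pt G (g u) (Prf (g u)) = G' (g u).
  by rewrite Derive_Reals; apply: is_derive_unique.
have := Ranalysis5.derivable_pt_lim_recip_interv G g (u - 1) (u + 1) u (fun a _ => Prf a) cg _ _ I.
rewrite E => H; apply/is_derive_Reals.
have -> : / G' (g u) = 1 / G' (g u) by have := H1 (g u) => ?; field; lra.
by apply: H; [lra|lra|move=> x _; rewrite /comp Hg|have := H1 (g u); lra].
Qed.

Section JacobiAmplitude.
Variable m : R.
Hypothesis m01 : 0 <= m < 1.

Let w x := sqrt (1 - m * sin x ^ 2).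
Let G x := RInt (fun th => / sqrt (1 - m * sin th ^ 2)) 0 x.

Let rad_pos x : 0 < 1 - m * sin x ^ 2 <= 1.
Proof. by have := sin2_cos2 x; rewrite /Rsqr => ?; have := pow2_ge_0 (cos x); nra. Qed.

Let w_bound x : 0 < w x <= 1.
Proof.
have [h1 h2] := rad_pos x; split; first exact: sqrt_lt_R0.
by rewrite -sqrt_1; apply: sqrt_le_1; lra.
Qed.

Let cont x : continuous (fun th => / sqrt (1 - m * sin th ^ 2)) x.
Proof.
have [h _] := rad_pos x; have [h' _] := w_bound x; rewrite /w in h'.
apply: (ex_derive_continuous (fun th => / sqrt (1 - m * sin th ^ 2))).
by auto_derive; split; [lra|split=> //; apply: Rgt_not_eq].
Qed.

Let dG x : is_derive G x (/ w x).
Proof.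
apply: is_derive_RInt (cont x).
by apply: filter_forall => y; apply: RInt_correct; apply: ex_RInt_continuous => z _.
Qed.

Let dG1 x : 1 <= / w x.
Proof. by have [h1 h2] := w_bound x; rewrite -Rinv_1; apply: Rinv_le_contravar. Qed.

Let G0 : G 0 = 0. Proof. exact: RInt_point. Qed.

Let Ginj x y : G x = G y -> x = y.
Proof.
have inc := derive_pos_lt G _ dG (fun t => Rlt_le_trans _ _ _ Rlt_0_1 (dG1 t)).
by move=> E; case: (Rtotal_order x y) => [/inc|[|/inc]] //; lra.
Qed.

Let cG x : continuity_pt G x.
Proof. by apply: derivable_continuous_pt; exists (/ w x); apply/is_derive_Reals. Qed.

Let Gsurj u : exists x, G x = u.
Proof.
have slope x y : x <= y -> y - x <= G y - G x.
  move=> xy; have [c [_ ->]] := MVT_gen G x y _ (fun x _ => dG x) (fun x _ => cG x).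
  by have := dG1 c; nra.
have [x [_ Hx]] : {x | Rmin (- Rabs u) (Rabs u) <= x <= Rmax (- Rabs u) (Rabs u) /\ G x = u}.
  apply: IVT_gen => //.
  have h0 := Rabs_pos u; have h1 := slope 0 (Rabs u) h0; have h2 := slope (- Rabs u) 0 ltac:(lra).
  have := Rabs_pos u; have := Rle_abs u; have := Rle_abs (- u); rewrite Rabs_Ropp G0 in h1 h2 *.
  move=> ? ? ?; split.
    by apply: Rle_trans (Rmin_l _ _) _; lra.
  by apply: Rle_trans (Rmax_r _ _); lra.
by exists x.
Qed.

(** [jacobi_am] is a definite description, so its defining equation is available only once existence
    and uniqueness of the solution are known. *)
Let amE u : G (jacobi_am u m) = u.
Proof.
apply: (iota_correct (fun phi : R => G phi = u)).
have [x Hx] := Gsurj u; exists x; split=> // y Hy; apply: Ginj; congruence.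
Qed.

Lemma is_derive_am u : is_derive (fun u => jacobi_am u m) u (sqrt (1 - m * sin (jacobi_am u m) ^ 2)).
Proof.
have := is_derive_right_inverse G _ (fun u => jacobi_am u m) dG dG1 amE u.
by rewrite Rinv_inv.
Qed.

Lemma am_0 : jacobi_am 0 m = 0.
Proof. by apply: Ginj; rewrite amE. Qed.

(** The integrand depends on [sin ^ 2] and has period [PI], so [G (x + PI) - G x] is constant. The
    [K] found here is twice the complete elliptic integral of the first kind. *)
Lemma am_quasi_period :
  exists K, 0 < K /\ jacobi_am K m = PI /\
    forall u, jacobi_am (u + K) m = jacobi_am u m + PI.
Proof.
have add x : G (x + PI) = G x + G PI.
  have D y : is_derive (fun y => G (y + PI) - G y) y 0.
    have -> : 0 = / w (y + PI) - / w y.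
      by rewrite /w neg_sin -Rsqr_pow2 -Rsqr_neg Rsqr_pow2; lra.
    apply: (is_derive_minus (K := R_AbsRing) (V := R_NormedModule)) (dG y).
    have H : is_derive (fun z => z + PI) y 1 by auto_derive.
    by have := is_derive_comp G _ y _ _ (dG (y + PI)) H; rewrite scal_one.
  have := derive_zero_const _ D x 0; rewrite Rplus_0_l G0; lra.
exists (G PI); split; last split.
- rewrite -G0; apply: (derive_pos_lt G _ dG) PI_RGT_0 => t.
  by have := dG1 t; lra.
- by apply: Ginj; rewrite amE.
- by move=> u; apply: Ginj; rewrite add !amE.
Qed.

End JacobiAmplitude.

(** * The curvature function and its minimal period *)

Section KabFacts.
Variables a b : R.
Hypotheses (b0 : 0 < b) (ba : b < a).

Let psi t := jacobi_am (sqrt a * t) ((a - b) / a).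

Lemma modulus_bound : 0 <= (a - b) / a < 1.
Proof.
split; first by apply: Rdiv_le_0_compat; lra.
by apply/(Rmult_lt_reg_r a); first lra; rewrite /Rdiv Rmult_assoc Rinv_l; lra.
Qed.

Lemma kab_dn t : kab a b t = sqrt a * sqrt (1 - (a - b) / a * sin (psi t) ^ 2).
Proof. by rewrite /kab; case: Rlt_dec => [h|_] //; lra. Qed.

Lemma kab_psi t : kab a b t = sqrt (a - (a - b) * sin (psi t) ^ 2).
Proof.
rewrite kab_dn -sqrt_mult_alt; last lra.
by congr sqrt; field; lra.
Qed.

Let sin2 t : 0 <= sin (psi t) ^ 2 <= 1.
Proof. by have := sin2_cos2 (psi t); rewrite /Rsqr; nra. Qed.

Lemma kab_sq t : kab a b t ^ 2 = a - (a - b) * sin (psi t) ^ 2.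
Proof. by rewrite kab_psi pow2_sqrt //; have := sin2 t; nra. Qed.

Lemma kab_sq_bound t : b <= kab a b t ^ 2 <= a.
Proof. by rewrite kab_sq; have := sin2 t; nra. Qed.

Lemma kab_pos t : 0 < kab a b t.
Proof. by rewrite kab_psi; apply: sqrt_lt_R0; have := sin2 t; nra. Qed.

Lemma is_derive_psi t : is_derive psi t (kab a b t).
Proof.
rewrite kab_dn; have H : is_derive (fun t => sqrt a * t) t (sqrt a) by auto_derive => //; ring.
exact: is_derive_comp (fun u => jacobi_am u ((a - b) / a)) _ t _ _ (is_derive_am _ modulus_bound _) H.
Qed.

Definition kab' t := - (a - b) * sin (psi t) * cos (psi t).

Lemma is_derive_kab t : is_derive (kab a b) t (kab' t).
Proof.
apply: (is_derive_ext (fun t => sqrt (a - (a - b) * sin (psi t) ^ 2))); first by move=> s; rewrite kab_psi.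
have P := is_derive_psi t; have E := is_derive_unique _ _ _ P; have S := sin2 t.
have k0 := kab_pos t; have kE := kab_psi t.
auto_derive; first by split; [exists (kab a b t)|split=> //; nra].
rewrite (_ : sin (psi t) * (sin (psi t) * 1) = sin (psi t) ^ 2) //.
change (Derive (fun x => psi x) t) with (Derive psi t).
rewrite E /kab' /Rminus in kE *; rewrite -kE; field; lra.
Qed.

Lemma kab'_sq t : kab' t ^ 2 = (a - kab a b t ^ 2) * (kab a b t ^ 2 - b).
Proof.
rewrite kab_sq /kab'; have := sin2_cos2 (psi t); rewrite /Rsqr => H.
have C : cos (psi t) ^ 2 = 1 - sin (psi t) ^ 2 by nra.
transitivity ((a - b) ^ 2 * sin (psi t) ^ 2 * cos (psi t) ^ 2); first by ring.
by rewrite C; ring.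
Qed.

Lemma is_derive_kab' t : is_derive kab' t (kab a b t * (a + b - 2 * kab a b t ^ 2)).
Proof.
have P := is_derive_psi t; have E := is_derive_unique _ _ _ P.
rewrite kab_sq /kab'; auto_derive; first by split; [exists (kab a b t)|split=> //; exists (kab a b t)].
change (Derive (fun x => psi x) t) with (Derive psi t); rewrite E.
have := sin2_cos2 (psi t); rewrite /Rsqr => H.
have C : cos (psi t) * cos (psi t) = 1 - sin (psi t) ^ 2 by nra.
transitivity (- (a - b) * kab a b t * (cos (psi t) * cos (psi t) - sin (psi t) ^ 2)); first by ring.
by rewrite C; ring.
Qed.

(** Minimality: [kab ^ 2] has its maximum [a] at 0, so any period is a zero of [sin psi]; since
    [psi] increases strictly from 0, the first positive zero is where [psi] equals [PI]. *)
Lemma omega_spec : 0 < omega a b /\ psi (omega a b) = PI /\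
  forall t, kab a b (t + omega a b) = kab a b t.
Proof.
have a0 : 0 < sqrt a by apply: sqrt_lt_R0; lra.
have [K [K0 [amK add]]] := am_quasi_period _ modulus_bound.
have psiT t : psi (t + K / sqrt a) = psi t + PI.
  by rewrite /psi -add; congr jacobi_am; field; lra.
have psi0 : psi 0 = 0 by rewrite /psi Rmult_0_r (am_0 _ modulus_bound).
have psiK : psi (K / sqrt a) = PI by rewrite -[K / _]Rplus_0_l psiT psi0; lra.
have kT t : kab a b (t + K / sqrt a) = kab a b t.
  rewrite !kab_psi psiT neg_sin; congr (sqrt (_ - _ * _)); ring.
have T0 : 0 < K / sqrt a by apply: Rdiv_lt_0_compat.
have inc := derive_pos_lt psi _ is_derive_psi kab_pos.
have minT T' : is_period (kab a b) T' -> K / sqrt a <= T'.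
  case=> T'0 HT'; have k2 := kab_sq T'.
  have := HT' 0; rewrite Rplus_0_l => E; rewrite E kab_sq psi0 sin_0 in k2.
  have s0 : sin (psi T') = 0 by have : sin (psi T') ^ 2 = 0; [apply: (Rmult_eq_reg_l (a - b)); lra|rewrite -Rsqr_pow2; exact: Rsqr_0_uniq].
  have p0 : 0 < psi T' by rewrite -psi0; apply: inc.
  case: (Rle_lt_dec (K / sqrt a) T') => // /inc; rewrite psiK => h.
  by have := sin_gt_0 _ p0 h; lra.
have -> : omega a b = K / sqrt a; last by [].
have [|h1 h2] := iota_correct (fun T => is_period (kab a b) T /\ forall T', is_period (kab a b) T' -> T <= T').
  exists (K / sqrt a); split=> [|T' [h1 h2]]; first by split.
  by apply: Rle_antisym; [apply: minT|apply: h2; split].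
by apply: Rle_antisym; [apply: h2; split|apply: minT].
Qed.

End KabFacts.

(** * The period map *)

(* The left side is the derivative in [c], at fixed [c ^ 2 - d ^ 2], of the
   integrand [m / (N * W)] of the third kind, where [w = cos theta]. Its residues
   do not depend on [c], so up to the theta-derivative of
   [- m * s * K / (C * d * N * W)] it is a differential of the second kind. *)
Lemma third_kind_identity sg c d C w s W m :
  sg = 1 \/ sg = -1 -> W ^ 2 = c + d * w -> C ^ 2 = 1 + d ^ 2 -> s ^ 2 = 1 - w ^ 2 ->
  0 < C -> 0 < d -> 0 < W -> 0 < C - sg * d * w ->
  let N := C - sg * d * w in let K := C - sg * (c + d * w) in
  sg * m / (2 * C) / (N * W) - m * (c / C - sg * (c * w / d)) / (N ^ 2 * W)
    - m * (1 + c * w / d) / (2 * N * W ^ 3)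
  = m * w / (2 * C * d * W)
    - m / (C * d) * (w * K / (N * W) + sg * d * s ^ 2 / (N * W)
                     - K * sg * d * s ^ 2 / (N ^ 2 * W) + K * d * s ^ 2 / (2 * N * W ^ 3)).
Proof.
move=> Hsg HW HC -> C0 d0 W0 N0 N K.
have Ec : c = W ^ 2 - d * w by lra.
(* [tau] parametrizes the hyperbola [C ^ 2 = 1 + d ^ 2] rationally. With [c] and [s ^ 2] eliminated
   as well, no side relation is left and [field] decides the identity. *)
pose tau := d / (1 + C).
have t01 : 0 < tau < 1.
  have dC : d < C by nra.
  by rewrite /tau; split; [apply: Rdiv_lt_0_compat; lra|apply/(Rmult_lt_reg_r (1 + C)); first lra; rewrite /Rdiv Rmult_assoc Rinv_l; lra].
have t1 : 0 < 1 - tau ^ 2 by nra.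
have T : d = tau * (1 + C) by rewrite /tau; field; lra.
have Q : (C - 1) = tau ^ 2 * (1 + C).
  by apply: (Rmult_eq_reg_r (1 + C)); [rewrite T in HC; nra|lra].
have EC : C = (1 + tau ^ 2) / (1 - tau ^ 2).
  by apply: (Rmult_eq_reg_r (1 - tau ^ 2)); [field_simplify; lra|lra].
have Ed : d = 2 * tau / (1 - tau ^ 2) by rewrite T EC; field; lra.
rewrite {}/N {}/K {}Ec.
case: Hsg => E; subst sg.
- have N1 : 0 < 1 + tau ^ 2 - 2 * tau * w.
    rewrite EC Ed in N0; apply: (Rmult_lt_reg_r (/ (1 - tau ^ 2))); first exact: Rinv_0_lt_compat.
    by rewrite Rmult_0_l; apply: Rlt_le_trans N0 _; apply: Req_le; field; lra.
  rewrite {}Ed {}EC; field; repeat split; nra.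
- have N1 : 0 < 1 + tau ^ 2 + 2 * tau * w.
    rewrite EC Ed in N0; apply: (Rmult_lt_reg_r (/ (1 - tau ^ 2))); first exact: Rinv_0_lt_compat.
    by rewrite Rmult_0_l; apply: Rlt_le_trans N0 _; apply: Req_le; field; lra.
  rewrite {}Ed {}EC; field; repeat split; nra.
Qed.

Section PeriodMap.
Variable sg : R.
Hypothesis sgE : sg = 1 \/ sg = -1.

(* In terms of the parameters a, b: [g = sqrt (a * b)], [c = (a + b) / 2],
   [semi_diff = (a - b) / 2], and [pole] is mu for [sg = 1] and upsilon for
   [sg = -1]. *)
Definition semi_diff (g c : R) := sqrt (c ^ 2 - g ^ 2).
Definition semi_sum (g c : R) := sqrt (1 + semi_diff g c ^ 2).
Definition pole (g c : R) := sqrt (c + sg * semi_sum g c).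
(** The curvature as a function of the Jacobi amplitude [y], with [sin y ^ 2] expressed by the
    double angle. *)
Definition dn_at (g c y : R) := sqrt (c + semi_diff g c * cos (2 * y)).
(** This is [sg * (pole ^ 2 - dn_at ^ 2)], which is positive for both signs. *)
Definition pole_gap (g c y : R) := semi_sum g c - sg * semi_diff g c * cos (2 * y).

Definition period_integrand (g c y : R) := pole g c / (pole_gap g c y * dn_at g c y).

Lemma param_ineqs g c y : 1 < g -> g < c ->
  0 < semi_diff g c /\ 0 < semi_sum g c /\ 0 < c + sg * semi_sum g c /\
  0 < c + semi_diff g c * cos (2 * y) /\ 0 < pole_gap g c y /\
  semi_diff g c ^ 2 = c ^ 2 - g ^ 2 /\ semi_sum g c ^ 2 = 1 + semi_diff g c ^ 2.
Proof.
move=> g1 gc; have d0 : 0 < semi_diff g c by apply: sqrt_lt_R0; nra.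
have d2 : semi_diff g c ^ 2 = c ^ 2 - g ^ 2 by rewrite pow2_sqrt //; nra.
have C0 : 0 < semi_sum g c by apply: sqrt_lt_R0; nra.
have C2 : semi_sum g c ^ 2 = 1 + semi_diff g c ^ 2 by rewrite pow2_sqrt //; nra.
have [cos_ge cos_le] := COS_bound (2 * y).
have lt_sq u v : 0 < v -> u ^ 2 < v ^ 2 -> u < v.
  by move=> v0 h; case: (Rle_lt_dec v u) => // vu; nra.
have Cc : semi_sum g c < c by apply: lt_sq; nra.
have dc : semi_diff g c < c by apply: lt_sq; nra.
have dC : semi_diff g c < semi_sum g c by apply: lt_sq; nra.
rewrite /pole_gap; do 2 split=> //.
split; first by case: sgE => ->; lra.
split; first by nra.
by split=> //; case: sgE => ->; nra.
Qed.

Lemma CkOn_period_integrand n g : 1 < g ->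
  CkOn (fun c => g < c) n (period_integrand g).
Proof.
move=> g1; have cst c : CkOn (fun c => g < c) n (fun _ _ => c) by apply: CkOn_const.
have id : CkOn (fun c => g < c) n (fun c _ => c) by apply: CkOn_fst.
have [co _] := CkOn_cos_sin (fun c => g < c) n 2.
have dd : CkOn (fun c => g < c) n (fun c _ => semi_diff g c).
  apply: CkOn_sqrt => [c _ h|]; first by nra.
  apply: CkOn_minus => //.
  by apply: CkOn_ext (CkOn_mult _ _ _ _ id id) => c y; ring.
have CC : CkOn (fun c => g < c) n (fun c _ => semi_sum g c).
  apply: CkOn_sqrt => [c y h|]; first by have := param_ineqs _ _ y g1 h; nra.
  apply: CkOn_plus => //.
  by apply: CkOn_ext (CkOn_mult _ _ _ _ dd dd) => c y; ring.
apply: CkOn_div => [c y h|//|//].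
- have [_ [_ [_ [h4 [h5 _]]]]] := param_ineqs _ _ y g1 h.
  by apply: Rgt_not_eq; apply: Rmult_lt_0_compat => //; apply: sqrt_lt_R0.
- apply: CkOn_sqrt => [c y h|]; first by have := param_ineqs _ _ y g1 h; tauto.
  by apply: CkOn_plus => //; apply: CkOn_mult.
- apply: CkOn_mult.
    by apply: CkOn_minus => //; apply: CkOn_mult => //; apply: CkOn_mult.
  apply: CkOn_sqrt => [c y h|]; first by have := param_ineqs _ _ y g1 h; tauto.
  by apply: CkOn_plus => //; apply: CkOn_mult.
Qed.

(** The exact term of [third_kind_identity] in the variable [theta = 2 * y]; the 2 in the
    denominator compensates for [dtheta = 2 dy]. *)
Definition exact_part (g c y : R) :=
  - pole g c * sin (2 * y) * (semi_sum g c - sg * (c + semi_diff g c * cos (2 * y))) /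
  (2 * semi_sum g c * semi_diff g c * pole_gap g c y * dn_at g c y).

Lemma period_integrand_derivative g c y fx : 1 < g -> g < c ->
  is_derive (fun c => period_integrand g c y) c fx ->
  is_derive (exact_part g c) y
   (fx - pole g c * cos (2 * y) / (2 * semi_sum g c * semi_diff g c * dn_at g c y)).
Proof.
move=> g1 gc Hfx.
have [d0 [C0 [m0 [W0 [N0 [d2 C2]]]]]] := param_ineqs _ _ y g1 gc.
have [W1 m1] : 0 < dn_at g c y /\ 0 < pole g c by split; apply: sqrt_lt_R0.
have W2 : dn_at g c y ^ 2 = c + semi_diff g c * cos (2 * y) by rewrite pow2_sqrt //; lra.
have m2 : pole g c ^ 2 = c + sg * semi_sum g c by rewrite pow2_sqrt //; lra.
have s2 : sin (2 * y) ^ 2 = 1 - cos (2 * y) ^ 2.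
  by have := sin2_cos2 (2 * y); rewrite /Rsqr; lra.
have sg2 : sg * sg = 1 by case: sgE => ->; ring.
have Hd : is_derive (semi_diff g) c (c / semi_diff g c).
  rewrite /semi_diff; auto_derive; first by nra.
  by rewrite /semi_diff in d0 *; rewrite (_ : c * (c * 1) + - (g * (g * 1)) = c ^ 2 - g ^ 2); [field; lra|ring].
have HC : is_derive (semi_sum g) c (c / semi_sum g c).
  have E := is_derive_unique _ _ _ Hd.
  rewrite /semi_sum; auto_derive; first by split; [exists (c / semi_diff g c)|split=> //; nra].
  change (Derive (fun x => semi_diff g x) c) with (Derive (semi_diff g) c).
  rewrite E; rewrite /semi_sum in C0 *.
  rewrite (_ : 1 + semi_diff g c * (semi_diff g c * 1) = 1 + semi_diff g c ^ 2); [field; lra|ring].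
have Hm : is_derive (pole g) c (sg * pole g c / (2 * semi_sum g c)).
  have E := is_derive_unique _ _ _ HC.
  rewrite /pole; auto_derive; first by split; [exists (c / semi_sum g c)|split=> //; nra].
  change (Derive (fun x => semi_sum g x) c) with (Derive (semi_sum g) c).
  rewrite E -/(pole g c).
  apply: (Rmult_eq_reg_r (pole g c)); last lra.
  transitivity (sg * pole g c ^ 2 / (2 * semi_sum g c)); last by field; lra.
  rewrite m2; transitivity ((sg * sg * semi_sum g c + sg * c) / (2 * semi_sum g c)); last by field; lra.
  by rewrite sg2; field; lra.
have HW : is_derive (fun c => dn_at g c y) c ((1 + c * cos (2 * y) / semi_diff g c) / (2 * dn_at g c y)).
  have E := is_derive_unique _ _ _ Hd.
  rewrite /dn_at; auto_derive; first by split; [exists (c / semi_diff g c)|split=> //; nra].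
  change (Derive (fun x => semi_diff g x) c) with (Derive (semi_diff g) c).
  by rewrite E -/(dn_at g c y); field; lra.
have EN : is_derive (fun c => pole_gap g c y) c (c / semi_sum g c - sg * (c * cos (2 * y) / semi_diff g c)).
  have E := is_derive_unique _ _ _ Hd; have E' := is_derive_unique _ _ _ HC.
  rewrite /pole_gap; auto_derive.
    by split; [exists (c / semi_sum g c)|split=> //; exists (c / semi_diff g c)].
  change (Derive (fun x => semi_sum g x) c) with (Derive (semi_sum g) c).
  change (Derive (fun x => semi_diff g x) c) with (Derive (semi_diff g) c).
  by rewrite E E'; field; lra.
have Efx : fx = sg * pole g c / (2 * semi_sum g c) / (pole_gap g c y * dn_at g c y)
   - pole g c * (c / semi_sum g c - sg * (c * cos (2 * y) / semi_diff g c)) / (pole_gap g c y ^ 2 * dn_at g c y)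
   - pole g c * (1 + c * cos (2 * y) / semi_diff g c) / (2 * pole_gap g c y * dn_at g c y ^ 3).
  rewrite -(is_derive_unique _ _ _ Hfx); apply: is_derive_unique.
  have E1 := is_derive_unique _ _ _ Hm; have E2 := is_derive_unique _ _ _ HW.
  have E3 := is_derive_unique _ _ _ EN.
  rewrite /period_integrand; auto_derive.
    split; first by eexists; exact: Hm.
    split; first by eexists; exact: EN.
    split; first by eexists; exact: HW.
    by split=> //; apply: Rgt_not_eq; apply: Rmult_lt_0_compat.
  change (Derive (fun x => pole g x) c) with (Derive (pole g) c).
  by rewrite E1 E2 E3; field; lra.
have I := third_kind_identity sg c _ _ _ _ _ (pole g c) sgE W2 C2 s2 C0 d0 W1 N0.
rewrite /= in I; rewrite -!/(pole_gap g c y) in I.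
rewrite -[X in is_derive _ _ (X - _)]/fx Efx I /exact_part.
have DW : is_derive (dn_at g c) y (- semi_diff g c * sin (2 * y) / dn_at g c y).
  rewrite /dn_at; auto_derive; first by [].
  by rewrite -/(dn_at g c y); field; lra.
have DN : is_derive (pole_gap g c) y (2 * sg * semi_diff g c * sin (2 * y)).
  by rewrite /pole_gap; auto_derive => //; ring.
have E1 := is_derive_unique _ _ _ DW; have E2 := is_derive_unique _ _ _ DN.
auto_derive.
  split; first by eexists; exact: DN.
  split; first by eexists; exact: DW.
  by split=> //; apply: Rgt_not_eq; repeat apply: Rmult_lt_0_compat => //; lra.
change (Derive (fun x => pole_gap g c x) y) with (Derive (pole_gap g c) y).
change (Derive (fun x => dn_at g c x) y) with (Derive (dn_at g c) y).
rewrite E1 E2; field; lra.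
Qed.

Definition period (g c : R) := RInt (period_integrand g c) 0 PI.

Lemma continuous_period_integrand g c y : 1 < g -> g < c -> continuous (period_integrand g c) y.
Proof.
move=> g1 gc; apply: ex_derive_continuous; eexists.
exact: CkOn_is_derive_dy (CkOn_period_integrand 1 g g1) gc.
Qed.

Definition main_part (g c y : R) :=
  pole g c * cos (2 * y) / (2 * semi_sum g c * semi_diff g c * dn_at g c y).

Lemma continuous_main_part g c y : 1 < g -> g < c -> continuous (main_part g c) y.
Proof.
move=> g1 gc; have [d0 [C0 [m0 [W0 [N0 [d2 C2]]]]]] := param_ineqs _ _ y g1 gc.
apply: ex_derive_continuous; rewrite /main_part /dn_at; auto_derive; split; first by lra.
split=> //; apply: Rgt_not_eq; repeat apply: Rmult_lt_0_compat; try lra.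
by apply: sqrt_lt_R0.
Qed.

(** After differentiation under the integral sign the exact part contributes nothing, because
    [sin (2 * y)] vanishes at 0 and [PI]; an integral of the second kind remains. *)
Lemma is_derive_period g c : 1 < g -> g < c ->
  is_derive (period g) c (RInt (main_part g c) 0 PI).
Proof.
move=> g1 gc; have C := CkOn_period_integrand 1 g g1.
have oD : open (fun c => g < c) by apply: open_gt.
have H := is_derive_RInt_CkOn _ oD _ _ 0 PI C gc.
have -> : RInt (main_part g c) 0 PI = RInt (dx (period_integrand g) c) 0 PI; last by [].
symmetry.
have IR : is_RInt (fun y => dx (period_integrand g) c y - main_part g c y) 0 PI 0.
  have E0 : minus (exact_part g c PI) (exact_part g c 0) = 0.
    rewrite /exact_part /minus /plus /opp /= Rmult_0_r sin_0.
    by rewrite sin_2PI; rewrite /Rdiv; ring.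
  rewrite -[X in is_RInt _ _ _ X]E0; apply: (is_RInt_derive (exact_part g c)) => y _.
    by apply: period_integrand_derivative => //; exact: CkOn_is_derive_dx C gc.
  apply: (continuous_minus (dx (period_integrand g) c) (main_part g c)); first exact: continuous_dx C gc.
  exact: continuous_main_part.
have IM : is_RInt (main_part g c) 0 PI (RInt (main_part g c) 0 PI).
  by apply: RInt_correct; apply: ex_RInt_continuous => y _; apply: continuous_main_part.
apply: is_RInt_unique.
have := is_RInt_plus _ _ _ _ _ _ IR IM; rewrite plus_zero_l.
by apply: is_RInt_ext => y _; rewrite /plus /=; ring.
Qed.

(** The weight [/ dn_at] is smaller where the cosine is positive, so the negative values prevail. To
    make this quantitative, the integrand is bounded by a multiple of [cos (2 * y) / sqrt c], whose
    integral is zero, minus a positive multiple of [cos (2 * y) ^ 2]. *)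
Lemma RInt_main_part_neg g c : 1 < g -> g < c -> RInt (main_part g c) 0 PI < 0.
Proof.
move=> g1 gc.
have [d0 [C0 [m0 [_ [_ [d2 C2]]]]]] := param_ineqs _ _ 0 g1 gc.
have c0 : 0 < c by lra.
have r0 : 0 < sqrt c by apply: sqrt_lt_R0.
have rr : sqrt c * sqrt c = c by apply: sqrt_sqrt; lra.
have m1 : 0 < pole g c by apply: sqrt_lt_R0.
pose K := pole g c / (2 * semi_sum g c * semi_diff g c).
have K0 : 0 < K by apply: Rdiv_lt_0_compat => //; repeat apply: Rmult_lt_0_compat; lra.
(* The constant comes from [(W + sqrt c) * W <= 4 * c] with [W = dn_at g c y], which follows from
   [W ^ 2 <= 2 * c]. *)
pose kap := semi_diff g c / (4 * c * sqrt c).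
have kap0 : 0 < kap by apply: Rdiv_lt_0_compat => //; repeat apply: Rmult_lt_0_compat; lra.
pose maj y := K * (cos (2 * y) / sqrt c - kap * cos (2 * y) ^ 2).
have IM : is_RInt maj 0 PI (- K * kap * PI / 2).
  pose prim y := K * (sin (2 * y) / (2 * sqrt c) - kap * (y / 2 + sin (2 * y) * cos (2 * y) / 4)).
  have -> : - K * kap * PI / 2 = minus (prim PI) (prim 0).
    by rewrite /prim /minus /plus /opp /= Rmult_0_r sin_0 sin_2PI; field; lra.
  apply: (is_RInt_derive prim) => y _.
    rewrite /prim /maj; auto_derive; first by [].
    have := sin2_cos2 (2 * y); rewrite /Rsqr => h.
    have S2 : sin (2 * y) * sin (2 * y) = 1 - cos (2 * y) * cos (2 * y) by lra.
    transitivity (K * (cos (2 * y) / sqrt c -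
       kap * ((1 + cos (2 * y) * cos (2 * y) - sin (2 * y) * sin (2 * y)) / 2))); first by field; lra.
    by rewrite S2; field; lra.
  by apply: (ex_derive_continuous maj); rewrite /maj; auto_derive.
have IL : RInt (main_part g c) 0 PI <= RInt maj 0 PI.
  apply: RInt_le; first by have := PI_RGT_0; lra.
  - by apply: ex_RInt_continuous => y _; apply: continuous_main_part.
  - by eexists; exact: IM.
  move=> y _; have [_ [_ [_ [W0 [_ _]]]]] := param_ineqs _ _ y g1 gc.
  have W1 : 0 < dn_at g c y by apply: sqrt_lt_R0.
  have W2 : dn_at g c y * dn_at g c y = c + semi_diff g c * cos (2 * y) by apply: sqrt_sqrt; lra.
  have [cos_ge cos_le] := COS_bound (2 * y).
  have dc : semi_diff g c <= c by nra.
  have -> : main_part g c y = K * (cos (2 * y) / dn_at g c y) by rewrite /main_part /K; field; lra.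
  apply: Rmult_le_compat_l; first by lra.
  have E : cos (2 * y) / sqrt c - cos (2 * y) / dn_at g c y
     = semi_diff g c * cos (2 * y) ^ 2 / ((dn_at g c y + sqrt c) * dn_at g c y * sqrt c).
    have Ed : semi_diff g c * cos (2 * y) = (dn_at g c y - sqrt c) * (dn_at g c y + sqrt c) by lra.
    transitivity ((semi_diff g c * cos (2 * y)) * cos (2 * y) / ((dn_at g c y + sqrt c) * dn_at g c y * sqrt c)).
      by rewrite Ed; field; lra.
    by field; lra.
  suff : kap * cos (2 * y) ^ 2 <= semi_diff g c * cos (2 * y) ^ 2 / ((dn_at g c y + sqrt c) * dn_at g c y * sqrt c) by lra.
  have -> : kap * cos (2 * y) ^ 2 = semi_diff g c * cos (2 * y) ^ 2 / (4 * c * sqrt c).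
    by rewrite /kap; field; lra.
  apply: Rmult_le_compat_l; first by have := pow2_ge_0 (cos (2 * y)); nra.
  have den0 : 0 < (dn_at g c y + sqrt c) * dn_at g c y * sqrt c by repeat apply: Rmult_lt_0_compat; lra.
  apply: Rinv_le_contravar => //.
  apply: Rmult_le_compat_r; first lra.
  have W3 : dn_at g c y * dn_at g c y <= 2 * c by nra.
  by have := pow2_ge_0 (dn_at g c y - sqrt c); lra.
rewrite (is_RInt_unique _ _ _ _ IM) in IL.
have : 0 < K * kap * PI by apply: Rmult_lt_0_compat PI_RGT_0; exact: Rmult_lt_0_compat.
by lra.
Qed.

Lemma period_decr g c c' : 1 < g -> g < c -> c < c' -> period g c' < period g c.
Proof.
move=> g1 gc cc'.
have [||x [Hx E]] := MVT_gen (period g) c c' (fun c => RInt (main_part g c) 0 PI).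
- by move=> x [h1 _]; apply: is_derive_period => //; move: h1; rewrite Rmin_left; lra.
- move=> x [h1 _]; apply: derivable_continuous_pt; exists (RInt (main_part g x) 0 PI).
  by apply/is_derive_Reals; apply: is_derive_period => //; move: h1; rewrite Rmin_left; lra.
move: Hx; rewrite Rmin_left ?Rmax_right; try lra; move=> Hx.
by have := RInt_main_part_neg g x g1 ltac:(lra); nra.
Qed.

End PeriodMap.

(* With the half difference [d = (a - b) / 2] fixed the integrands are monotone in [c]. *)
Lemma period_fixed_diff d g g' : 0 < d -> 1 < g -> g < g' ->
  let c := sqrt (g ^ 2 + d ^ 2) in let c' := sqrt (g' ^ 2 + d ^ 2) in
  period 1 g' c' < period 1 g c /\ period (-1) g c < period (-1) g' c'.
Proof.
move=> d0 g1 gg' c c'.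
have lt_sq u v : 0 < v -> u ^ 2 < v ^ 2 -> u < v.
  by move=> v0 h; case: (Rle_lt_dec v u) => // vu; nra.
have c2 : c ^ 2 = g ^ 2 + d ^ 2 by rewrite pow2_sqrt //; nra.
have c'2 : c' ^ 2 = g' ^ 2 + d ^ 2 by rewrite pow2_sqrt //; nra.
have c0 : 0 < c by apply: sqrt_lt_R0; nra.
have c'0 : 0 < c' by apply: sqrt_lt_R0; nra.
have gc : g < c by apply: lt_sq; nra.
have gc' : g' < c' by apply: lt_sq; nra.
have cc' : c < c' by apply: lt_sq; nra.
have E : semi_diff g c = d by rewrite /semi_diff c2 (_ : _ - _ = d ^ 2); [rewrite -Rsqr_pow2 sqrt_Rsqr; lra|ring].
have E' : semi_diff g' c' = d by rewrite /semi_diff c'2 (_ : _ - _ = d ^ 2); [rewrite -Rsqr_pow2 sqrt_Rsqr; lra|ring].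
have ES : semi_sum g' c' = semi_sum g c by rewrite /semi_sum E E'.
have pos := PI_RGT_0.
have g'1 : 1 < g' by lra.
(* For fixed [d] the gap is fixed, and [c] enters only through
   [(c + sg * C) / (c + d * cos (2 * y))] with [C = semi_sum g c]. The difference of two such
   quotients is a positive multiple of [sg] times the gap. *)
have key sg y : sg = 1 \/ sg = -1 ->
   sg * (period_integrand sg g c y - period_integrand sg g' c' y) > 0.
  move=> sgE.
  have [_ [C0 [m0 [W0 [N0 [d2 C2]]]]]] := param_ineqs sg sgE _ _ y g1 gc.
  have [_ [C'0 [m'0 [W'0 [N'0 [d'2 C'2]]]]]] := param_ineqs sg sgE _ _ y g'1 gc'.
  have EG : pole_gap sg g' c' y = pole_gap sg g c y by rewrite /pole_gap ES E E'.
  have EI : period_integrand sg g c y = sqrt ((c + sg * semi_sum g c) / (c + d * cos (2 * y))) / pole_gap sg g c y.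
    rewrite /period_integrand /pole /dn_at E sqrt_div_alt; last by rewrite E in W0.
    by rewrite E in W0; field; split; [|lra]; apply: Rgt_not_eq; apply: sqrt_lt_R0.
  have EI' : period_integrand sg g' c' y = sqrt ((c' + sg * semi_sum g c) / (c' + d * cos (2 * y))) / pole_gap sg g c y.
    rewrite /period_integrand EG /pole /dn_at E' ES sqrt_div_alt; last by rewrite E' in W'0.
    by rewrite E' in W'0; field; split; [|lra]; apply: Rgt_not_eq; apply: sqrt_lt_R0.
  rewrite EI EI'; rewrite E in W0; rewrite E' in W'0; rewrite ES in m'0.
  have gap : 0 < semi_sum g c - sg * d * cos (2 * y) by move: N0; rewrite /pole_gap E.
  have frac : (c + sg * semi_sum g c) / (c + d * cos (2 * y)) - (c' + sg * semi_sum g c) / (c' + d * cos (2 * y))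
      = (c' - c) * (sg * semi_sum g c - d * cos (2 * y)) / ((c + d * cos (2 * y)) * (c' + d * cos (2 * y))).
    by field; lra.
  have den : 0 < (c + d * cos (2 * y)) * (c' + d * cos (2 * y)) by apply: Rmult_lt_0_compat.
  have q0 : 0 <= (c + sg * semi_sum g c) / (c + d * cos (2 * y)) by apply: Rlt_le; apply: Rdiv_lt_0_compat.
  have q'0 : 0 <= (c' + sg * semi_sum g c) / (c' + d * cos (2 * y)) by apply: Rlt_le; apply: Rdiv_lt_0_compat.
  case: sgE => Esg; rewrite Esg in N0 gap frac q0 q'0 *.
    have : sqrt ((c' + 1 * semi_sum g c) / (c' + d * cos (2 * y))) < sqrt ((c + 1 * semi_sum g c) / (c + d * cos (2 * y))).
      apply: sqrt_lt_1 => //; suff : 0 < (c' - c) * (1 * semi_sum g c - d * cos (2 * y)) / ((c + d * cos (2 * y)) * (c' + d * cos (2 * y))) by lra.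
      by apply: Rdiv_lt_0_compat => //; apply: Rmult_lt_0_compat; lra.
    by move=> /(Rmult_lt_compat_r _ _ _ (Rinv_0_lt_compat _ N0)); rewrite /Rdiv; lra.
  have : sqrt ((c + -1 * semi_sum g c) / (c + d * cos (2 * y))) < sqrt ((c' + -1 * semi_sum g c) / (c' + d * cos (2 * y))).
    apply: sqrt_lt_1 => //.
    have : 0 < (c' - c) * (semi_sum g c + d * cos (2 * y)) / ((c + d * cos (2 * y)) * (c' + d * cos (2 * y))).
      by apply: Rdiv_lt_0_compat => //; apply: Rmult_lt_0_compat; lra.
    rewrite (_ : (c' - c) * (-1 * semi_sum g c - d * cos (2 * y)) = - ((c' - c) * (semi_sum g c + d * cos (2 * y)))) in frac; last by ring.
    by rewrite Ropp_div in frac; lra.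
  by move=> /(Rmult_lt_compat_r _ _ _ (Rinv_0_lt_compat _ N0)); rewrite /Rdiv; lra.
have sg1 : 1 = 1 \/ 1 = -1 by left.
have sgm : -1 = 1 \/ -1 = -1 by right.
split; apply: RInt_lt => // y _; try by apply: continuous_period_integrand.
- by have := key 1 y sg1; lra.
- by have := key (-1) y sgm; lra.
Qed.

(** Let [g <= g'] and let [d], [d'] be the half differences. If [d < d'], then [period 1] does not
    increase on either leg of the path from [(g, d)] through [(g, d')] to [(g', d')], and decreases
    on the first. If [d > d'], the same holds for increase of [period (-1)] on the path through
    [(g', d)], where the second leg is strict. If [d = d'], [period 1] is strictly monotone in
    [g]. *)
Lemma period_injective g c g' c' : 1 < g -> g < c -> 1 < g' -> g' < c' ->
  period 1 g c = period 1 g' c' -> period (-1) g c = period (-1) g' c' ->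
  g = g' /\ c = c'.
Proof.
have wlog_le : forall g c g' c', 1 < g -> g < c -> 1 < g' -> g' < c' -> g <= g' ->
  period 1 g c = period 1 g' c' -> period (-1) g c = period (-1) g' c' ->
  g = g' /\ c = c'.
  move=> {g c g' c'} g c g' c' g1 gc g'1 gc' gg' E1 E2.
  pose d := sqrt (c ^ 2 - g ^ 2); pose d' := sqrt (c' ^ 2 - g' ^ 2).
  have lt_sq u v : 0 < v -> u ^ 2 < v ^ 2 -> u < v.
    by move=> v0 h; case: (Rle_lt_dec v u) => // vu; nra.
  have d0 : 0 < d by apply: sqrt_lt_R0; nra.
  have d'0 : 0 < d' by apply: sqrt_lt_R0; nra.
  have d2 : d ^ 2 = c ^ 2 - g ^ 2 by rewrite pow2_sqrt //; nra.
  have d'2 : d' ^ 2 = c' ^ 2 - g' ^ 2 by rewrite pow2_sqrt //; nra.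
  have Ec : c = sqrt (g ^ 2 + d ^ 2) by rewrite d2 (_ : _ + _ = c ^ 2); [rewrite -Rsqr_pow2 sqrt_Rsqr; lra|ring].
  have Ec' : c' = sqrt (g' ^ 2 + d' ^ 2) by rewrite d'2 (_ : _ + _ = c' ^ 2); [rewrite -Rsqr_pow2 sqrt_Rsqr; lra|ring].
  have decr sg h e e' : sg = 1 \/ sg = -1 -> 1 < h -> 0 < e -> e < e' ->
     period sg h (sqrt (h ^ 2 + e' ^ 2)) < period sg h (sqrt (h ^ 2 + e ^ 2)).
    move=> sgE h1 e0 ee'; apply: period_decr => //.
      by apply: lt_sq; [apply: sqrt_lt_R0; nra|rewrite pow2_sqrt; nra].
    by apply: sqrt_lt_1; nra.
  have dE : d = d' -> g = g' -> g = g' /\ c = c' by move=> h h'; split=> //; rewrite Ec Ec' h h'.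
  have sg1 : 1 = 1 \/ 1 = -1 by left.
  have sgm : -1 = 1 \/ -1 = -1 by right.
  rewrite Ec Ec' in E1 E2.
  case: (Rtotal_order d d') => [dd'|[dd'|dd']].
  - have h1 := decr 1 g d d' sg1 g1 d0 dd'.
    case: gg' => [gg'|gg']; last by rewrite gg' in h1 E1; lra.
    have [h2 _] := period_fixed_diff d' g g' d'0 g1 gg'; lra.
  - case: gg' => [gg'|gg']; last by apply: dE.
    have [h2 _] := period_fixed_diff d g g' d0 g1 gg'; rewrite dd' in h2 E1; lra.
  - have h1 := decr (-1) g' d' d sgm g'1 d'0 dd'.
    case: gg' => [gg'|gg']; last by rewrite gg' in E2; lra.
    have [_ h2] := period_fixed_diff d g g' d0 g1 gg'; lra.
move=> g1 gc g'1 gc' E1 E2; case: (Rle_lt_dec g g') => h; first exact: wlog_le.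
by have [-> ->] := wlog_le g' c' g c g'1 gc' g1 gc (Rlt_le _ _ h) (esym E1) (esym E2).
Qed.

Lemma admissible_pos a b : admissible a b -> 0 < b < a.
Proof. by case=> a0 [ba [b0 ab1]]; split=> //; case: (Rlt_le_dec 0 b) => // h; nra. Qed.

(** * [Phi1] and [Phi2] as periods in the amplitude variable *)

Section Admissible.
Variables a b : R.
Hypothesis adm : admissible a b.

Let b0 : 0 < b. Proof. by case: (admissible_pos _ _ adm). Qed.
Let ba : b < a. Proof. by case: (admissible_pos _ _ adm). Qed.
Let ab1 : 1 < a * b. Proof. by case: adm => _ [_ [_]]. Qed.

Let g := sqrt (a * b).
Let c := (a + b) / 2.

Let g2 : g ^ 2 = a * b. Proof. by rewrite pow2_sqrt; lra. Qed.

Let g1 : 1 < g. Proof. by rewrite -sqrt_1; apply: sqrt_lt_1; lra. Qed.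

Let gc : g < c.
Proof.
have g0 : 0 < g by lra.
by case: (Rle_lt_dec c g) => // h; have := g2; rewrite /c in h *; nra.
Qed.

Lemma semi_diff_ab : semi_diff g c = (a - b) / 2.
Proof.
rewrite /semi_diff g2 /c (_ : _ - _ = ((a - b) / 2) ^ 2); last by field.
by rewrite -Rsqr_pow2 sqrt_Rsqr; lra.
Qed.

Let root4 : sqrt (4 + (a - b) ^ 2) = 2 * semi_sum g c.
Proof.
have [_ [C0 [_ [_ [_ [d2 C2]]]]]] := param_ineqs 1 (or_introl (erefl 1)) g c 0 g1 gc.
rewrite (_ : 4 + (a - b) ^ 2 = Rsqr (2 * semi_sum g c)); first by rewrite sqrt_Rsqr; lra.
by rewrite Rsqr_pow2 Rpow_mult_distr C2 semi_diff_ab; field.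
Qed.

Let sgl : 1 = 1 \/ 1 = -1. Proof. by left. Qed.
Let sgr : -1 = 1 \/ -1 = -1. Proof. by right. Qed.

Let scale_sqrt2 u : 0 <= u -> 1 / sqrt 2 * sqrt (2 * u) = sqrt u.
Proof.
move=> u0; rewrite sqrt_mult; [|lra|lra].
by field; apply: Rgt_not_eq; apply: sqrt_lt_R0; lra.
Qed.

Lemma mu_pole : mu a b = pole 1 g c.
Proof.
have [_ [C0 [m0 _]]] := param_ineqs 1 sgl g c 0 g1 gc.
by rewrite /mu root4 /pole -(scale_sqrt2 (c + 1 * _)); [congr (_ * sqrt _); rewrite /c; field|lra].
Qed.

Lemma upsilon_pole : upsilon a b = pole (-1) g c.
Proof.
have [_ [C0 [m0 _]]] := param_ineqs (-1) sgr g c 0 g1 gc.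
by rewrite /upsilon root4 /pole -(scale_sqrt2 (c + -1 * _)); [congr (_ * sqrt _); rewrite /c; field|lra].
Qed.

Lemma mu_upsilon_facts :
  0 < mu a b /\ 0 < upsilon a b /\ mu a b ^ 2 + upsilon a b ^ 2 = a + b /\
  mu a b ^ 2 * upsilon a b ^ 2 = a * b - 1 /\ upsilon a b ^ 2 < b /\ a < mu a b ^ 2.
Proof.
have [_ [C0 [m0 [_ [_ [d2 C2]]]]]] := param_ineqs 1 sgl g c 0 g1 gc.
have [_ [_ [u0 _]]] := param_ineqs (-1) sgr g c 0 g1 gc.
rewrite semi_diff_ab in d2 C2.
have dC : (a - b) / 2 < semi_sum g c by case: (Rle_lt_dec (semi_sum g c) ((a - b) / 2)) => // h; nra.
rewrite mu_pole upsilon_pole /pole !pow2_sqrt; try lra.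
split; first exact: sqrt_lt_R0.
split; first exact: sqrt_lt_R0.
split; first by rewrite /c; field.
split; last by move: dC; rewrite /c; split; lra.
transitivity (c ^ 2 - semi_sum g c ^ 2); first by ring.
by rewrite C2 /c; field.
Qed.

Let psi t := jacobi_am (sqrt a * t) ((a - b) / a).

Let kab_dn_at t : kab a b t = dn_at g c (psi t).
Proof.
rewrite kab_psi // /dn_at semi_diff_ab cos_2a_sin; congr sqrt.
by rewrite /c /psi; field.
Qed.

(** Substitution [y = psi t]: since [psi' = kab], the measure accounts for the factor [/ dn_at] in
    the integrand, and one period of [kab] becomes [[0, PI]]. *)
Let period_change sg h : sg = 1 \/ sg = -1 ->
  (forall t, h t = kab a b t * period_integrand sg g c (psi t)) ->
  RInt h 0 (omega a b) = period sg g c.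
Proof.
move=> sgE E; have [w0 [psiw _]] := omega_spec a b b0 ba.
rewrite (RInt_ext _ _ _ _ (fun t _ => E t)) /period.
have psi0 : psi 0 = 0 by rewrite /psi Rmult_0_r am_0 //; apply: modulus_bound.
rewrite -psiw -[X in _ = RInt _ X _]psi0.
have := RInt_comp (period_integrand sg g c) psi (kab a b) 0 (omega a b); apply.
  by move=> y _; apply: continuous_period_integrand.
move=> y _; split; first exact: is_derive_psi.
by apply: ex_derive_continuous; exists (kab' a b y); apply: is_derive_kab.
Qed.

Lemma Phi1_period : Phi1 a b = - (1 / (2 * PI) * period 1 g c).
Proof.
rewrite /Phi1 -(period_change 1 (fun t => mu a b / (mu a b ^ 2 - kab a b t ^ 2))) => [|//|t].
  rewrite Ropp_mult_distr_r -[- RInt _ _ _](RInt_opp (V := R_CompleteNormedModule)).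
    congr (_ * _); apply: RInt_ext => t _; rewrite /opp /=.
    have [_ h] := kab_sq_bound a b b0 ba t; have [_ [_ [_ [_ [_ h']]]]] := mu_upsilon_facts.
    by field; lra.
  apply: ex_RInt_continuous => t _; apply: ex_derive_continuous.
  have D := is_derive_kab a b b0 ba t.
  have [_ h] := kab_sq_bound a b b0 ba t; have [_ [_ [_ [_ [_ h']]]]] := mu_upsilon_facts.
  by auto_derive; split; [eexists; exact: D|split=> //; lra].
rewrite /period_integrand kab_dn_at mu_pole.
have [_ [C0 [m0 [W0 [N0 _]]]]] := param_ineqs 1 sgl g c (psi t) g1 gc.
have W1 : 0 < dn_at g c (psi t) by apply: sqrt_lt_R0.
have -> : pole 1 g c ^ 2 - dn_at g c (psi t) ^ 2 = pole_gap 1 g c (psi t).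
  by rewrite /pole /dn_at /pole_gap !pow2_sqrt; lra.
by field; lra.
Qed.

Lemma Phi2_period : Phi2 a b = 1 / (2 * PI) * period (-1) g c.
Proof.
rewrite /Phi2 (period_change (-1)) // => t.
rewrite /period_integrand kab_dn_at upsilon_pole.
have [_ [C0 [m0 [W0 [N0 _]]]]] := param_ineqs (-1) sgr g c (psi t) g1 gc.
have W1 : 0 < dn_at g c (psi t) by apply: sqrt_lt_R0.
have -> : dn_at g c (psi t) ^ 2 - pole (-1) g c ^ 2 = pole_gap (-1) g c (psi t).
  by rewrite /pole /dn_at /pole_gap !pow2_sqrt; lra.
by field; lra.
Qed.

Lemma admissible_params : 1 < sqrt (a * b) /\ sqrt (a * b) < (a + b) / 2 /\ sqrt (a * b) ^ 2 = a * b.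
Proof. by []. Qed.

End Admissible.

Theorem Phi_injective a b a' b' : admissible a b -> admissible a' b' ->
  Phi1 a b = Phi1 a' b' -> Phi2 a b = Phi2 a' b' -> a = a' /\ b = b'.
Proof.
move=> A A'; have [g1 [gc g2]] := admissible_params _ _ A.
have [g1' [gc' g2']] := admissible_params _ _ A'.
have [b0 ba] := admissible_pos _ _ A; have [b0' ba'] := admissible_pos _ _ A'.
rewrite !Phi1_period // !Phi2_period // => E1 E2.
have p0 : 0 < 1 / (2 * PI) by apply: Rdiv_lt_0_compat; have := PI_RGT_0; lra.
have [||Eg Ec] := period_injective _ _ _ _ g1 gc g1' gc'.
- by apply: (Rmult_eq_reg_l (1 / (2 * PI))); lra.
- by apply: (Rmult_eq_reg_l (1 / (2 * PI))); lra.
rewrite Eg g2' in g2.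
have S : a + b = a' + b' by lra.
have D : (a - b) ^ 2 = (a' - b') ^ 2.
  have -> : (a - b) ^ 2 = (a + b) ^ 2 - 4 * (a * b) by ring.
  by rewrite S -g2; ring.
have : a - b = a' - b' by nra.
by lra.
Qed.

(** * The Vessiot frame of the model string *)

(* Coordinate-wise form of F' = F V with eta = 1: [f j] is the entry of a fixed
   row of F in column [j]. *)
Definition vessiot_row (k1 k2 : R -> R) (f : nat -> R -> R) : Prop :=
  forall t,
  is_derive (f 0%nat) t (k2 t * f 1%nat t + f 2%nat t) /\
  is_derive (f 1%nat) t (f 0%nat t + k2 t * f 4%nat t) /\
  is_derive (f 2%nat) t (- k1 t * f 3%nat t + f 4%nat t) /\
  is_derive (f 3%nat) t (k1 t * f 2%nat t) /\
  is_derive (f 4%nat) t (f 1%nat t).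

Lemma is_derive_lincomb (f g : R -> R) al be t df dg : is_derive f t df -> is_derive g t dg ->
  is_derive (fun s => al * f s + be * g s) t (al * df + be * dg).
Proof.
move=> Hf Hg; apply: (is_derive_plus (K := R_AbsRing) (V := R_NormedModule)).
  exact: is_derive_Rscal.
exact: is_derive_Rscal.
Qed.

Lemma vessiot_row_lincomb k1 k2 f g al be :
  vessiot_row k1 k2 f -> vessiot_row k1 k2 g ->
  vessiot_row k1 k2 (fun j t => al * f j t + be * g j t).
Proof.
move=> Hf Hg t; have [f0 [f1 [f2 [f3 f4]]]] := Hf t; have [g0 [g1 [g2 [g3 g4]]]] := Hg t.
split; [|split; [|split; [|split]]]; (evar_last; [by apply: is_derive_lincomb; eassumption|by rewrite /=; ring]).
Qed.

(* The momentum of the string is a constant element of so(4,1) with eigenvalues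
   0, +-i mu, +-i upsilon up to scale; in an eigenbasis the rows of F decouple into a timelike
   row and two complex rows of the form (p + i q) e^{i Theta} / sqrt |m^2 - k^2|
   with m = mu or upsilon. *)
Definition block_re (m N k kp : R) (j : nat) : R :=
  match j with
  | 0 => (m ^ 2 * (N - m ^ 2) - N * k ^ 2 + k ^ 4) / 2
  | 1 => - k * kp
  | 2 => 0
  | 3 => - k
  | _ => m ^ 2 - k ^ 2
  end.

Definition block_im (m k kp : R) (j : nat) : R :=
  match j with
  | 0 => 0
  | 1 => m
  | 2 => - m * (m ^ 2 - k ^ 2)
  | 3 => - m * kp
  | _ => 0
  end.

Definition time_row (S k kp : R) (j : nat) : R :=
  match j with
  | 0 => k * (S - k ^ 2) / 2
  | 1 => kp
  | 2 => 0
  | 3 => 1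
  | _ => k
  end.

Section Rows.
Variables (k kp : R -> R) (m N : R).
Hypotheses (dk : forall t, is_derive k t (kp t))
  (dkp : forall t, is_derive kp t (k t * (m ^ 2 + N - 2 * k t ^ 2)))
  (kp2 : forall t, kp t ^ 2 = (m ^ 2 - k t ^ 2) * (k t ^ 2 - N) - 1)
  (gap : forall t, m ^ 2 - k t ^ 2 <> 0).

Let k2 t := - (3 / 2) * k t ^ 2 + (m ^ 2 + N) / 2.

Lemma time_row_vessiot : vessiot_row k k2 (fun j t => time_row (m ^ 2 + N) (k t) (kp t) j).
Proof.
move=> t; have E1 := is_derive_unique _ _ _ (dk t); have E2 := is_derive_unique _ _ _ (dkp t).
have X1 : ex_derive k t by eexists; exact: dk.
have X2 : ex_derive kp t by eexists; exact: dkp.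
rewrite /time_row /k2; split; [|split; [|split; [|split]]]; auto_derive => //; rewrite ?E1 ?E2; try field.
Qed.

(** The hypotheses say that [u + i w] has logarithmic derivative [(k * kp + i m) / (m ^ 2 - k ^ 2)];
    the row is the real part of [(block_re + i block_im) * (u + i w)]. [N] is the square of the
    other eigenvalue, so exchanging the two eigenvalues gives the other block. *)
Lemma block_vessiot (u w : R -> R) :
  (forall t, is_derive u t ((k t * kp t * u t - m * w t) / (m ^ 2 - k t ^ 2))) ->
  (forall t, is_derive w t ((k t * kp t * w t + m * u t) / (m ^ 2 - k t ^ 2))) ->
  vessiot_row k k2 (fun j t => block_re m N (k t) (kp t) j * u t - block_im m (k t) (kp t) j * w t).
Proof.
move=> du dw t; have E1 := is_derive_unique _ _ _ (dk t); have E2 := is_derive_unique _ _ _ (dkp t).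
have E3 := is_derive_unique _ _ _ (du t); have E4 := is_derive_unique _ _ _ (dw t).
have X1 : ex_derive k t by eexists; exact: dk.
have X2 : ex_derive kp t by eexists; exact: dkp.
have X3 : ex_derive u t by eexists; exact: du.
have X4 : ex_derive w t by eexists; exact: dw.
have h := gap t.
(* The first integral [kp2] is linear in [N]. Eliminating [N] leaves [k t], [kp t] and [m] without a
   relation, so that [field] applies. *)
have EN : N = k t ^ 2 - (kp t ^ 2 + 1) / (m ^ 2 - k t ^ 2) by rewrite kp2; field.
rewrite /block_re /block_im /k2; split; [|split; [|split; [|split]]];
  auto_derive => //; rewrite ?E1 ?E2 ?E3 ?E4 ?EN; field; contradict h; lra.
Qed.

End Rows.

(** * Gram relations between the columns of the frame *)

Definition gram (i j : nat) : R :=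
  match i, j with
  | 0, 4 | 4, 0 => -1
  | 1, 1 | 2, 2 | 3, 3 => 1
  | _, _ => 0
  end.

Section GramIdentity.
Variables (mu ups k kp : R).
Let S := mu ^ 2 + ups ^ 2.
Let A := mu ^ 2 - k ^ 2.
Let B := k ^ 2 - ups ^ 2.
Hypotheses (kp2 : kp ^ 2 = A * B - 1) (A0 : 0 < A) (B0 : 0 < B) (mu0 : 0 < mu) (ups0 : 0 < ups).

(** The left side is the Lorentz product of columns [i] and [j] of the frame, expanded over one
    timelike row and two complex spacelike rows. [/ A] and [/ B] are the squared moduli of the
    phases; the other denominators normalize the eigenrows. *)
Lemma gram_blocks i j : (i < 5)%nat -> (j < 5)%nat ->
  - (time_row S k kp i * time_row S k kp j) / (mu ^ 2 * ups ^ 2)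
  + (block_re mu (ups ^ 2) k kp i * block_re mu (ups ^ 2) k kp j
     + block_im mu k kp i * block_im mu k kp j) / (A * (mu ^ 2 * (mu ^ 2 - ups ^ 2)))
  + (block_re ups (mu ^ 2) k kp i * block_re ups (mu ^ 2) k kp j
     + block_im ups k kp i * block_im ups k kp j) / (B * (ups ^ 2 * (mu ^ 2 - ups ^ 2)))
  = gram i j.
Proof.
have D0 : 0 < mu ^ 2 - ups ^ 2 by move: A0 B0; rewrite /A /B; lra.
have mu2 : 0 < mu ^ 2 by nra.
have ups2 : 0 < ups ^ 2 by nra.
move: A0 B0 kp2; rewrite /A /B /S => A1 B1 kp2'.
have k0 : kp * kp = (mu ^ 2 - k ^ 2) * (k ^ 2 - ups ^ 2) - 1 by lra.
move=> hi hj.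
(* Only the entries (1,1) and (3,3) are quadratic in [kp] and need [kp2]; the remaining ones are
   identities in [kp]. *)
do 5 (try (case: i hi => [|i] hi; [|try by lia])); do 5 (try (case: j hj => [|j] hj; [|try by lia]));
rewrite /time_row /block_re /block_im /gram;
match goal with
 | |- context [(- (kp * kp))] => idtac
 | |- context [(- mu * kp * (- mu * kp))] => idtac
 | _ => by field; lra
end.
- transitivity (- (kp * kp) / (mu ^ 2 * ups ^ 2) + (k ^ 2 * (kp * kp) + mu ^ 2) / ((mu ^ 2 - k ^ 2) * (mu ^ 2 * (mu ^ 2 - ups ^ 2)))
    + (k ^ 2 * (kp * kp) + ups ^ 2) / ((k ^ 2 - ups ^ 2) * (ups ^ 2 * (mu ^ 2 - ups ^ 2)))); first by field; lra.
  by rewrite k0; field; lra.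
- transitivity (- 1 / (mu ^ 2 * ups ^ 2) + (k ^ 2 + mu ^ 2 * (kp * kp)) / ((mu ^ 2 - k ^ 2) * (mu ^ 2 * (mu ^ 2 - ups ^ 2)))
    + (k ^ 2 + ups ^ 2 * (kp * kp)) / ((k ^ 2 - ups ^ 2) * (ups ^ 2 * (mu ^ 2 - ups ^ 2)))); first by field; lra.
  by rewrite k0; field; lra.
Qed.

End GramIdentity.

(** * Angles, phases and rows of the model frame *)

Section Model.
Variables a b : R.
Hypothesis adm : admissible a b.

Let b0 : 0 < b. Proof. by case: (admissible_pos _ _ adm). Qed.
Let ba : b < a. Proof. by case: (admissible_pos _ _ adm). Qed.

Let k := kab a b.
Let kp := kab' a b.
Let M := mu a b.
Let U := upsilon a b.
Let D := sqrt (M ^ 2 - U ^ 2).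

Lemma model_gaps t : 0 < M ^ 2 - k t ^ 2 /\ 0 < k t ^ 2 - U ^ 2 /\ 0 < M /\ 0 < U /\ 0 < D /\
  D ^ 2 = M ^ 2 - U ^ 2 /\ 0 < k t.
Proof.
have [h1 h2] := kab_sq_bound a b b0 ba t; have [m0 [u0 [_ [_ [h3 h4]]]]] := mu_upsilon_facts a b adm.
rewrite -/(k t) -/M -/U in h1 h2 h3 h4 m0 u0.
split; first lra; split; first lra; do 2 split=> //; split; first by apply: sqrt_lt_R0; lra.
by split; [rewrite /D pow2_sqrt; lra|apply: kab_pos].
Qed.

Lemma model_kp2 t : kp t ^ 2 = (M ^ 2 - k t ^ 2) * (k t ^ 2 - U ^ 2) - 1.
Proof.
rewrite /kp kab'_sq // -/(k t); have [_ [_ [h3 [h4 _]]]] := mu_upsilon_facts a b adm.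
rewrite -/M -/U in h3 h4.
have -> : (M ^ 2 - k t ^ 2) * (k t ^ 2 - U ^ 2) = (M ^ 2 + U ^ 2) * k t ^ 2 - k t ^ 4 - M ^ 2 * U ^ 2 by ring.
by rewrite h3 h4; ring.
Qed.

Let sumMU : M ^ 2 + U ^ 2 = a + b. Proof. by have [_ [_ [h3 _]]] := mu_upsilon_facts a b adm. Qed.

Definition curvature2 (t : R) := - (3 / 2) * kab a b t ^ 2 + (a + b) / 2.

Let dk t : is_derive k t (kp t). Proof. exact: is_derive_kab. Qed.
Let dkp t : is_derive kp t (k t * (a + b - 2 * k t ^ 2)). Proof. exact: is_derive_kab'. Qed.

Let theta_derive (m : R) : m <> 0 -> (forall t, m ^ 2 - k t ^ 2 <> 0) ->
  forall t, is_derive (fun t => RInt (fun u => m / (m ^ 2 - k u ^ 2)) 0 t) t (m / (m ^ 2 - k t ^ 2)).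
Proof.
move=> m0 h t.
have c s : continuous (fun u => m / (m ^ 2 - k u ^ 2)) s.
  apply: (ex_derive_continuous (fun u => m / (m ^ 2 - k u ^ 2))).
  auto_derive; split; first by exists (kp s).
  by split=> //; have := h s; rewrite /= => h' h''; apply: h'; lra.
apply: is_derive_RInt (c t).
by apply: filter_forall => s; apply: RInt_correct; apply: ex_RInt_continuous => z _.
Qed.

Lemma is_derive_Theta1 t : is_derive (Theta1 a b) t (M / (M ^ 2 - k t ^ 2)).
Proof. by apply: (theta_derive M) => [|s]; [have := model_gaps 0; lra|have := model_gaps s; lra]. Qed.

Lemma is_derive_Theta2 t : is_derive (Theta2 a b) t (U / (U ^ 2 - k t ^ 2)).
Proof. by apply: (theta_derive U) => [|s]; [have := model_gaps 0; lra|have := model_gaps s; lra]. Qed.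

Definition phase1_re t := cos (Theta1 a b t) / sqrt (M ^ 2 - k t ^ 2).
Definition phase1_im t := sin (Theta1 a b t) / sqrt (M ^ 2 - k t ^ 2).
Definition phase2_re t := cos (Theta2 a b t) / sqrt (k t ^ 2 - U ^ 2).
Definition phase2_im t := sin (Theta2 a b t) / sqrt (k t ^ 2 - U ^ 2).

(** [g] is [m ^ 2 - k ^ 2] or its negative, whichever is positive. The condition on [dg] prescribes
    its logarithmic derivative, which is the same in both cases. *)
Lemma phase_derive (th g : R -> R) (m t dg : R) : 0 < g t ->
  is_derive th t (m / (m ^ 2 - k t ^ 2)) -> m ^ 2 - k t ^ 2 <> 0 ->
  is_derive g t dg -> dg * (m ^ 2 - k t ^ 2) = - 2 * k t * kp t * g t ->
  is_derive (fun t => cos (th t) / sqrt (g t)) t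
     ((k t * kp t * (cos (th t) / sqrt (g t)) - m * (sin (th t) / sqrt (g t))) / (m ^ 2 - k t ^ 2)) /\
  is_derive (fun t => sin (th t) / sqrt (g t)) t
     ((k t * kp t * (sin (th t) / sqrt (g t)) + m * (cos (th t) / sqrt (g t))) / (m ^ 2 - k t ^ 2)).
Proof.
move=> g0 dth n0 Hg E.
have s0 : 0 < sqrt (g t) by apply: sqrt_lt_R0.
have s2 : sqrt (g t) * sqrt (g t) = g t by apply: sqrt_sqrt; lra.
have E' : dg = - 2 * k t * kp t * (sqrt (g t) * sqrt (g t)) / (m ^ 2 - k t ^ 2).
  by rewrite s2 -E; field.
have E1 := is_derive_unique _ _ _ dth; have E2 := is_derive_unique _ _ _ Hg.
have X1 : ex_derive th t by eexists; exact: dth.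
have X2 : ex_derive g t by eexists; exact: Hg.
by split; auto_derive; try (by repeat split => //; lra); rewrite E1 E2 E'; field; lra.
Qed.

Lemma phase1_derive t :
  is_derive phase1_re t ((k t * kp t * phase1_re t - M * phase1_im t) / (M ^ 2 - k t ^ 2)) /\
  is_derive phase1_im t ((k t * kp t * phase1_im t + M * phase1_re t) / (M ^ 2 - k t ^ 2)).
Proof.
have [h1 [h2 _]] := model_gaps t.
apply: (phase_derive (Theta1 a b) (fun t => M ^ 2 - k t ^ 2) M t (- 2 * k t * kp t)) => //; try lra.
  exact: is_derive_Theta1.
auto_derive; first by exists (kp t).
by rewrite (is_derive_unique _ _ _ (dk t)); ring.
Qed.

Lemma phase2_derive t :
  is_derive phase2_re t ((k t * kp t * phase2_re t - U * phase2_im t) / (U ^ 2 - k t ^ 2)) /\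
  is_derive phase2_im t ((k t * kp t * phase2_im t + U * phase2_re t) / (U ^ 2 - k t ^ 2)).
Proof.
have [h1 [h2 _]] := model_gaps t.
apply: (phase_derive (Theta2 a b) (fun t => k t ^ 2 - U ^ 2) U t (2 * k t * kp t)) => //; try lra.
  exact: is_derive_Theta2.
auto_derive; first by exists (kp t).
by rewrite (is_derive_unique _ _ _ (dk t)); ring.
Qed.

Definition rowT j t := time_row (M ^ 2 + U ^ 2) (k t) (kp t) j.
Definition row1_re j t := block_re M (U ^ 2) (k t) (kp t) j * phase1_re t
  - block_im M (k t) (kp t) j * phase1_im t.
(** The imaginary part, written as the real part for the phase multiplied by [- i], so that
    [block_vessiot] covers it too. *)
Definition row1_im j t := block_re M (U ^ 2) (k t) (kp t) j * phase1_im t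
  - block_im M (k t) (kp t) j * - phase1_re t.
Definition row2_re j t := block_re U (M ^ 2) (k t) (kp t) j * phase2_re t
  - block_im U (k t) (kp t) j * phase2_im t.
Definition row2_im j t := block_re U (M ^ 2) (k t) (kp t) j * phase2_im t
  - block_im U (k t) (kp t) j * - phase2_re t.

(** Rows 0 and 4 are the light-cone combinations [(T - X) / sqrt 2] and [(T + X) / sqrt 2] of the
    normalized time row [T] and the normalized real row [X] of the mu block. The remaining signs are
    those of the coordinates of the model string. The summands [0 * _] give every row the shape of
    [vessiot_row_lincomb]. *)
Definition frame_row (i j : nat) (t : R) : R :=
  match i with
  | 0 => / (sqrt 2 * (M * U)) * rowT j t + - / (sqrt 2 * (M * D)) * row1_re j t
  | 1 => - / (U * D) * row2_re j t + 0 * row2_re j t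
  | 2 => - / (U * D) * row2_im j t + 0 * row2_im j t
  | 3 => / (M * D) * row1_im j t + 0 * row1_im j t
  | _ => / (sqrt 2 * (M * U)) * rowT j t + / (sqrt 2 * (M * D)) * row1_re j t
  end.

Lemma frame_row_vessiot i : vessiot_row k curvature2 (frame_row i).
Proof.
have cE : forall n m, n ^ 2 + m ^ 2 = a + b ->
   forall t, - (3 / 2) * k t ^ 2 + (n ^ 2 + m ^ 2) / 2 = curvature2 t.
  by move=> n m h t; rewrite h.
have rec n m f : n ^ 2 + m ^ 2 = a + b ->
    vessiot_row k (fun t => - (3 / 2) * k t ^ 2 + (n ^ 2 + m ^ 2) / 2) f -> vessiot_row k curvature2 f.
  by move=> h H t; have := H t; rewrite (cE _ _ h).
have dkp' n m : n ^ 2 + m ^ 2 = a + b -> forall t, is_derive kp t (k t * (n ^ 2 + m ^ 2 - 2 * k t ^ 2)).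
  by move=> -> t.
have RT : vessiot_row k curvature2 rowT.
  by apply: (rec M U) => //; apply: time_row_vessiot => //; apply: dkp'.
have g1 t : M ^ 2 - k t ^ 2 <> 0 by have := model_gaps t; lra.
have g2 t : U ^ 2 - k t ^ 2 <> 0 by have := model_gaps t; lra.
have sumUM : U ^ 2 + M ^ 2 = a + b by lra.
have kp2' t : kp t ^ 2 = (U ^ 2 - k t ^ 2) * (k t ^ 2 - M ^ 2) - 1 by rewrite model_kp2; ring.
have R1 : vessiot_row k curvature2 row1_re.
  apply: (rec M U) => //; apply: block_vessiot => // t; try exact: dkp'.
  - exact: model_kp2.
  - by have [] := phase1_derive t.
  - by have [] := phase1_derive t.
have R2 : vessiot_row k curvature2 row2_re.
  apply: (rec U M) => //; apply: block_vessiot => // t; try exact: dkp'.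
  - by have [] := phase2_derive t.
  - by have [] := phase2_derive t.
have I1 : vessiot_row k curvature2 row1_im.
  apply: (rec M U) => //; apply: (block_vessiot _ _ _ _ _ _ _ _ phase1_im (fun t => - phase1_re t)) => // t; try exact: dkp'.
  - exact: model_kp2.
  - by have [_ h] := phase1_derive t; apply: is_derive_val h _; rewrite /Rdiv; ring.
  - have [h _] := phase1_derive t; apply: is_derive_val (is_derive_opp (K := R_AbsRing) (V := R_NormedModule) _ _ _ h) _.
    by rewrite /opp /= /Rdiv; ring.
have I2 : vessiot_row k curvature2 row2_im.
  apply: (rec U M) => //; apply: (block_vessiot _ _ _ _ _ _ _ _ phase2_im (fun t => - phase2_re t)) => // t; try exact: dkp'.
  - by have [_ h] := phase2_derive t; apply: is_derive_val h _; rewrite /Rdiv; ring.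
  - have [h _] := phase2_derive t; apply: is_derive_val (is_derive_opp (K := R_AbsRing) (V := R_NormedModule) _ _ _ h) _.
    by rewrite /opp /= /Rdiv; ring.
by case: i => [|[|[|[|i]]]]; apply: vessiot_row_lincomb.
Qed.

End Model.

From mathcomp Require Import all_boot all_algebra.
From mathcomp Require boolp classical_sets filter topology normedtype.
From mathcomp Require Import Rstruct Rstruct_topology.
From Stdlib Require Import FunctionalExtensionality.
From Coquelicot Require Import Coquelicot.
Local Open Scope ring_scope.
Local Open Scope R_scope.

(** * Conformal arclength element of a light-cone lift *)

(** The product [lorentz] on coordinate functions, where [ring] works directly; [lorentzE] connects
    the two. *)
Definition lor (v w : nat -> R) : R :=
  - (v 0%nat * w 4%nat + v 4%nat * w 0%nat)
  + v 1%nat * w 1%nat + v 2%nat * w 2%nat + v 3%nat * w 3%nat.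

Lemma lor_sym v w : lor v w = lor w v.
Proof. by rewrite /lor; ring. Qed.

Lemma is_derive_lor (V W : R -> nat -> R) V1 W1 t :
  (forall i, is_derive (fun s => V s i) t (V1 i)) ->
  (forall i, is_derive (fun s => W s i) t (W1 i)) ->
  is_derive (fun s => lor (V s) (W s)) t (lor V1 (W t) + lor (V t) W1).
Proof.
move=> HV HW; rewrite /lor.
have M i := is_derive_Rmult _ _ _ _ _ (HV i) (HW i).
have M' i j := is_derive_Rmult _ _ _ _ _ (HV i) (HW j).
pose P := is_derive_plus (K := R_AbsRing) (V := R_NormedModule).
have N := is_derive_opp (K := R_AbsRing) (V := R_NormedModule) _ _ _ (P _ _ _ _ _ (M' 0%nat 4%nat) (M' 4%nat 0%nat)).
apply: is_derive_val (P _ _ _ _ _ (P _ _ _ _ _ (P _ _ _ _ _ N (M 1%nat)) (M 2%nat)) (M 3%nat)) _.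
by rewrite /plus /opp /=; ring.
Qed.

Definition chain (V W : R -> nat -> R) := forall t i, is_derive (fun s => V s i) t (W t i).

Lemma lor_const_derive V V1 W W1 c : chain V V1 -> chain W W1 ->
  (forall t, lor (V t) (W t) = c) -> forall t, lor (V1 t) (W t) + lor (V t) (W1 t) = 0.
Proof.
move=> HV HW E t; rewrite -(is_derive_unique _ _ _ (is_derive_lor V W _ _ t (HV t) (HW t))).
by rewrite (Derive_ext _ (fun _ => c)) // Derive_const.
Qed.

Lemma dot3E x y : dot3 x y =
  x ord0 ord0 * y ord0 ord0 + x (inord 1) ord0 * y (inord 1) ord0 + x (inord 2) ord0 * y (inord 2) ord0.
Proof.
rewrite /dot3 !big_ord_recr big_ord0 /= GRing.add0r.
have -> : widen_ord (leqnSn 2) (widen_ord (leqnSn 1) ord_max) = ord0 :> 'I_3 by apply: val_inj.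
have -> : widen_ord (leqnSn 2) ord_max = inord 1 :> 'I_3 by apply: val_inj; rewrite /= inordK.
by have -> : ord_max = inord 2 :> 'I_3 by apply: val_inj; rewrite /= inordK.
Qed.

Lemma val_inord3 k : (k < 3)%nat -> nat_of_ord (inord k : 'I_3) = k.
Proof. exact: inordK. Qed.

Section LiftCoordinate.
Variables (f f1 f2 f3 m m1 m2 m3 : R -> R) (t : R).
Hypotheses (D1 : is_derive f t (f1 t)) (D2 : is_derive f1 t (f2 t)) (D3 : is_derive f2 t (f3 t))
  (M1 : is_derive m t (m1 t)) (M2 : is_derive m1 t (m2 t)) (M3 : is_derive m2 t (m3 t))
  (m0 : 0 < m t).

Let U := is_derive_unique.

(** If [m] is the last coordinate of the lift, the curve will have speed [/ m], and an arclength
    derivative is [m] times a derivative in the parameter. Each result is therefore displayed as a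
    quotient by [m t], whose numerator is the next arclength derivative. *)
Lemma lift_coordinate_D1 : is_derive (fun s => f s / m s) t ((f1 t - m1 t / m t * f t) / m t).
Proof.
auto_derive; last by rewrite (U _ _ _ D1) (U _ _ _ M1); field; lra.
by split; [exists (f1 t)|split; [exists (m1 t)|split => //; lra]].
Qed.

Lemma lift_coordinate_D2 : is_derive (fun s => f1 s - m1 s / m s * f s) t
  ((m t * f2 t - m1 t * f1 t - (m2 t - m1 t ^ 2 / m t) * f t) / m t).
Proof.
auto_derive; last by rewrite (U _ _ _ D1) (U _ _ _ D2) (U _ _ _ M1) (U _ _ _ M2); field; lra.
split; first by exists (f2 t).
split; first by exists (m2 t).
split; first by exists (m1 t).
by split; [lra|split=> //; exists (f1 t)].
Qed.

Lemma lift_coordinate_D3 :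
  is_derive (fun s => m s * f2 s - m1 s * f1 s - (m2 s - m1 s ^ 2 / m s) * f s) t
  ((m t * (m t * f3 t + (m1 t ^ 2 / m t - 2 * m2 t) * f1 t
    - (m3 t - (2 * m1 t * m2 t * m t - m1 t ^ 3) / m t ^ 2) * f t)) / m t).
Proof.
auto_derive; last first.
  by rewrite (U _ _ _ D1) (U _ _ _ D2) (U _ _ _ D3) (U _ _ _ M1) (U _ _ _ M2) (U _ _ _ M3); field; lra.
split; first by exists (m1 t).
split; first by exists (f3 t).
split; first by exists (m2 t).
split; first by exists (f2 t).
split; first by exists (m3 t).
do 2 (split=> //; first by [exists (m1 t)|lra|exists (m2 t)]).
by split; [lra|split => //; exists (f1 t)].
Qed.

End LiftCoordinate.

Section Lift.
Variables (Y Y1 Y2 Y3 : R -> nat -> R).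
Hypotheses (C1 : chain Y Y1) (C2 : chain Y1 Y2) (C3 : chain Y2 Y3).
Hypotheses (m0 : forall t, 0 < Y t 4%nat) (null : forall t, lor (Y t) (Y t) = 0)
  (unit : forall t, lor (Y1 t) (Y1 t) = 1).

Lemma lift_products t :
  lor (Y t) (Y1 t) = 0 /\ lor (Y t) (Y2 t) = -1 /\ lor (Y1 t) (Y2 t) = 0 /\
  lor (Y t) (Y3 t) = 0 /\ lor (Y1 t) (Y3 t) = - lor (Y2 t) (Y2 t).
Proof.
have E01 s : lor (Y s) (Y1 s) = 0.
  by have := lor_const_derive _ _ _ _ _ C1 C1 null s; rewrite lor_sym; lra.
have E12 s : lor (Y1 s) (Y2 s) = 0.
  by have := lor_const_derive _ _ _ _ _ C2 C2 unit s; rewrite lor_sym; lra.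
have E02 s : lor (Y s) (Y2 s) = -1.
  by have := lor_const_derive _ _ _ _ _ C1 C2 E01 s; rewrite unit; lra.
have E03 := lor_const_derive _ _ _ _ _ C1 C3 E02 t.
have E13 := lor_const_derive _ _ _ _ _ C2 C3 E12 t.
by rewrite E12 in E03; repeat split => //; lra.
Qed.

Variable g : curve.
Hypothesis gE : forall t (j : 'I_3), g t j ord0 = Y t j.+1 / Y t 4%nat.

Let m t := Y t 4%nat.
Let m1 t := Y1 t 4%nat.
Let m2 t := Y2 t 4%nat.
Let m3 t := Y3 t 4%nat.
(** Arclength derivatives of [g], extended to five coordinates. Their coordinate 4 vanishes, so
    Euclidean products of the derivatives are Lorentz products of combinations of [Y], ..., [Y3]. *)
Let G1 t i := Y1 t i - m1 t / m t * Y t i.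
Let G2 t i := m t * Y2 t i - m1 t * Y1 t i - (m2 t - m1 t ^ 2 / m t) * Y t i.
Let G3 t i := m t * (m t * Y3 t i + (m1 t ^ 2 / m t - 2 * m2 t) * Y1 t i
  - (m3 t - (2 * m1 t * m2 t * m t - m1 t ^ 3) / m t ^ 2) * Y t i).

Let dG1 t i : is_derive (fun s => G1 s i) t (G2 t i / m t).
Proof. exact: (lift_coordinate_D2 (Y^~ i) (Y1^~ i) (Y2^~ i) m m1 m2 t (C1 t i) (C2 t i) (C1 t 4%nat) (C2 t 4%nat) (m0 t)). Qed.

Let dG2 t i : is_derive (fun s => G2 s i) t (G3 t i / m t).
Proof. exact: (lift_coordinate_D3 (Y^~ i) (Y1^~ i) (Y2^~ i) (Y3^~ i) m m1 m2 m3 t (C1 t i) (C2 t i) (C3 t i) (C1 t 4%nat) (C2 t 4%nat) (C3 t 4%nat) (m0 t)). Qed.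

Let dg t (j : 'I_3) : is_derive (fun s => g s j ord0) t (G1 t j.+1 / m t).
Proof.
apply: (is_derive_ext (fun s => Y s j.+1 / Y s 4%nat)) => [s|]; first by rewrite gE.
exact: (lift_coordinate_D1 (Y^~ j.+1) (Y1^~ j.+1) m m1 t (C1 t j.+1) (C1 t 4%nat) (m0 t)).
Qed.

Lemma Dcurve_lift t (j : 'I_3) : Dcurve g t j ord0 = G1 t j.+1 / m t.
Proof. by rewrite mxE; apply: is_derive_unique. Qed.

Let dot_lor (v w : 'cV[R]_3) (V W : nat -> R) : V 4%nat = 0 -> W 4%nat = 0 ->
  (forall j : 'I_3, v j ord0 = V j.+1) -> (forall j : 'I_3, w j ord0 = W j.+1) ->
  dot3 v w = lor V W.
Proof. by move=> V4 W4 Hv Hw; rewrite dot3E !Hv !Hw !val_inord3 // /lor V4 W4 /=; ring. Qed.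

Let G1_4 t : G1 t 4%nat = 0.
Proof. by have := m0 t; rewrite /G1 /m1 /m => h; field; lra. Qed.

Let G2_4 t : G2 t 4%nat = 0.
Proof. by have := m0 t; rewrite /G2 /m1 /m /m2 => h; field; lra. Qed.

Let G3_4 t : G3 t 4%nat = 0.
Proof. by have := m0 t; rewrite /G3 /m1 /m /m2 /m3 => h; field; lra. Qed.

Lemma speed_lift t : speed g t = / m t.
Proof.
have [E01 _] := lift_products t; have h := m0 t; rewrite -/(m t) in h.
rewrite /speed (dot_lor _ _ (fun i => G1 t i / m t) (fun i => G1 t i / m t)); try by rewrite ?G1_4 ?Dcurve_lift; field; lra.
2,3: by move=> j; rewrite Dcurve_lift.
have -> : lor (fun i => G1 t i / m t) (fun i => G1 t i / m t) = Rsqr (/ m t).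
  transitivity ((lor (Y1 t) (Y1 t) - 2 * (m1 t / m t) * lor (Y t) (Y1 t)
     + (m1 t / m t) ^ 2 * lor (Y t) (Y t)) / m t ^ 2).
    by rewrite /lor /G1; field; lra.
  by rewrite unit null E01 /Rsqr; field; lra.
by apply: sqrt_Rsqr; apply: Rlt_le; apply: Rinv_0_lt_compat.
Qed.

Lemma Dcurve_lift_neq0 t : Dcurve g t <> GRing.zero.
Proof.
move=> E; have := speed_lift t; rewrite /speed E dot3E !mxE /=.
have := Rinv_0_lt_compat _ (m0 t); rewrite -/(m t).
have -> : GRing.zero = 0 :> R by [].
by rewrite !Rmult_0_l !Rplus_0_l sqrt_0; lra.
Qed.

Let Darc1 t (j : 'I_3) : Darc g g t j ord0 = G1 t j.+1.
Proof.
have h := m0 t; rewrite /Darc mxE Dcurve_lift speed_lift -RinvE -RmultE; field; rewrite /m; lra.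
Qed.

Let Darc2 t (j : 'I_3) : Darc g (Darc g g) t j ord0 = G2 t j.+1.
Proof.
have h := m0 t; rewrite {1}/Darc mxE speed_lift mxE.
rewrite (is_derive_unique _ _ (G2 t j.+1 / m t)); first by rewrite -RinvE -RmultE; field; rewrite /m; lra.
by apply: is_derive_ext (dG1 t j.+1) => s; rewrite Darc1.
Qed.

Let Darc3 t (j : 'I_3) : Darc g (Darc g (Darc g g)) t j ord0 = G3 t j.+1.
Proof.
have h := m0 t; rewrite {1}/Darc mxE speed_lift mxE.
rewrite (is_derive_unique _ _ (G3 t j.+1 / m t)); first by rewrite -RinvE -RmultE; field; rewrite /m; lra.
by apply: is_derive_ext (dG2 t j.+1) => s; rewrite Darc2.
Qed.

(** In [(G3, G3) - (G2, G2) ^ 2] all derivatives of [m] cancel and [m ^ 4] times the invariant of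
    the lift remains; the speed [/ m] cancels the fourth root of [m ^ 4]. *)
Lemma eta_lift t : eta g t = sqrt (sqrt (lor (Y3 t) (Y3 t) - lor (Y2 t) (Y2 t) ^ 2)).
Proof.
have [E01 [E02 [E12 [E03 E13]]]] := lift_products t; have h := m0 t; rewrite -/(m t) in h.
rewrite /eta speed_lift (dot_lor _ _ _ _ (G3_4 t) (G3_4 t) (Darc3 t) (Darc3 t)).
rewrite (dot_lor _ _ _ _ (G2_4 t) (G2_4 t) (Darc2 t) (Darc2 t)).
have -> : lor (G2 t) (G2 t) = m t ^ 2 * lor (Y2 t) (Y2 t) - m1 t ^ 2 + 2 * m t * m2 t.
  transitivity (m t ^ 2 * lor (Y2 t) (Y2 t) + m1 t ^ 2 * lor (Y1 t) (Y1 t)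
     + (m2 t - m1 t ^ 2 / m t) ^ 2 * lor (Y t) (Y t) - 2 * m t * m1 t * lor (Y1 t) (Y2 t)
     - 2 * m t * (m2 t - m1 t ^ 2 / m t) * lor (Y t) (Y2 t)
     + 2 * m1 t * (m2 t - m1 t ^ 2 / m t) * lor (Y t) (Y1 t)).
    by rewrite /lor /G2; ring.
  by rewrite unit null E01 E12 E02; field; lra.
have -> : lor (G3 t) (G3 t) = m t ^ 2 * (m t ^ 2 * lor (Y3 t) (Y3 t)
    - 2 * m t * (m1 t ^ 2 / m t - 2 * m2 t) * lor (Y2 t) (Y2 t) + (m1 t ^ 2 / m t - 2 * m2 t) ^ 2).
  pose z := m3 t - (2 * m1 t * m2 t * m t - m1 t ^ 3) / m t ^ 2.
  pose w := m1 t ^ 2 / m t - 2 * m2 t.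
  transitivity (m t ^ 2 * (m t ^ 2 * lor (Y3 t) (Y3 t) + w ^ 2 * lor (Y1 t) (Y1 t) + z ^ 2 * lor (Y t) (Y t)
     + 2 * m t * w * lor (Y1 t) (Y3 t) - 2 * m t * z * lor (Y t) (Y3 t) - 2 * w * z * lor (Y t) (Y1 t))).
    by rewrite /lor /G3 -/z -/w; ring.
  by rewrite unit null E01 E13 E03 /w; ring.
set E := lor (Y3 t) (Y3 t) - _.
set D := (X in sqrt (sqrt X)); have {D}-> : D = (m t ^ 2) ^ 2 * E.
  by rewrite /D -RpowE /E; field; lra.
rewrite sqrt_mult_alt; last by nra.
rewrite -Rsqr_pow2 sqrt_Rsqr; last by nra.
rewrite sqrt_mult_alt; last by nra.
rewrite -Rsqr_pow2 sqrt_Rsqr; last by lra.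
by field; lra.
Qed.


Definition euclid_lift (x : 'cV[R]_3) (i : nat) : R :=
  match i with
  | 0 => dot3 x x / 2
  | 1 => x ord0 ord0
  | 2 => x (inord 1) ord0
  | 3 => x (inord 2) ord0
  | _ => 1
  end.

(** This identifies column 4 of the model frame with the canonical lift of the model string, from
    which a variation starts. *)
Lemma lift_unique t i : (i < 5)%nat -> Y t i = / speed g t * euclid_lift (g t) i.
Proof.
have h := m0 t; have n := null t; rewrite speed_lift Rinv_inv /m => hi.
have E j : (j < 3)%nat -> Y t 4%nat * g t (inord j) ord0 = Y t j.+1.
  by move=> hj; rewrite gE inordK //; field; lra.
have E0 : Y t 4%nat * g t ord0 ord0 = Y t 1%nat by rewrite gE /=; field; lra.
case: i hi => [|[|[|[|[|//]]]]] _ /=; rewrite ?E ?E0 //; last by ring.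
apply: (Rmult_eq_reg_l (2 * Y t 4%nat)); last lra.
rewrite dot3E; transitivity ((Y t 4%nat * g t ord0 ord0) ^ 2 + (Y t 4%nat * g t (inord 1) ord0) ^ 2
  + (Y t 4%nat * g t (inord 2) ord0) ^ 2); last by field.
by rewrite E0 !E //; move: n; rewrite /lor /=; lra.
Qed.

End Lift.

(** The canonical lift: the factor [/ speed] achieves [(Y_1, Y_1) = 1]. *)
Definition lift (g : curve) (t : R) (i : nat) : R := / speed g t * euclid_lift (g t) i.

Section CanonicalLift.
Variable g : curve.
Hypotheses (reg : forall t, Dcurve g t <> GRing.zero)
  (dg : forall j t, ex_derive (fun s => g s j ord0) t).

Lemma dot3_Dcurve_pos t : 0 < dot3 (Dcurve g t) (Dcurve g t).
Proof.
rewrite dot3E; apply: Rnot_le_lt => le0.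
have sq (x : R) : 0 <= x * x by nra.
have z (x : R) : x * x <= 0 -> x = 0 by nra.
have [[s0 s1] s2] := (sq (Dcurve g t ord0 ord0), sq (Dcurve g t (inord 1) ord0), sq (Dcurve g t (inord 2) ord0)).
case: (reg t); apply/matrixP => i j; rewrite (ord1 j) [RHS]mxE.
case: i => [[|[|[|//]]] hi].
- have h : Dcurve g t ord0 ord0 = 0 by apply: z; lra.
  by rewrite (_ : Ordinal hi = ord0); [exact: h|apply: val_inj].
- have h : Dcurve g t (inord 1) ord0 = 0 by apply: z; lra.
  by rewrite (_ : Ordinal hi = inord 1); [exact: h|apply: val_inj; rewrite /= inordK].
- have h : Dcurve g t (inord 2) ord0 = 0 by apply: z; lra.
  by rewrite (_ : Ordinal hi = inord 2); [exact: h|apply: val_inj; rewrite /= inordK].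
Qed.

Lemma speed_pos t : 0 < speed g t.
Proof. by apply: sqrt_lt_R0; apply: dot3_Dcurve_pos. Qed.

Lemma lift_4_pos t : 0 < lift g t 4.
Proof. by rewrite /lift /= Rmult_1_r; apply: Rinv_0_lt_compat; apply: speed_pos. Qed.

Lemma lift_null t : lor (lift g t) (lift g t) = 0.
Proof. by rewrite /lor /lift /euclid_lift dot3E; field; have := speed_pos t; lra. Qed.

Lemma lift_ratio t (j : 'I_3) : g t j ord0 = lift g t j.+1 / lift g t 4.
Proof.
have s0 := speed_pos t.
have ratio (x : R) : x = / speed g t * x / (/ speed g t * 1) by field; lra.
case: j => [[|[|[|//]]] hi]; rewrite /lift /=.
- by rewrite (_ : Ordinal hi = ord0); [exact: ratio|apply: val_inj].
- by rewrite (_ : Ordinal hi = inord 1); [exact: ratio|apply: val_inj; rewrite /= inordK].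
- by rewrite (_ : Ordinal hi = inord 2); [exact: ratio|apply: val_inj; rewrite /= inordK].
Qed.

(** The derivative of the factor [/ speed] multiplies the null vector [euclid_lift], which is
    orthogonal to its own derivative, so only the squared speed divided by itself survives. *)
Lemma lift_unit Y1 : chain (lift g) Y1 -> forall t, lor (Y1 t) (Y1 t) = 1.
Proof.
move=> C t; have s0 := speed_pos t.
have Dj j : is_derive (fun s => g s j ord0) t (Dcurve g t j ord0).
  by rewrite mxE; apply: Derive_correct.
pose x := g t ord0 ord0; pose y := g t (inord 1) ord0; pose z := g t (inord 2) ord0.
pose x' := Dcurve g t ord0 ord0; pose y' := Dcurve g t (inord 1) ord0; pose z' := Dcurve g t (inord 2) ord0.
have Dinv : is_derive (fun s => / speed g s) t (Y1 t 4%nat).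
  by apply: is_derive_ext (C t 4%nat) => s; rewrite /lift /= Rmult_1_r.
have prod f f' i : (forall s, f s = euclid_lift (g s) i) -> is_derive f t f' ->
    Y1 t i = Y1 t 4%nat * f t + / speed g t * f'.
  move=> E Df; rewrite -(is_derive_unique _ _ _ (C t i)); apply: is_derive_unique.
  by apply: is_derive_ext (is_derive_Rmult _ _ _ _ _ Dinv Df) => s; rewrite E.
have E1 : Y1 t 1%nat = Y1 t 4%nat * x + / speed g t * x' by apply: (prod (fun s => g s ord0 ord0)).
have E2 : Y1 t 2%nat = Y1 t 4%nat * y + / speed g t * y' by apply: (prod (fun s => g s (inord 1) ord0)).
have E3 : Y1 t 3%nat = Y1 t 4%nat * z + / speed g t * z' by apply: (prod (fun s => g s (inord 2) ord0)).
have E0 : Y1 t 0%nat = Y1 t 4%nat * ((x * x + y * y + z * z) / 2) + / speed g t * (x * x' + y * y' + z * z').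
  pose f s := (g s ord0 ord0 * g s ord0 ord0 + g s (inord 1) ord0 * g s (inord 1) ord0 + g s (inord 2) ord0 * g s (inord 2) ord0) * / 2.
  apply: (prod f) => [s|]; first by rewrite /f /= dot3E.
  have sq j := is_derive_Rmult _ _ _ _ _ (Dj j) (Dj j).
  pose P := is_derive_plus (K := R_AbsRing) (V := R_NormedModule).
  have H := is_derive_Rmult _ _ _ _ _ (P _ _ _ _ _ (P _ _ _ _ _ (sq ord0) (sq (inord 1))) (sq (inord 2))) (is_derive_const (/ 2) t).
  move: H; rewrite /f /plus /zero /= -/x -/y -/z -/x' -/y' -/z' => H.
  by rewrite (_ : _ + _ = (x' * x + x * x' + (y' * y + y * y') + (z' * z + z * z')) * / 2 + (x * x + y * y + z * z) * 0) //; field.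
rewrite /lor E0 E1 E2 E3.
transitivity ((x' * x' + y' * y' + z' * z') / speed g t ^ 2); first by field; lra.
rewrite /x' /y' /z' -dot3E /speed pow2_sqrt; last by apply: Rlt_le; apply: dot3_Dcurve_pos.
by field; have := dot3_Dcurve_pos t; lra.
Qed.

End CanonicalLift.

(** * The model frame as a lift of the model string *)

Section ModelFrame.
Variables a b : R.
Hypothesis adm : admissible a b.

Let b0 : 0 < b. Proof. by case: (admissible_pos _ _ adm). Qed.
Let ba : b < a. Proof. by case: (admissible_pos _ _ adm). Qed.

Let k := kab a b.
Let kp := kab' a b.
Let M := mu a b.
Let U := upsilon a b.
Let D := sqrt (M ^ 2 - U ^ 2).
Let F := frame_row a b.

Let sqrt2_pos : 0 < sqrt 2. Proof. by apply: sqrt_lt_R0; lra. Qed.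
Let sqrt2_sq : sqrt 2 ^ 2 = 2. Proof. by rewrite pow2_sqrt; lra. Qed.

Lemma phase1_norm t : phase1_re a b t ^ 2 + phase1_im a b t ^ 2 = / (M ^ 2 - k t ^ 2).
Proof.
have [h _] := model_gaps a b adm t; rewrite -/M -/k in h.
have s0 : 0 < sqrt (M ^ 2 - k t ^ 2) by apply: sqrt_lt_R0.
have s2 : sqrt (M ^ 2 - k t ^ 2) ^ 2 = M ^ 2 - k t ^ 2 by rewrite pow2_sqrt; lra.
rewrite /phase1_re /phase1_im -/M -/k.
transitivity ((cos (Theta1 a b t) ^ 2 + sin (Theta1 a b t) ^ 2) / sqrt (M ^ 2 - k t ^ 2) ^ 2); first by field; lra.
by have := sin2_cos2 (Theta1 a b t); rewrite s2 !Rsqr_pow2 Rplus_comm => ->; field; lra.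
Qed.

Lemma phase2_norm t : phase2_re a b t ^ 2 + phase2_im a b t ^ 2 = / (k t ^ 2 - U ^ 2).
Proof.
have [_ [h _]] := model_gaps a b adm t; rewrite -/U -/k in h.
have s0 : 0 < sqrt (k t ^ 2 - U ^ 2) by apply: sqrt_lt_R0.
have s2 : sqrt (k t ^ 2 - U ^ 2) ^ 2 = k t ^ 2 - U ^ 2 by rewrite pow2_sqrt; lra.
rewrite /phase2_re /phase2_im -/U -/k.
transitivity ((cos (Theta2 a b t) ^ 2 + sin (Theta2 a b t) ^ 2) / sqrt (k t ^ 2 - U ^ 2) ^ 2); first by field; lra.
by have := sin2_cos2 (Theta2 a b t); rewrite s2 !Rsqr_pow2 Rplus_comm => ->; field; lra.
Qed.

Lemma frame_gram (t : R) (i j : nat) : (i < 5)%nat -> (j < 5)%nat ->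
  lor (fun l => F l i t) (fun l => F l j t) = gram i j.
Proof.
move=> hi hj.
have [h1 [h2 [M0 [U0 [D0 [D2 k0]]]]]] := model_gaps a b adm t.
rewrite -/M -/U -/D -/k in h1 h2 M0 U0 D0 D2.
rewrite -(gram_blocks M U (k t) (kp t) (model_kp2 a b adm t) h1 h2 M0 U0); try by apply/ltP.
transitivity (- (rowT a b i t * rowT a b j t) / (M ^ 2 * U ^ 2)
   + (block_re M (U ^ 2) (k t) (kp t) i * block_re M (U ^ 2) (k t) (kp t) j +
      block_im M (k t) (kp t) i * block_im M (k t) (kp t) j)
     * (phase1_re a b t ^ 2 + phase1_im a b t ^ 2) / (M ^ 2 * D ^ 2)
   + (block_re U (M ^ 2) (k t) (kp t) i * block_re U (M ^ 2) (k t) (kp t) j +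
      block_im U (k t) (kp t) i * block_im U (k t) (kp t) j)
     * (phase2_re a b t ^ 2 + phase2_im a b t ^ 2) / (U ^ 2 * D ^ 2)).
  rewrite /lor /F /frame_row -/M -/U -/D.
  transitivity (- (rowT a b i t * rowT a b j t) * (2 / sqrt 2 ^ 2) / (M ^ 2 * U ^ 2)
     + row1_re a b i t * row1_re a b j t * (2 / sqrt 2 ^ 2) / (M ^ 2 * D ^ 2)
     + row1_im a b i t * row1_im a b j t / (M ^ 2 * D ^ 2)
     + (row2_re a b i t * row2_re a b j t + row2_im a b i t * row2_im a b j t) / (U ^ 2 * D ^ 2)).
    by field; lra.
  rewrite sqrt2_sq /row1_re /row1_im /row2_re /row2_im -/M -/U -/k -/kp; field; lra.
by rewrite phase1_norm phase2_norm D2 /rowT -/M -/U -/k -/kp; field; rewrite -/k in h1 h2 *; lra.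
Qed.

Lemma frame_44 t : F 4%nat 4%nat t = radius a b t / (sqrt 2 * M * U * D).
Proof.
have [h1 [h2 [M0 [U0 [D0 [D2 k0]]]]]] := model_gaps a b adm t.
rewrite -/M -/U -/D -/k in h1 h2 M0 U0 D0 D2.
have s0 : 0 < sqrt (M ^ 2 - k t ^ 2) by apply: sqrt_lt_R0.
have s2 : M ^ 2 - k t ^ 2 = sqrt (M ^ 2 - k t ^ 2) * sqrt (M ^ 2 - k t ^ 2) by rewrite sqrt_sqrt; lra.
rewrite /F /frame_row /rowT /row1_re /radius /time_row /block_re /block_im /phase1_re -/M -/U -/k -/D.
by set s := sqrt (_ - k t ^ 2) in s0 s2 *; rewrite s2; field; lra.
Qed.

(** Positivity of the denominator means that the model string never reaches the point at
    infinity. *)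
Lemma radius_pos t : 0 < radius a b t.
Proof.
have [h1 [h2 [M0 [U0 [D0 [D2 k0]]]]]] := model_gaps a b adm t.
rewrite -/M -/U -/D -/k in h1 h2 M0 U0 D0 D2 k0.
have s0 : 0 < sqrt (M ^ 2 - k t ^ 2) by apply: sqrt_lt_R0.
have s2 : sqrt (M ^ 2 - k t ^ 2) ^ 2 = M ^ 2 - k t ^ 2 by rewrite pow2_sqrt; lra.
rewrite /radius -/M -/U -/D -/k.
have [cos_ge cos_le] := COS_bound (Theta1 a b t).
(* The difference of the squares is [M ^ 2 * (k t ^ 2 - U ^ 2)]. *)
have : U * sqrt (M ^ 2 - k t ^ 2) < D * k t.
  have p1 : 0 < U * sqrt (M ^ 2 - k t ^ 2) by apply: Rmult_lt_0_compat.
  have p2 : 0 < D * k t by apply: Rmult_lt_0_compat.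
  have sq : (U * sqrt (M ^ 2 - k t ^ 2)) ^ 2 < (D * k t) ^ 2.
    by rewrite (Rpow_mult_distr U) (Rpow_mult_distr D) s2 D2; nra.
  by nra.
have : 0 < U * sqrt (M ^ 2 - k t ^ 2) by apply: Rmult_lt_0_compat.
by nra.
Qed.

Lemma frame_44_pos t : 0 < F 4%nat 4%nat t.
Proof.
have [h1 [h2 [M0 [U0 [D0 _]]]]] := model_gaps a b adm t.
rewrite frame_44; apply: Rdiv_lt_0_compat; first exact: radius_pos.
by apply: Rmult_lt_0_compat D0; apply: Rmult_lt_0_compat U0; apply: Rmult_lt_0_compat M0.
Qed.

Lemma model_string_frame t (j : 'I_3) : model_string a b t j ord0 = F j.+1 4%nat t / F 4%nat 4%nat t.
Proof.
have [h1 [h2 [M0 [U0 [D0 [D2 k0]]]]]] := model_gaps a b adm t.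
rewrite -/M -/U -/D -/k in h1 h2 M0 U0 D0 D2.
have r0 := radius_pos t.
rewrite frame_44 /model_string /col3 mxE.
case: j => [[|[|[|//]]] hj] /=.
- have s0 : 0 < sqrt (k t ^ 2 - U ^ 2) by apply: sqrt_lt_R0.
  have s2 : k t ^ 2 - U ^ 2 = sqrt (k t ^ 2 - U ^ 2) * sqrt (k t ^ 2 - U ^ 2) by rewrite sqrt_sqrt; lra.
  rewrite /F /frame_row /row2_re /phase2_re /block_re /block_im -/M -/U -/k -/D.
  set s := sqrt (k t ^ 2 - _) in s0 s2 *.
  have -> : U ^ 2 - k t ^ 2 = - (s * s) by lra.
  by field; lra.
- have s0 : 0 < sqrt (k t ^ 2 - U ^ 2) by apply: sqrt_lt_R0.
  have s2 : k t ^ 2 - U ^ 2 = sqrt (k t ^ 2 - U ^ 2) * sqrt (k t ^ 2 - U ^ 2) by rewrite sqrt_sqrt; lra.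
  rewrite /F /frame_row /row2_im /phase2_im /block_re /block_im -/M -/U -/k -/D.
  set s := sqrt (k t ^ 2 - _) in s0 s2 *.
  have -> : U ^ 2 - k t ^ 2 = - (s * s) by lra.
  by field; lra.
- have s0 : 0 < sqrt (M ^ 2 - k t ^ 2) by apply: sqrt_lt_R0.
  have s2 : M ^ 2 - k t ^ 2 = sqrt (M ^ 2 - k t ^ 2) * sqrt (M ^ 2 - k t ^ 2) by rewrite sqrt_sqrt; lra.
  rewrite /F /frame_row /row1_im /phase1_im /block_re /block_im -/M -/U -/k -/D.
  by set s := sqrt (_ - k t ^ 2) in s0 s2 *; rewrite s2; field; lra.
Qed.

End ModelFrame.

(** * Smoothness and conformal arclength element of the model string *)

Definition CkLine n f := CkOn (fun _ => True) n (fun _ => f).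

Lemma CkLine_Derive n f : CkLine (S n) f -> CkLine n (Derive f).
Proof.
case=> _ [fx [fy [_ [Fy [_ C]]]]]; apply: CkOn_ext C => x y.
by symmetry; apply: is_derive_unique; apply: Fy.
Qed.

Lemma CkLine_ex_derive n f t : CkLine (S n) f -> ex_derive f t.
Proof. by case=> _ [fx [fy [_ [Fy _]]]]; exists (fy 0 t); apply: Fy. Qed.

(** Makes the closure properties of the strip classes available for [smooth]. *)
Lemma smooth_CkLine f : smooth f <-> forall n, CkLine n f.
Proof.
split.
  move=> H n; elim: n f H => [|n IH] f H.
    split=> // x y _; apply: continuity_2d_pt_snd; apply: ex_derive_continuous; exact: (H 1%nat y).
  apply: (CkOn_of_derive _ _ _ (Derive f)) => [y|]; first by apply: Derive_correct; apply: (H 1%nat y).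
  apply: IH => -[|m] t //=.
  apply: (ex_derive_ext (Derive_n f m.+1)); last by apply: (H m.+2 t).
  by move=> s; have := Derive_n_comp f m 1 s; rewrite PeanoNat.Nat.add_1_r => /esym.
move=> H [|n] t //=.
have C m : forall p, CkLine p (Derive_n f m).
  by elim: m => [|m IH] p; [apply: H|apply: CkLine_Derive].
exact: CkLine_ex_derive (C n 1%nat).
Qed.

Section ModelSmooth.
Variables a b : R.
Hypothesis adm : admissible a b.

Let b0 : 0 < b. Proof. by case: (admissible_pos _ _ adm). Qed.
Let ba : b < a. Proof. by case: (admissible_pos _ _ adm). Qed.

Let k := kab a b.
Let kp := kab' a b.
Let M := mu a b.
Let U := upsilon a b.
Let D := sqrt (M ^ 2 - U ^ 2).
Let cst n c : CkLine n (fun _ => c). Proof. exact: CkOn_const. Qed.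

Let CkLine_sq n f : CkLine n f -> CkLine n (fun t => f t ^ 2).
Proof. by move=> H; apply: CkOn_ext (CkOn_mult _ _ _ _ H H) => x y; ring. Qed.

Let CkLine_gap n m : CkLine n k -> CkLine n (fun t => m ^ 2 - k t ^ 2).
Proof. by move=> H; apply: CkOn_minus (cst _ _) _; apply: CkLine_sq. Qed.

(** Bootstrap: the derivatives of all six functions are polynomials in these functions and in the
    inverses of the gaps, so class [n] gives class [n + 1]. *)
Lemma CkLine_model n : CkLine n k /\ CkLine n kp /\ CkLine n (phase1_re a b) /\
  CkLine n (phase1_im a b) /\ CkLine n (phase2_re a b) /\ CkLine n (phase2_im a b).
Proof.
have dk t : is_derive k t (kp t) by apply: is_derive_kab.
have dkp t : is_derive kp t (k t * (a + b - 2 * k t ^ 2)) by apply: is_derive_kab'.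
have d1 := phase1_derive a b adm; have d2 := phase2_derive a b adm.
rewrite -/M -/U -/k -/kp in d1 d2.
elim: n => [|n [Ck [Ckp [C1 [C2 [C3 C4]]]]]].
  have C f df : (forall t, is_derive f t (df t)) -> CkLine 0 f.
    by move=> H; split=> // x y _; apply: continuity_2d_pt_snd; apply: ex_derive_continuous; exists (df y).
  split; first exact: C dk.
  split; first exact: C dkp.
  split; first exact: C (fun t => proj1 (d1 t)).
  split; first exact: C (fun t => proj2 (d1 t)).
  split; first exact: C (fun t => proj1 (d2 t)).
  exact: C (fun t => proj2 (d2 t)).
have I1 : CkLine n (fun t => / (M ^ 2 - k t ^ 2)).
  apply: CkOn_inv (CkLine_gap _ _ Ck) => _ t _; have := model_gaps a b adm t; rewrite -/M -/k; lra.
have I2 : CkLine n (fun t => / (U ^ 2 - k t ^ 2)).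
  apply: CkOn_inv (CkLine_gap _ _ Ck) => _ t _; have := model_gaps a b adm t; rewrite -/U -/k; lra.
have kkp : CkLine n (fun t => k t * kp t) by apply: CkOn_mult.
have cM f g : CkLine n f -> CkLine n g -> CkLine n (fun t => f t * g t) by apply: CkOn_mult.
have cA f g : CkLine n f -> CkLine n g -> CkLine n (fun t => f t + g t) by apply: CkOn_plus.
have cB f g : CkLine n f -> CkLine n g -> CkLine n (fun t => f t - g t) by apply: CkOn_minus.
have cZ c f : CkLine n f -> CkLine n (fun t => c * f t) by apply: (cM).
split; first exact: CkOn_of_derive dk Ckp.
split.
  apply: CkOn_of_derive dkp _; apply: (cM k) => //; apply: CkOn_minus (cst _ _) _.
  by apply: (cZ 2 (fun t => k t ^ 2)); apply: CkLine_sq.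
split.
  apply: CkOn_of_derive (fun t => proj1 (d1 t)) _; apply: (cM _ _ _ I1).
  by apply: (cB); [exact: (cM _ _ kkp C1)|apply: (cZ)].
split.
  apply: CkOn_of_derive (fun t => proj2 (d1 t)) _; apply: (cM _ _ _ I1).
  by apply: (cA); [exact: (cM _ _ kkp C2)|apply: (cZ)].
split.
  apply: CkOn_of_derive (fun t => proj1 (d2 t)) _; apply: (cM _ _ _ I2).
  by apply: (cB); [exact: (cM _ _ kkp C3)|apply: (cZ)].
apply: CkOn_of_derive (fun t => proj2 (d2 t)) _; apply: (cM _ _ _ I2).
by apply: (cA); [exact: (cM _ _ kkp C4)|apply: (cZ)].
Qed.

Lemma CkLine_frame n i j : CkLine n (frame_row a b i j).
Proof.
have [Ck [Ckp [C1 [C2 [C3 C4]]]]] := CkLine_model n.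
have cM f g : CkLine n f -> CkLine n g -> CkLine n (fun t => f t * g t) by apply: CkOn_mult.
have cA f g : CkLine n f -> CkLine n g -> CkLine n (fun t => f t + g t) by apply: CkOn_plus.
have cB f g : CkLine n f -> CkLine n g -> CkLine n (fun t => f t - g t) by apply: CkOn_minus.
have cN f : CkLine n f -> CkLine n (fun t => - f t) by apply: CkOn_opp.
have cZ c f : CkLine n f -> CkLine n (fun t => c * f t) by apply: (cM).
have k2 := CkLine_sq _ _ Ck.
have k4 : CkLine n (fun t => k t ^ 4).
  by apply: CkOn_ext (CkLine_sq _ _ k2) => x y; ring.
have re m N : CkLine n (fun t => block_re m N (k t) (kp t) j).
  case: j => [|[|[|[|j]]]] /=.
  - by apply: (cM _ (fun _ => / 2)) => //; apply: (cA _ _ _ k4); apply: (cB) => //; apply: (cZ N _ k2).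
  - by apply: (cM (fun t => - k t)) => //; apply: (cN).
  - by [].
  - exact: (cN).
  - exact: (CkLine_gap _ m).
have im m : CkLine n (fun t => block_im m (k t) (kp t) j).
  case: j {re} => [|[|[|[|j]]]] //=.
  - exact: (cZ) (CkLine_gap _ m Ck).
  - exact: (cZ).
have tm : CkLine n (rowT a b j).
  rewrite /rowT; case: j {re im} => [|[|[|[|j]]]] //=.
  by apply: (cM _ (fun _ => / 2)) => //; apply: (cM) => //; apply: (cB _ _ _ k2).
have r1 : CkLine n (row1_re a b j) by apply: (cB); apply: (cM).
have r2 : CkLine n (row1_im a b j) by apply: (cB); apply: (cM) => //; apply: (cN).
have r3 : CkLine n (row2_re a b j) by apply: (cB); apply: (cM).
have r4 : CkLine n (row2_im a b j) by apply: (cB); apply: (cM) => //; apply: (cN).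
by case: i => [|[|[|[|i]]]] /=; apply: (cA); apply: (cZ).
Qed.

Lemma smooth_frame i j : smooth (frame_row a b i j).
Proof. by apply/smooth_CkLine => n; apply: CkLine_frame. Qed.

Lemma smooth_model_string (j : 'I_3) : smooth (fun t => model_string a b t j ord0).
Proof.
apply/smooth_CkLine => n; apply: (CkOn_ext _ _ (fun _ t => frame_row a b j.+1 4%nat t / frame_row a b 4%nat 4%nat t)).
  by move=> _ t; rewrite -model_string_frame.
apply: (CkOn_div _ _ _ _ _ (CkLine_frame n j.+1 4%nat) (CkLine_frame n 4%nat 4%nat)).
by move=> _ t _; apply: Rgt_not_eq; apply: frame_44_pos.
Qed.

Let F j (t : R) (i : nat) := frame_row a b i j t.

Let dF i := frame_row_vessiot a b adm i.

Lemma frame_chains :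
  chain (F 4) (F 1) /\
  chain (F 1) (fun t i => F 0 t i + curvature2 a b t * F 4 t i) /\
  chain (F 0) (fun t i => curvature2 a b t * F 1 t i + F 2 t i) /\
  chain (F 2) (fun t i => - k t * F 3 t i + F 4 t i) /\
  chain (F 3) (fun t i => k t * F 2 t i).
Proof.
split; first by move=> t i; have [_ [_ [_ [_ h]]]] := dF i t.
split; first by move=> t i; have [_ [h _]] := dF i t.
split; first by move=> t i; have [h _] := dF i t.
split; first by move=> t i; have [_ [_ [h _]]] := dF i t.
by move=> t i; have [_ [_ [_ [h _]]]] := dF i t.
Qed.

Definition curvature2' t := - 3 * kab a b t * kab' a b t.
Definition curvature2'' t := - 3 * (kab' a b t ^ 2 + kab a b t ^ 2 * (a + b - 2 * kab a b t ^ 2)).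

Lemma is_derive_curvature2 t : is_derive (curvature2 a b) t (curvature2' t).
Proof.
have dk : is_derive k t (kp t) by apply: is_derive_kab.
rewrite /curvature2 -/k; auto_derive; first by exists (kp t).
by rewrite (is_derive_unique _ _ _ dk) /curvature2' -/k -/kp; field.
Qed.

Lemma is_derive_curvature2' t : is_derive curvature2' t (curvature2'' t).
Proof.
have dk : is_derive k t (kp t) by apply: is_derive_kab.
have dkp : is_derive kp t (k t * (a + b - 2 * k t ^ 2)) by apply: is_derive_kab'.
rewrite /curvature2' /curvature2'' -/k -/kp; auto_derive.
  by split; [exists (kp t)|split=> //; eexists; exact: dkp].
by rewrite (is_derive_unique _ _ _ dk) (is_derive_unique _ _ _ dkp); ring.
Qed.

Let k2 := curvature2 a b.
(** [X2] and [X3] are the second and third derivatives of the null lift [F 4], expressed in the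
    frame. *)
Let X2 t i := F 0 t i + k2 t * F 4 t i.
Let X3 t i := 2 * k2 t * F 1 t i + F 2 t i + curvature2' t * F 4 t i.

Lemma chain_X3 : chain X2 X3.
Proof.
have [c4 [c1 [c0 _]]] := frame_chains => t i.
have H := is_derive_plus (K := R_AbsRing) (V := R_NormedModule) _ _ _ _ _ (c0 t i)
  (is_derive_Rmult _ _ _ _ _ (is_derive_curvature2 t) (c4 t i)).
by apply: is_derive_val H _; rewrite /plus /= /X3 /k2; ring.
Qed.

Let G i j t : (i < 5)%nat -> (j < 5)%nat -> lor (F i t) (F j t) = gram i j.
Proof. exact: frame_gram. Qed.

Lemma frame_lift_invariant t : lor (X3 t) (X3 t) - lor (X2 t) (X2 t) ^ 2 = 1 /\
  lor (X2 t) (X2 t) = - 2 * k2 t.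
Proof.
have E22 : lor (X2 t) (X2 t) = - 2 * k2 t.
  transitivity (lor (F 0 t) (F 0 t) + 2 * k2 t * lor (F 0 t) (F 4 t) + k2 t ^ 2 * lor (F 4 t) (F 4 t)).
    by rewrite /lor /X2; ring.
  by rewrite !G //=; ring.
split=> //; rewrite E22; set w := curvature2' t.
transitivity (4 * k2 t ^ 2 * lor (F 1 t) (F 1 t) + lor (F 2 t) (F 2 t) + w ^ 2 * lor (F 4 t) (F 4 t)
  + 4 * k2 t * lor (F 1 t) (F 2 t) + 4 * k2 t * w * lor (F 1 t) (F 4 t) + 2 * w * lor (F 2 t) (F 4 t)
  - (- 2 * k2 t) ^ 2).
  by rewrite /lor /X3 -/w; ring.
by rewrite !G //=; ring.
Qed.

Let null t : lor (F 4 t) (F 4 t) = 0. Proof. by rewrite G. Qed.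
Let unit_speed t : lor (F 1 t) (F 1 t) = 1. Proof. by rewrite G. Qed.
Let c41 : chain (F 4) (F 1). Proof. by case: frame_chains. Qed.
Let c12 : chain (F 1) X2. Proof. by case: frame_chains => _ []. Qed.

Lemma eta_model_string t : eta (model_string a b) t = 1.
Proof.
rewrite (eta_lift _ _ _ _ c41 c12 chain_X3 (frame_44_pos a b adm) null unit_speed _ (model_string_frame a b adm)).
by have [-> _] := frame_lift_invariant t; rewrite !sqrt_1.
Qed.

Lemma generic_model_string : generic (model_string a b).
Proof.
split; first exact: smooth_model_string.
split=> t; last by rewrite eta_model_string; exact: R1_neq_R0.
exact: (Dcurve_lift_neq0 _ _ _ _ c41 c12 chain_X3 (frame_44_pos a b adm) null unit_speed _ (model_string_frame a b adm)).
Qed.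

End ModelSmooth.

(** * First variation *)

Lemma CkOn_of_smooth2 D n f : Cn_2d n f -> CkOn D n f.
Proof.
elim: n f => [|n IH] f [H1 H2]; split=> //; try by move=> x y _; apply: H1.
case: H2 => H2 [H3 H4]; exists (dx f), (dy f); split.
  by move=> x y _; apply: Derive_correct; case: (H2 x y).
split; first by move=> x y _; apply: Derive_correct; case: (H2 x y).
by split; apply: IH.
Qed.

(** * Lifts of a family of curves and the derivative of its length *)

Section LiftFamily.
Variables (D : R -> Prop) (oD : open D) (V : R -> curve).
Hypotheses (CV : forall n (j : 'I_3), CkOn D n (fun tau t => V tau t j ord0))
  (reg : forall tau t, D tau -> Dcurve (V tau) t <> GRing.zero).

Let CkOn_sq n f : CkOn D n f -> CkOn D n (fun x y => f x y * f x y).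
Proof. by move=> C; apply: CkOn_mult. Qed.

Lemma CkOn_lift n i : CkOn D n (fun tau t => lift (V tau) t i).
Proof.
have Cd j : CkOn D n (fun tau t => Dcurve (V tau) t j ord0).
  by apply: CkOn_ext (CkOn_dy _ oD _ _ (CV n.+1 j)) => x y; rewrite mxE.
have Cspeed : CkOn D n (fun tau t => / speed (V tau) t).
  apply: CkOn_inv => [tau t Dt|].
    by apply: Rgt_not_eq; apply: sqrt_lt_R0; apply: dot3_Dcurve_pos => s; apply: reg.
  apply: CkOn_sqrt => [tau t Dt|]; first by apply: dot3_Dcurve_pos => s; apply: reg.
  apply: (CkOn_ext _ _ (fun tau t => Dcurve (V tau) t ord0 ord0 * Dcurve (V tau) t ord0 ord0
     + Dcurve (V tau) t (inord 1) ord0 * Dcurve (V tau) t (inord 1) ord0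
     + Dcurve (V tau) t (inord 2) ord0 * Dcurve (V tau) t (inord 2) ord0)).
    by move=> x y; rewrite dot3E.
  by apply: CkOn_plus; [apply: CkOn_plus|]; apply: CkOn_sq.
apply: CkOn_mult => //; case: i => [|[|[|[|i]]]] /=; try exact: CV; last exact: CkOn_const.
apply: (CkOn_ext _ _ (fun tau t => (V tau t ord0 ord0 * V tau t ord0 ord0
     + V tau t (inord 1) ord0 * V tau t (inord 1) ord0
     + V tau t (inord 2) ord0 * V tau t (inord 2) ord0) * / 2)).
  by move=> x y; rewrite dot3E.
by apply: CkOn_mult (CkOn_const _ _ _); apply: CkOn_plus; [apply: CkOn_plus|]; apply: CkOn_sq.
Qed.

Definition lift_dt m tau t i := Nat.iter m dy (fun tau t => lift (V tau) t i) tau t.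
Definition lift_var m tau t i := Nat.iter m dy (dx (fun tau t => lift (V tau) t i)) tau t.

Lemma CkOn_iter_dy n m f : (forall n, CkOn D n f) -> CkOn D n (Nat.iter m dy f).
Proof. by move=> C; elim: m n => [|m IH] n //=; apply: CkOn_dy. Qed.

Lemma CkOn_lift_dt n m i : CkOn D n (fun tau t => lift_dt m tau t i).
Proof. by apply: CkOn_iter_dy => p; apply: CkOn_lift. Qed.

Lemma chain_lift_dt m tau : D tau -> chain (lift_dt m tau) (lift_dt m.+1 tau).
Proof. by move=> Dt t i; exact: CkOn_is_derive_dy (CkOn_lift_dt 1 m i) Dt. Qed.

Lemma chain_lift_var m tau : D tau -> chain (lift_var m tau) (lift_var m.+1 tau).
Proof.
move=> Dt t i; have C : CkOn D 1 (Nat.iter m dy (dx (fun tau t => lift (V tau) t i))).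
  by apply: CkOn_iter_dy => p; apply: CkOn_dx => //; apply: CkOn_lift.
exact: CkOn_is_derive_dy C Dt.
Qed.

Lemma is_derive_lift_dt m tau t i : D tau ->
  is_derive (fun s => lift_dt m s t i) tau (lift_var m tau t i).
Proof.
move=> Dt; rewrite /lift_var -(dx_dy_iter _ oD 0 _ m) //; last exact: CkOn_lift.
exact: CkOn_is_derive_dx (CkOn_lift_dt 1 m i) Dt.
Qed.

Let dV tau : D tau -> forall j t, ex_derive (fun s => V tau s j ord0) t.
Proof. by move=> Dt j t; eexists; exact: CkOn_is_derive_dy (CV 1 j) Dt. Qed.

Definition lift_E tau t := lor (lift_dt 3 tau t) (lift_dt 3 tau t) - lor (lift_dt 2 tau t) (lift_dt 2 tau t) ^ 2.

Lemma lift_family_products tau : D tau ->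
  (forall t, 0 < lift_dt 0 tau t 4) /\ (forall t, lor (lift_dt 0 tau t) (lift_dt 0 tau t) = 0) /\
  (forall t, lor (lift_dt 1 tau t) (lift_dt 1 tau t) = 1).
Proof.
move=> Dt; have r t : Dcurve (V tau) t <> GRing.zero by apply: reg.
split; first by move=> t; apply: lift_4_pos.
split; first by move=> t; apply: lift_null.
by apply: lift_unit => //; [apply: dV|apply: (chain_lift_dt 0)].
Qed.

Lemma eta_lift_family tau t : D tau -> eta (V tau) t = sqrt (sqrt (lift_E tau t)).
Proof.
move=> Dt; have r s : Dcurve (V tau) s <> GRing.zero by apply: reg.
have [p [n u]] := lift_family_products tau Dt.
have c0 := chain_lift_dt 0 tau Dt; have c1 := chain_lift_dt 1 tau Dt; have c2 := chain_lift_dt 2 tau Dt.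
by apply: (eta_lift _ _ _ _ c0 c1 c2 p n u) => s j; apply: lift_ratio.
Qed.

Let CkOn_lor n (Y Z : R -> R -> nat -> R) : (forall i, CkOn D n (fun x y => Y x y i)) ->
  (forall i, CkOn D n (fun x y => Z x y i)) -> CkOn D n (fun x y => lor (Y x y) (Z x y)).
Proof.
move=> CY CZ; have CM i j : CkOn D n (fun x y => Y x y i * Z x y j) by apply: CkOn_mult.
do 3 (apply: CkOn_plus => //); apply: CkOn_opp; exact: CkOn_plus.
Qed.

Lemma CkOn_lift_E n : CkOn D n lift_E.
Proof.
apply: CkOn_minus; first by apply: CkOn_lor => i; apply: CkOn_lift_dt.
have C : CkOn D n (fun tau t => lor (lift_dt 2 tau t) (lift_dt 2 tau t)).
  by apply: CkOn_lor => i; apply: CkOn_lift_dt.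
by apply: CkOn_ext (CkOn_mult _ _ _ _ C C) => x y; ring.
Qed.

Lemma lift_var_constraints tau t : D tau ->
  lor (lift_dt 0 tau t) (lift_var 0 tau t) = 0 /\ lor (lift_dt 1 tau t) (lift_var 1 tau t) = 0 /\
  is_derive (fun s => lift_E s t) tau
    (2 * lor (lift_dt 3 tau t) (lift_var 3 tau t)
     - 4 * lor (lift_dt 2 tau t) (lift_dt 2 tau t) * lor (lift_dt 2 tau t) (lift_var 2 tau t)).
Proof.
move=> Dt.
have dl m := is_derive_lor (fun s => lift_dt m s t) (fun s => lift_dt m s t) _ _ tau
  (fun i => is_derive_lift_dt m tau t i Dt) (fun i => is_derive_lift_dt m tau t i Dt).
have cst m c : (forall s, D s -> lor (lift_dt m s t) (lift_dt m s t) = c) ->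
    lor (lift_dt m tau t) (lift_var m tau t) = 0.
  move=> E; have := is_derive_unique _ _ _ (dl m).
  rewrite (Derive_ext_loc _ (fun _ => c)); last by apply: filter_imp (oD tau Dt) => s /E.
  by rewrite Derive_const lor_sym; lra.
split; first by apply: (cst 0%nat 0) => s Ds; have [_ [-> _]] := lift_family_products s Ds.
split; first by apply: (cst 1%nat 1) => s Ds; have [_ [_ ->]] := lift_family_products s Ds.
have H := is_derive_minus (K := R_AbsRing) (V := R_NormedModule) _ _ _ _ _ (dl 3%nat)
   (is_derive_Rmult _ _ _ _ _ (dl 2%nat) (dl 2%nat)).
apply: (is_derive_ext (fun s => minus (lor (lift_dt 3 s t) (lift_dt 3 s t)) (lor (lift_dt 2 s t) (lift_dt 2 s t) * lor (lift_dt 2 s t) (lift_dt 2 s t)))).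
  by move=> s; rewrite /lift_E /minus /plus /opp /=; ring.
apply: is_derive_val H _; rewrite /minus /plus /opp /=.
by rewrite (lor_sym (lift_var 3 tau t)) (lor_sym (lift_var 2 tau t)); ring.
Qed.

(** The integrand is the fourth root of [lift_E]; since [lift_E] is 1 on the base curve, the root
    contributes the factor 1/4. *)
Lemma is_derive_length x l r : D x -> (forall tau t, D tau -> 0 < lift_E tau t) ->
  (forall t, lift_E x t = 1) ->
  is_derive (fun tau => RInt (eta (V tau)) l r) x
    (RInt (fun t => lor (lift_dt 3 x t) (lift_var 3 x t) / 2
      - lor (lift_dt 2 x t) (lift_dt 2 x t) * lor (lift_dt 2 x t) (lift_var 2 x t)) l r).
Proof.
move=> Dx pos E1.
have C : CkOn D 1 (fun tau t => sqrt (sqrt (lift_E tau t))).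
  apply: CkOn_sqrt => [tau t Dt|]; first by apply: sqrt_lt_R0; apply: pos.
  by apply: CkOn_sqrt => //; apply: CkOn_lift_E.
have H := is_derive_RInt_CkOn _ oD _ x l r C Dx.
apply: (is_derive_ext_loc (fun tau => RInt (fun t => sqrt (sqrt (lift_E tau t))) l r)).
  apply: filter_imp (oD x Dx) => tau Dt; apply: RInt_ext => t _.
  by rewrite eta_lift_family.
apply: is_derive_val H _; apply: RInt_ext => t _.
have [_ [_ dE]] := lift_var_constraints x t Dx.
have dS := is_derive_sqrt _ _ _ dE (pos x t Dx).
have := is_derive_sqrt _ _ _ dS (sqrt_lt_R0 _ (pos x t Dx)).
move/is_derive_unique; rewrite /dx => ->.
by rewrite E1 !sqrt_1; as_R; field.
Qed.

End LiftFamily.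

(** For the ends of the support: boundary terms vanish outside [[l, r]] by locality, and at [l] and
    [r] themselves by continuity. *)
Lemma continuous_zero_left (f : R -> R) x : continuous f x -> (forall y, y < x -> f y = 0) -> f x = 0.
Proof.
move=> /continuity_pt_filterlim C H; case: (Req_dec (f x) 0) => // n0.
have [d [d0 Hd]] := C (Rabs (f x)) (Rabs_pos_lt _ n0).
have := Hd (x - d / 2); rewrite /D_x /no_cond /= /Rdist H; last lra.
rewrite Rminus_0_l Rabs_Ropp => h; suff : Rabs (f x) < Rabs (f x) by lra.
apply: h; split; first by split=> //; lra.
by rewrite (_ : _ - x = - (d / 2)); [rewrite Rabs_Ropp Rabs_pos_eq; lra|lra].
Qed.

Lemma continuous_zero_right (f : R -> R) x : continuous f x -> (forall y, x < y -> f y = 0) -> f x = 0.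
Proof.
move=> C H; have := continuous_zero_left (fun y => f (- y)) (- x); rewrite Ropp_involutive; apply.
  apply: (continuous_comp Ropp f); last by rewrite Ropp_involutive.
  by apply: (ex_derive_continuous Ropp); auto_derive.
by move=> y h; apply: H; lra.
Qed.

Section FirstVariation.
Variables a b : R.
Hypothesis adm : admissible a b.

Let b0 : 0 < b. Proof. by case: (admissible_pos _ _ adm). Qed.
Let ba : b < a. Proof. by case: (admissible_pos _ _ adm). Qed.

Let k := kab a b.
Let kp := kab' a b.
Let k2 := curvature2 a b.
Let k2' := curvature2' a b.
Let k2'' := curvature2'' a b.
Let F j (t : R) (i : nat) := frame_row a b i j t.
Let X2 t i := F 0 t i + k2 t * F 4 t i.
Let X3 t i := 2 * k2 t * F 1 t i + F 2 t i + k2' t * F 4 t i.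

Let dk t : is_derive k t (kp t). Proof. exact: is_derive_kab. Qed.
Let dkp t : is_derive kp t (k t * (a + b - 2 * k t ^ 2)). Proof. exact: is_derive_kab'. Qed.
Let dk2 t : is_derive k2 t (k2' t). Proof. exact: is_derive_curvature2. Qed.
Let dk2' t : is_derive k2' t (k2'' t). Proof. exact: is_derive_curvature2'. Qed.

Let coef_derive (c f : R -> R) t dc df : is_derive c t dc -> is_derive f t df ->
  is_derive (fun s => c s * f s) t (dc * f t + c t * df).
Proof. exact: is_derive_Rmult. Qed.

Let plusD (f g : R -> R) t df dg : is_derive f t df -> is_derive g t dg ->
  is_derive (fun s => f s + g s) t (df + dg).
Proof. exact: (is_derive_plus (K := R_AbsRing) (V := R_NormedModule)). Qed.

Let X4 t i := 2 * k2 t * F 0 t i + 3 * k2' t * F 1 t i - k t * F 3 t i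
  + (1 + 2 * k2 t ^ 2 + k2'' t) * F 4 t i.

Let chain_X4 : chain X3 X4.
Proof.
have [c4 [c1 [c0 [c2 c3]]]] := frame_chains a b adm => t i.
have H := plusD _ _ _ _ _ (plusD _ _ _ _ _ (coef_derive _ _ _ _ _ (is_derive_Rscal _ 2 _ _ (dk2 t)) (c1 t i)) (c2 t i))
  (coef_derive _ _ _ _ _ (dk2' t) (c4 t i)).
by apply: is_derive_val H _; rewrite /X4 -/k -/k2 /F; ring.
Qed.

(* The momenta conjugate to the first derivative of the variation and to the
   variation itself in the Ostrogradsky form of the first variation. *)
Let M1 t i := 2 * k2 t * F 0 t i + k t * F 3 t i + (2 * (k2 t * k2 t) + -1) * F 4 t i.
Let M0 t i := k2' t * F 0 t i + (-2 * k2 t + -1 * (k t * k t)) * F 2 t i + -1 * kp t * F 3 t i.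

Let M1' t i := 2 * k2' t * F 0 t i + 2 * k2 t * (k2 t * F 1 t i + F 2 t i) + kp t * F 3 t i
  + k t * (k t * F 2 t i) + 4 * k2 t * k2' t * F 4 t i + (2 * k2 t ^ 2 - 1) * F 1 t i.
Let M0' t i := k2'' t * F 0 t i + k2' t * (k2 t * F 1 t i + F 2 t i)
  - (2 * k2' t + 2 * k t * kp t) * F 2 t i - (2 * k2 t + k t ^ 2) * (- k t * F 3 t i + F 4 t i)
  - k t * (a + b - 2 * k t ^ 2) * F 3 t i - kp t * (k t * F 2 t i).

Let chain_M1 : chain M1 M1'.
Proof.
have [c4 [c1 [c0 [c2 c3]]]] := frame_chains a b adm => t i.
have H := plusD _ _ _ _ _ (plusD _ _ _ _ _ (coef_derive _ _ _ _ _ (is_derive_Rscal _ 2 _ _ (dk2 t)) (c0 t i))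
   (coef_derive _ _ _ _ _ (dk t) (c3 t i)))
  (coef_derive _ _ _ _ _ (plusD _ _ _ _ _ (is_derive_Rscal _ 2 _ _ (coef_derive _ _ _ _ _ (dk2 t) (dk2 t))) (is_derive_const (-1) t)) (c4 t i)).
by apply: is_derive_val H _; rewrite /M1' /zero /= -/k -/k2 /F; ring.
Qed.

Let chain_M0 : chain M0 M0'.
Proof.
have [c4 [c1 [c0 [c2 c3]]]] := frame_chains a b adm => t i.
have H := plusD _ _ _ _ _ (plusD _ _ _ _ _ (coef_derive _ _ _ _ _ (dk2' t) (c0 t i))
   (coef_derive _ _ _ _ _ (plusD _ _ _ _ _ (is_derive_Rscal _ (-2) _ _ (dk2 t))
        (is_derive_Rscal _ (-1) _ _ (coef_derive _ _ _ _ _ (dk t) (dk t)))) (c2 t i)))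
  (coef_derive _ _ _ _ _ (is_derive_Rscal _ (-1) _ _ (dkp t)) (c3 t i)).
by apply: is_derive_val H _; rewrite /M0' -/k -/k2 /F; ring.
Qed.

Section Field.
Variables P P1 P2 P3 P4 : R -> nat -> R.
Hypotheses (C0 : chain P P1) (C1 : chain P1 P2) (C2 : chain P2 P3) (C3 : chain P3 P4)
  (T0 : forall t, lor (F 4 t) (P t) = 0) (T1 : forall t, lor (F 1 t) (P1 t) = 0).

Definition boundary t := lor (X3 t) (P2 t) + lor (M1 t) (P1 t) + lor (M0 t) (P t).

Lemma boundary_derive t :
  is_derive boundary t (lor (X3 t) (P3 t) + 4 * k2 t * lor (X2 t) (P2 t)).
Proof.
have [c4 [c1 _]] := frame_chains a b adm.
have S0 := lor_const_derive _ _ _ _ _ c4 C0 T0.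
have S1 := lor_const_derive _ _ _ _ _ c1 C1 T1 t.
have S2 : lor (X2 t) (P t) + 2 * lor (F 1 t) (P1 t) + lor (F 4 t) (P2 t) = 0.
  have D s : is_derive (fun s => lor (F 1 s) (P s) + lor (F 4 s) (P1 s)) s
     ((lor (X2 s) (P s) + lor (F 1 s) (P1 s)) + (lor (F 1 s) (P1 s) + lor (F 4 s) (P2 s))).
    by apply: plusD; apply: is_derive_lor => i; [apply: c1|apply: C0|apply: c4|apply: C1].
  have := is_derive_unique _ _ _ (D t).
  by rewrite (Derive_ext _ (fun _ => 0)) // Derive_const; lra.
have {}S0 := S0 t.
have H := plusD _ _ _ _ _ (plusD _ _ _ _ _ (is_derive_lor _ _ _ _ t (chain_X4 t) (C2 t))
  (is_derive_lor _ _ _ _ t (chain_M1 t) (C1 t))) (is_derive_lor _ _ _ _ t (chain_M0 t) (C0 t)).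
apply: is_derive_val H _.
(* The string equations enter as [k2' = - 3 * k * kp] and, after [a + b] is eliminated,
   [kp' = k * (2 * k2 + k ^ 2)]. *)
have E2' : k2' t = -3 * k t * kp t by [].
have E2 : 2 * k2 t = a + b - 3 * k t ^ 2 by rewrite /k2 /curvature2 -/k; field.
have t0 := T0 t; have t1 := T1 t.
rewrite -/(X2 t) in S1.
set L := (X in X = _); set Rt := (X in _ = X).
(* The two sides differ by a combination of the constraints [(F 4, P) = 0], [(F 1, P1) = 0] and
   their derivatives; the coefficients are the multipliers that make the difference an identity for
   an arbitrary field. *)
have -> : L = Rt + 3 * k2' t * (lor (X2 t) (P1 t) + lor (F 1 t) (P2 t))
   + k2'' t * (lor (X2 t) (P t) + 2 * lor (F 1 t) (P1 t) + lor (F 4 t) (P2 t))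
   + k2 t * k2' t * (lor (F 1 t) (P t) + lor (F 4 t) (P1 t))
   + (4 * k2 t ^ 2 - 1 - 2 * k2'' t) * lor (F 1 t) (P1 t)
   - (2 * k2 t + k t ^ 2 + k2 t * k2'' t) * lor (F 4 t) (P t); last first.
  rewrite (_ : lor (X2 t) (P1 t) + lor (F 1 t) (P2 t) = 0) // S2 S0 t0 t1; ring.
rewrite /L /Rt /lor /X2 /X3 /X4 /M1 /M1' /M0 /M0' E2'.
have -> : a + b = 2 * k2 t + 3 * k t ^ 2 by lra.
ring.
Qed.

Lemma RInt_boundary l r :
  RInt (fun t => lor (X3 t) (P3 t) + 4 * k2 t * lor (X2 t) (P2 t)) l r = boundary r - boundary l.
Proof.
have [c4 [c1 _]] := frame_chains a b adm.
apply: is_RInt_unique; apply: (is_RInt_derive boundary) => t _; first exact: boundary_derive.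
apply: ex_derive_continuous; eexists; apply: plusD.
  by apply: is_derive_lor => i; [apply: chain_X4|apply: C3].
apply: (coef_derive (fun t => 4 * k2 t)); first exact: is_derive_Rscal (dk2 t).
by apply: is_derive_lor => i; [apply: chain_X3|apply: C2].
Qed.

End Field.

Lemma lor_ext v v' w w' : (forall i, (i < 5)%nat -> v i = v' i) -> (forall i, (i < 5)%nat -> w i = w' i) ->
  lor v w = lor v' w'.
Proof. by move=> H H'; rewrite /lor !H // !H'. Qed.

Theorem critical_model_string : critical (model_string a b).
Proof.
split; first exact: generic_model_string.
move=> V l r lr [sm [V0 [Vout [e [e0 gen]]]]].
have EV : V 0 = model_string a b by apply: functional_extensionality.
pose D tau := Rabs tau < e.
have oD : open D.
  apply: (open_comp Rabs (fun x => x < e)); last exact: open_lt.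
  by move=> x _; apply: continuous_Rabs.
have D0 : D 0 by rewrite /D Rabs_R0.
have CV n (j : 'I_3) : CkOn D n (fun tau t => V tau t j ord0).
  by apply: CkOn_of_smooth2; apply: sm.
have reg tau t : D tau -> Dcurve (V tau) t <> GRing.zero by move=> /gen [_ [h _]].
have pos tau t : D tau -> 0 < lift_E V tau t.
  move=> Dt; have [_ [_ h]] := gen tau Dt; have := h t.
  rewrite (eta_lift_family D oD V CV reg) // => n0.
  (* Because [sqrt] is 0 on nonpositive numbers, a nonpositive [lift_E] would make [eta] vanish,
     against genericity. *)
  case: (Rlt_le_dec 0 (lift_E V tau t)) => // h'; case: n0.
  by rewrite (sqrt_neg_0 _ h') sqrt_0.
have [c4 [c1 _]] := frame_chains a b adm.
have G i j t : (i < 5)%nat -> (j < 5)%nat -> lor (F i t) (F j t) = gram i j by exact: frame_gram.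
(* The lift at [tau = 0] is column 4 of the frame, so its derivatives are known from the frame
   equations. *)
have L0 t i : (i < 5)%nat -> lift_dt V 0 0 t i = F 4 t i.
  move=> hi; rewrite /lift_dt /= EV /lift.
  have null s : lor (F 4 s) (F 4 s) = 0 by rewrite G.
  have unit_speed s : lor (F 1 s) (F 1 s) = 1 by rewrite G.
  by symmetry; apply: (lift_unique _ _ _ _ c4 c1 (chain_X3 a b adm) (frame_44_pos a b adm) null unit_speed _ (model_string_frame a b adm)).
have Lstep m (Z Z1 : R -> nat -> R) : chain Z Z1 ->
    (forall t i, (i < 5)%nat -> lift_dt V m 0 t i = Z t i) ->
    forall t i, (i < 5)%nat -> lift_dt V m.+1 0 t i = Z1 t i.
  move=> CZ E t i hi; rewrite -(is_derive_unique _ _ _ (CZ t i)).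
  by apply: Derive_ext => s; apply: E.
have L1 := Lstep _ _ _ c4 L0.
have L2 := Lstep _ _ _ c1 L1.
have L3 := Lstep _ _ _ (chain_X3 a b adm) L2.
have E1 t : lift_E V 0 t = 1.
  have [E _] := frame_lift_invariant a b adm t.
  by rewrite /lift_E (lor_ext _ (X3 t) _ (X3 t)) ?(lor_ext (lift_dt V 2 0 t) (X2 t) _ (X2 t)) // => i hi; [apply: L2|apply: L2|apply: L3|apply: L3].
have H := is_derive_length D oD V CV reg 0 l r D0 pos E1.
apply: is_derive_val H _.
pose P m := lift_var V m 0.
have CP m : chain (P m) (P m.+1) by apply: (chain_lift_var D oD V CV reg).
have T0 t : lor (F 4 t) (P 0%nat t) = 0.
  have [E _] := lift_var_constraints D oD V CV reg 0 t D0; rewrite -E.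
  by apply: lor_ext => // i hi; rewrite L0.
have T1 t : lor (F 1 t) (P 1%nat t) = 0.
  have [_ [E _]] := lift_var_constraints D oD V CV reg 0 t D0; rewrite -E.
  by apply: lor_ext => // i hi; rewrite L1.
rewrite (RInt_ext _ (fun t => / 2 * (lor (X3 t) (P 3%nat t) + 4 * k2 t * lor (X2 t) (P 2%nat t)))); last first.
  move=> t _; have [_ E] := frame_lift_invariant a b adm t.
  have -> : lor (lift_dt V 2 0 t) (lift_dt V 2 0 t) = lor (X2 t) (X2 t) by apply: lor_ext => i; apply: L2.
  have -> : lor (lift_dt V 2 0 t) (lift_var V 2 0 t) = lor (X2 t) (P 2%nat t) by apply: lor_ext => // i; apply: L2.
  have -> : lor (lift_dt V 3 0 t) (lift_var V 3 0 t) = lor (X3 t) (P 3%nat t) by apply: lor_ext => // i; apply: L3.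
  by rewrite E -/k2; as_R; field.
(* The lift involves the speed, hence a derivative in [t]. Off [[l, r]] all curves [V tau] agree on
   a neighbourhood of [t], so the lift there is independent of [tau]. *)
have out m t i : t < l \/ r < t -> P m t i = 0.
  elim: m t => [|m IH] t ht.
    rewrite /P /lift_var /= /dx (Derive_ext _ (fun _ => lift (V 0) t i)); first exact: Derive_const.
    move=> tau; rewrite /lift /speed.
    have -> : Dcurve (V tau) t = Dcurve (V 0) t.
      apply/matrixP => j j'; rewrite !mxE; apply: Derive_ext_loc.
      case: ht => ht.
        by apply: filter_imp (open_lt l t ht) => s hs; rewrite V0 Vout //; left; apply: Rlt_le.
      by apply: filter_imp (open_gt r t ht) => s hs; rewrite V0 Vout //; right; apply: Rlt_le.
    by rewrite V0 Vout //; case: ht => ht; [left|right]; apply: Rlt_le.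
  rewrite -(is_derive_unique _ _ _ (CP m t i)) (Derive_ext_loc _ (fun _ => 0)); first exact: Derive_const.
  case: ht => ht.
    by apply: filter_imp (open_lt l t ht) => s hs; apply: IH; left.
  by apply: filter_imp (open_gt r t ht) => s hs; apply: IH; right.
pose Bd := boundary (P 0%nat) (P 1%nat) (P 2%nat).
have dB t := boundary_derive _ _ _ _ (CP 0%nat) (CP 1%nat) (CP 2%nat) T0 T1 t.
have cB t : continuous Bd t by apply: ex_derive_continuous; eexists; exact: dB.
have Bout t : t < l \/ r < t -> Bd t = 0.
  by move=> ht; rewrite /Bd /boundary /lor !(out _ t _ ht); ring.
have Bl : Bd l = 0 by apply: continuous_zero_left (cB l) _ => t ht; apply: Bout; left.
have Br : Bd r = 0 by apply: continuous_zero_right (cB r) _ => t ht; apply: Bout; right.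
have I := RInt_boundary _ _ _ _ _ (CP 0%nat) (CP 1%nat) (CP 2%nat) (CP 3%nat) T0 T1 l r.
rewrite -/Bd Bl Br in I.
rewrite (RInt_scal (V := R_CompleteNormedModule) _ l r (/ 2)); first by rewrite I /scal /= /mult /=; ring.
apply: ex_RInt_continuous => t _; apply: ex_derive_continuous; eexists; apply: plusD.
  by apply: is_derive_lor => i; [apply: chain_X4|apply: CP].
apply: (coef_derive (fun t => 4 * k2 t)); first exact: is_derive_Rscal (dk2 t).
by apply: is_derive_lor => i; [apply: chain_X3|apply: CP].
Qed.

End FirstVariation.

(** * The identity component of the Moebius group *)

Module MoebiusPath.
Import boolp classical_sets filter topology normedtype.
Import Num.Theory GRing.Theory.
Local Open Scope classical_set_scope.

Lemma continuous_matrix (f : R -> 'M[R]_5) :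
  (forall i j t, continuity_pt (fun s => f s i j) t) -> continuous f.
Proof.
move=> C t A [P MP sub].
pose Q (ij : 'I_5 * 'I_5) : set R := [set s | P ij.1 ij.2 (f s ij.1 ij.2)].
have HQ ij : nbhs t (Q ij).
  by have /continuity_ptE := C ij.1 ij.2 t; apply; apply: MP.
have H := filter_forall (nbhs_filter t) HQ.
apply: filterS H => s H; apply: sub => i j.
exact: (H (i, j)).
Qed.

(** The image of the line under the path is connected and stays in the group, hence within one
    component. *)
Lemma moebius_path (f : R -> 'M[R]_5) :
  (forall i j t, continuity_pt (fun s => f s i j) t) -> (forall t, moebius_group (f t)) ->
  forall s t, moebius_group_id (f s) -> moebius_group_id (f t).
Proof.
move=> C G s t; rewrite /moebius_group_id /IdentityComponent.moebius_group_id => H.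
apply: connected_component_trans H _.
have con : connected (f @` [set: R]).
  apply: connected_continuous_connected; last exact/continuous_subspaceT/continuous_matrix.
  by apply/connected_intervalP => x y _ _ z _.
have sub : f @` [set: R] `<=` [set B : 'M[R]_5 | moebius_group B] by move=> _ [u _ <-]; apply: G.
by apply: (connected_component_max _ sub con); [exists s|exists t].
Qed.

Lemma moebius_id_1 : moebius_group (@scalar_mx R 5 (GRing.one _)) -> moebius_group_id (@scalar_mx R 5 (GRing.one _)).
Proof. by move=> H; apply: connected_component_refl. Qed.

Lemma moebius_id_sub A : moebius_group_id A -> moebius_group A.
Proof. exact: connected_component_sub. Qed.

End MoebiusPath.

Import MoebiusPath.

(** Indexing by natural numbers lets case analysis and [ring] replace computations with ordinals. *)
Definition mx5 (f : nat -> nat -> R) : 'M[R]_5 := \matrix_(i < 5, j < 5) f i j.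
Definition ent (A : 'M[R]_5) (i j : nat) : R := A (inord i) (inord j).
Definition mul5 (f g : nat -> nat -> R) (i j : nat) : R :=
  f i 0%nat * g 0%nat j + f i 1%nat * g 1%nat j + f i 2%nat * g 2%nat j
  + f i 3%nat * g 3%nat j + f i 4%nat * g 4%nat j.
Definition delta5 (i j : nat) : R := if i == j then 1 else 0.
Definition iso (f : nat -> nat -> R) : Prop :=
  forall i j, (i < 5)%nat -> (j < 5)%nat -> lor (f^~ i) (f^~ j) = gram i j.

Lemma ent_mx5 f i j : (i < 5)%nat -> (j < 5)%nat -> ent (mx5 f) i j = f i j.
Proof. by move=> hi hj; rewrite /ent mxE !inordK. Qed.

Lemma mx5_ent A : mx5 (ent A) = A.
Proof. by apply/matrixP => i j; rewrite mxE /ent !inord_val. Qed.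

Lemma mx5_ext f g : (forall i j, (i < 5)%nat -> (j < 5)%nat -> f i j = g i j) -> mx5 f = mx5 g.
Proof. by move=> E; apply/matrixP => i j; rewrite !mxE; apply: E. Qed.

Lemma sum5 (G : 'I_5 -> R) : \big[GRing.add/GRing.zero]_(j < 5) G j =
  G (inord 0) + G (inord 1) + G (inord 2) + G (inord 3) + G (inord 4).
Proof.
rewrite !big_ord_recr big_ord0 /= GRing.add0r.
rewrite -!RplusE.
by congr (_ + _ + _ + _ + _); congr G; apply: val_inj; rewrite /= inordK.
Qed.

Lemma mx5_mul f g : mulmx (mx5 f) (mx5 g) = mx5 (mul5 f g).
Proof. by apply/matrixP => i j; rewrite !mxE sum5 !mxE !inordK. Qed.

Lemma mx5_1 : mx5 delta5 = (@scalar_mx R 5 (GRing.one _)).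
Proof. by apply/matrixP => i j; rewrite !mxE /delta5 -val_eqE; case: eqP. Qed.

Lemma lorentzE v w : lorentz v w = lor (entry v) (entry w).
Proof.
rewrite /lorentz 3?big_ltn // big_geq // GRing.addr0 /lor.
transitivity (- (entry v 0 * entry w 4 + entry v 4 * entry w 0)
  + (entry v 1 * entry w 1 + (entry v 2 * entry w 2 + entry v 3 * entry w 3))); first by [].
by ring.
Qed.

Definition act5 (f : nat -> nat -> R) (v : nat -> R) (i : nat) : R :=
  f i 0%nat * v 0%nat + f i 1%nat * v 1%nat + f i 2%nat * v 2%nat
  + f i 3%nat * v 3%nat + f i 4%nat * v 4%nat.

Lemma entry_mul f (v : 'cV[R]_5) i : (i < 5)%nat -> entry (mulmx (mx5 f) v) i = act5 f (entry v) i.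
Proof. by move=> hi; rewrite /entry mxE sum5 !mxE !inordK. Qed.

Lemma iso_lor f v w : iso f -> lor (act5 f v) (act5 f w) = lor v w.
Proof.
move=> H; pose c i j := lor (f^~ i) (f^~ j).
pose S i := c i 0%nat * w 0%nat + c i 1%nat * w 1%nat + c i 2%nat * w 2%nat
  + c i 3%nat * w 3%nat + c i 4%nat * w 4%nat.
transitivity (v 0%nat * S 0%nat + v 1%nat * S 1%nat + v 2%nat * S 2%nat + v 3%nat * S 3%nat + v 4%nat * S 4%nat).
  by rewrite /S /c /lor /act5; ring.
by rewrite /S /c !H //= /lor; ring.
Qed.

Lemma iso_lorentz f v w : iso f -> lorentz (mulmx (mx5 f) v) (mulmx (mx5 f) w) = lorentz v w.
Proof. by move=> H; rewrite !lorentzE -[RHS](iso_lor f _ _ H) /lor !entry_mul. Qed.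

Lemma moebius_group_mx5 f : iso f -> \det (mx5 f) = 1 -> moebius_group (mx5 f).
Proof. by move=> H D; split=> // v w; apply: iso_lorentz. Qed.

Lemma moebius_iso A : moebius_group A -> iso (ent A).
Proof.
case=> H _ i j hi hj.
pose e k : 'cV[R]_5 := \col_(l < 5) delta5 l k.
have E k l : (k < 5)%nat -> (l < 5)%nat -> entry (mulmx A (e k)) l = ent A l k.
  move=> hk hl; rewrite -{1}(mx5_ent A) entry_mul // /act5 /entry !mxE !inordK //.
  by case: k hk => [|[|[|[|[|k]]]]] // _; rewrite /delta5 /=; ring.
have := H (e i) (e j); rewrite !lorentzE {1}/lor !E // => {}E.
transitivity (lor (entry (e i)) (entry (e j))); first exact: E.
rewrite /lor /entry !mxE !inordK // {E}.
by case: i hi => [|[|[|[|[|i]]]]] // _; case: j hj => [|[|[|[|[|j]]]]] // _; rewrite /delta5 /gram /=; ring.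
Qed.

Lemma iso_gram f : iso f -> mulmx (mx5 (fun i j => f j i)) (mulmx (mx5 gram) (mx5 f)) = mx5 gram.
Proof.
move=> H; rewrite !mx5_mul; apply: mx5_ext => i j hi hj.
by rewrite -(H i j hi hj) /mul5 /lor /=; ring.
Qed.

Lemma gram_sq : mulmx (mx5 gram) (mx5 gram) = (@scalar_mx R 5 (GRing.one _)).
Proof.
rewrite mx5_mul -mx5_1; apply: mx5_ext => i j hi hj.
by case: i hi => [|[|[|[|[|i]]]]] // _; case: j hj => [|[|[|[|[|j]]]]] // _; rewrite /mul5 /delta5 /=; ring.
Qed.

Lemma iso_det_sq f : iso f -> \det (mx5 f) * \det (mx5 f) = 1.
Proof.
move=> H; pose J := mx5 gram.
have detG : \det (mx5 (fun i j => f j i)) = \det (mx5 f).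
  by rewrite -det_tr; congr determinant; apply/matrixP => i j; rewrite !mxE.
have d1 : \det J * \det J = 1 by have := congr1 determinant gram_sq; rewrite det_mulmx det1.
have := congr1 determinant (iso_gram f H); rewrite !det_mulmx detG.
change (\det (mx5 f) * (\det J * \det (mx5 f)) = \det J -> \det (mx5 f) * \det (mx5 f) = 1).
move=> h; have j0 : \det J <> 0 by move=> j0; rewrite j0 in d1; lra.
by apply: (Rmult_eq_reg_l (\det J)) => //; lra.
Qed.

Record one_param (f : R -> nat -> nat -> R) : Prop := OneParam {
  op_iso : forall t, iso (f t);
  op_add : forall s t i j, (i < 5)%nat -> (j < 5)%nat -> mul5 (f s) (f t) i j = f (s + t) i j;
  op_0 : forall i j, (i < 5)%nat -> (j < 5)%nat -> f 0 i j = delta5 i j;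
  op_cont : forall i j t, (i < 5)%nat -> (j < 5)%nat -> continuity_pt (fun s => f s i j) t }.

(** [f t] is the square of the isometry [f (t / 2)], whose determinant squares to 1. *)
Lemma one_param_det f t : one_param f -> \det (mx5 (f t)) = 1.
Proof.
case=> I A _ _; have E : mx5 (f t) = mulmx (mx5 (f (t / 2))) (mx5 (f (t / 2))).
  by rewrite mx5_mul; apply: mx5_ext => i j hi hj; rewrite A //; congr f; field.
by rewrite E det_mulmx; exact: iso_det_sq.
Qed.

(** The path [f s A] joins [A] to [f t A] inside the group, so multiplication by a one-parameter
    subgroup does not change the component. *)
Lemma one_param_reduce f t A : one_param f -> moebius_group A ->
  moebius_group_id (mulmx (mx5 (f t)) A) -> moebius_group_id A.
Proof.
move=> O GA H; pose B := ent (mulmx (mx5 (f t)) A).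
pose path s := mulmx (mx5 (f s)) A.
have -> : A = path 0.
  rewrite /path (mx5_ext (f 0) delta5) ?mx5_1 ?mul1mx // => i j hi hj; exact: op_0.
apply: (moebius_path path _ _ t) => // [i j u|u].
  apply: (continuity_pt_ext (fun s => f s i 0%nat * ent A 0 j + f s i 1%nat * ent A 1 j + f s i 2%nat * ent A 2 j
     + f s i 3%nat * ent A 3 j + f s i 4%nat * ent A 4 j)).
    move=> s; have -> : path s = mulmx (mx5 (f s)) (mx5 (ent A)) by rewrite mx5_ent.
    by rewrite mx5_mul mxE /mul5 /ent inord_val.
  have c k : (k < 5)%nat -> continuity_pt (fun s => f s i k * ent A k j) u.
    move=> hk; apply: (continuity_pt_mult (fun s => f s i k) (fun _ => ent A k j)).
      exact: op_cont.
    exact: continuity_pt_const.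
  have p g h : continuity_pt g u -> continuity_pt h u -> continuity_pt (fun s => g s + h s) u.
    exact: continuity_pt_plus.
  by do 4 (apply: (p) => //; last exact: c); apply: c.
split=> [v w|]; rewrite /path.
  by rewrite -!mulmxA iso_lorentz; [case: GA|apply: op_iso].
by rewrite det_mulmx one_param_det //; case: GA => _ ->; apply: GRing.mulr1.
Qed.

Definition rotation (p q : nat) (t : R) (i j : nat) : R :=
  if i == p then (if j == p then cos t else if j == q then sin t else 0)
  else if i == q then (if j == p then - sin t else if j == q then cos t else 0)
  else delta5 i j.

Definition translation (x y z t : R) (i j : nat) : R :=
  match i, j with
  | 0, 1 => t * x | 0, 2 => t * y | 0, 3 => t * z
  | 0, 4 => t ^ 2 * (x ^ 2 + y ^ 2 + z ^ 2) / 2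
  | 1, 4 => t * x | 2, 4 => t * y | 3, 4 => t * z
  | _, _ => delta5 i j
  end.

(* The conjugate of a translation by the inversion exchanging the origin and
   the point at infinity. *)
Definition inverted_translation (x y z t : R) (i j : nat) : R :=
  translation z y x t (4 - i)%nat (4 - j)%nat.

Definition dilation (t : R) (i j : nat) : R :=
  match i, j with 0, 0 => exp (- t) | 4, 4 => exp t | _, _ => delta5 i j end.

Ltac five i hi := case: i hi => [|[|[|[|[|i]]]]] // hi.

Lemma translation_one_param x y z : one_param (translation x y z).
Proof.
split.
- by move=> t i j hi hj; five i hi; five j hj; rewrite /lor /translation /delta5 /gram /=; field.
- by move=> s t i j hi hj; five i hi; five j hj; rewrite /mul5 /translation /delta5 /=; field.
- by move=> i j hi hj; five i hi; five j hj; rewrite /translation /delta5 /=; field.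
- move=> i j t hi hj; apply: derivable_continuous_pt; apply: ex_derive_Reals_0.
  by five i hi; five j hj; rewrite /translation /delta5 /=; auto_derive.
Qed.

Lemma inverted_translation_one_param x y z : one_param (inverted_translation x y z).
Proof.
split.
- by move=> t i j hi hj; five i hi; five j hj; rewrite /lor /inverted_translation /translation /delta5 /gram /=; field.
- by move=> s t i j hi hj; five i hi; five j hj; rewrite /mul5 /inverted_translation /translation /delta5 /=; field.
- by move=> i j hi hj; five i hi; five j hj; rewrite /inverted_translation /translation /delta5 /=; field.
- move=> i j t hi hj; apply: derivable_continuous_pt; apply: ex_derive_Reals_0.
  by five i hi; five j hj; rewrite /inverted_translation /translation /delta5 /=; auto_derive.
Qed.

Lemma dilation_one_param : one_param dilation.
Proof.
split.
- move=> t i j hi hj; have : exp t * exp (- t) = 1 by rewrite -exp_plus Rplus_opp_r exp_0.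
  by five i hi; five j hj; rewrite /lor /dilation /delta5 /gram /=; lra.
- move=> s t i j hi hj; rewrite /dilation Ropp_plus_distr !exp_plus.
  by five i hi; five j hj; rewrite /mul5 /delta5 /=; ring.
- by move=> i j hi hj; rewrite /dilation Ropp_0 exp_0; five i hi; five j hj.
- move=> i j t hi hj; apply: derivable_continuous_pt; apply: ex_derive_Reals_0.
  by five i hi; five j hj; rewrite /dilation /delta5 /=; auto_derive.
Qed.

Lemma rotation_one_param :
  one_param (rotation 1 2) /\ one_param (rotation 1 3) /\ one_param (rotation 2 3).
Proof.
split; [|split].
all: split.
all: try (move=> t i j hi hj; have := sin2_cos2 t; rewrite /Rsqr;
  five i hi; five j hj; rewrite /lor /rotation /delta5 /gram /=; lra).
all: try (move=> s t i j hi hj; rewrite /rotation cos_plus sin_plus;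
  five i hi; five j hj; rewrite /mul5 /delta5 /=; ring).
all: try (move=> i j hi hj; rewrite /rotation cos_0 sin_0; five i hi; five j hj; rewrite /delta5 /=; ring).
all: move=> i j t hi hj; apply: derivable_continuous_pt; apply: ex_derive_Reals_0;
  five i hi; five j hj; rewrite /rotation /delta5 /=; auto_derive; done.
Qed.

Lemma polar p q : exists th rho, 0 <= rho /\ p = rho * cos th /\ q = rho * sin th.
Proof.
case: (Req_dec (p ^ 2 + q ^ 2) 0) => h.
  by exists 0, 0; split; [lra|split; nra].
have r0 : 0 < p ^ 2 + q ^ 2 by have := pow2_ge_0 p; have := pow2_ge_0 q; lra.
pose rho := sqrt (p ^ 2 + q ^ 2).
have rho0 : 0 < rho by apply: sqrt_lt_R0.
have rho2 : rho ^ 2 = p ^ 2 + q ^ 2 by rewrite pow2_sqrt; lra.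
have E : (p / rho) ^ 2 + (q / rho) ^ 2 = 1.
  by transitivity ((p ^ 2 + q ^ 2) / rho ^ 2); [field; lra|rewrite -rho2; field; lra].
have b1 : -1 <= p / rho <= 1 by have := pow2_ge_0 (q / rho); split; nra.
have S : sqrt (1 - Rsqr (p / rho)) = Rabs (q / rho).
  by rewrite -sqrt_Rsqr_abs; congr sqrt; rewrite !Rsqr_pow2; lra.
case: (Rle_lt_dec 0 (q / rho)) => hq.
- exists (acos (p / rho)), rho; rewrite cos_acos // sin_acos // S Rabs_pos_eq //.
  by split; [lra|split; field; lra].
- exists (- acos (p / rho)), rho; rewrite cos_neg sin_neg cos_acos // sin_acos // S Rabs_left //.
  by split; [lra|split; field; lra].
Qed.

Definition fix_col f j := forall i, (i < 5)%nat -> f i j = delta5 i j.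

Lemma moebius_reduce g t f : one_param g -> moebius_group (mx5 f) ->
  (moebius_group (mx5 (mul5 (g t) f)) -> moebius_group_id (mx5 (mul5 (g t) f))) ->
  moebius_group_id (mx5 f).
Proof.
move=> O M H; apply: (one_param_reduce g t) => //; rewrite mx5_mul; apply: H.
have I : iso f by move=> i j hi hj; have := moebius_iso _ M i j hi hj; rewrite /lor !ent_mx5.
rewrite -mx5_mul; split=> [v w|].
  by rewrite -!mulmxA iso_lorentz; [case: M|apply: op_iso].
by rewrite det_mulmx one_param_det //; case: M => _ ->; apply: GRing.mulr1.
Qed.

Lemma moebius_mx5_iso f i j : moebius_group (mx5 f) -> (i < 5)%nat -> (j < 5)%nat ->
  lor (f^~ i) (f^~ j) = gram i j.
Proof. by move=> M hi hj; have := moebius_iso _ M i j hi hj; rewrite /lor !ent_mx5. Qed.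

(** Orthogonality to four basis vectors leaves only the sign of column 3 undecided; the determinant
    fixes it. *)
Lemma moebius_id_fix012 f : moebius_group (mx5 f) ->
  fix_col f 0 -> fix_col f 4 -> fix_col f 1 -> fix_col f 2 -> moebius_group_id (mx5 f).
Proof.
move=> M f0 f4 f1 f2.
have e0 := moebius_mx5_iso f 0 3 M isT isT; have e4 := moebius_mx5_iso f 4 3 M isT isT.
have e1 := moebius_mx5_iso f 1 3 M isT isT; have e2 := moebius_mx5_iso f 2 3 M isT isT.
rewrite /lor !f0 // /delta5 /gram /= in e0; rewrite /lor !f4 // /delta5 /gram /= in e4.
rewrite /lor !f1 // /delta5 /gram /= in e1; rewrite /lor !f2 // /delta5 /gram /= in e2.
have z0 : f 0%nat 3%nat = 0 by lra.
have z4 : f 4%nat 3%nat = 0 by lra.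
have z1 : f 1%nat 3%nat = 0 by lra.
have z2 : f 2%nat 3%nat = 0 by lra.
pose d (j : nat) := if j == 3%nat then f 3%nat 3%nat else 1.
have E : mx5 f = diag_mx (\row_(j < 5) d j).
  apply/matrixP => i j; rewrite [LHS]mxE !mxE -val_eqE.
  case: i j => [i hi] [j hj] /=; five j hj; rewrite ?f0 ?f1 ?f2 ?f4 // /delta5 /d /=;
    five i hi => //=; rewrite ?GRing.mulr1n ?GRing.mulr0n //; lra.
have d1 : f 3%nat 3%nat = 1.
  have [_] := M; rewrite E det_diag.
  rewrite !big_ord_recr big_ord0 /= !mxE /d /= => h.
  by transitivity (1 * 1 * 1 * 1 * f 3%nat 3%nat * 1); [ring|exact: h].
have -> : mx5 f = (@scalar_mx R 5 (GRing.one _)).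
  rewrite -mx5_1; apply: mx5_ext => i j hi hj; five j hj; rewrite ?f0 ?f1 ?f2 ?f4 //.
  by five i hi; rewrite /delta5 /=.
apply: moebius_id_1; rewrite -mx5_1; apply: moebius_group_mx5.
  by move=> i j hi hj; five i hi; five j hj; rewrite /lor /delta5 /gram /=; ring.
by rewrite mx5_1 det1.
Qed.

Lemma moebius_id_fix01 f : moebius_group (mx5 f) ->
  fix_col f 0 -> fix_col f 4 -> fix_col f 1 -> moebius_group_id (mx5 f).
Proof.
move=> M f0 f4 f1.
have e0 := moebius_mx5_iso f 0 2 M isT isT; have e4 := moebius_mx5_iso f 4 2 M isT isT.
have e1 := moebius_mx5_iso f 1 2 M isT isT; have e2 := moebius_mx5_iso f 2 2 M isT isT.
rewrite /lor !f0 // /delta5 /gram /= in e0; rewrite /lor !f4 // /delta5 /gram /= in e4.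
rewrite /lor !f1 // /delta5 /gram /= in e1; rewrite /lor /gram /= in e2.
have [th [rho [rho0 [p q]]]] := polar (f 2%nat 2%nat) (f 3%nat 2%nat).
have z0 : f 0%nat 2%nat = 0 by lra.
have z4 : f 4%nat 2%nat = 0 by lra.
have z1 : f 1%nat 2%nat = 0 by lra.
have cs := sin2_cos2 th; rewrite /Rsqr in cs.
rewrite z0 z1 p q in e2.
have r1 : rho = 1.
  have : rho * rho * (sin th * sin th + cos th * cos th) = 1 by lra.
  by rewrite cs; nra.
have [_ [_ O]] := rotation_one_param.
apply: (moebius_reduce _ th _ O M) => M'; apply: moebius_id_fix012 => // i hi; five i hi;
  rewrite /mul5 /rotation /delta5 /= ?f0 ?f4 ?f1 // ?z0 ?z1 ?z4 ?p ?q ?r1 /delta5 /=; lra.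
Qed.

Lemma moebius_id_fix0 f : moebius_group (mx5 f) ->
  fix_col f 0 -> fix_col f 4 -> moebius_group_id (mx5 f).
Proof.
move=> M f0 f4.
(* A rotation in the plane of axes 1 and 2 makes [f 2 1] vanish; a rotation in the plane of axes 1
   and 3 can then carry the unit column 1 to its basis vector. *)
wlog q0 : f M f0 f4 / f 2%nat 1%nat = 0.
  move=> H; have [th [rho [rho0 [p q]]]] := polar (f 1%nat 1%nat) (f 2%nat 1%nat).
  have [O _] := rotation_one_param.
  apply: (moebius_reduce _ th _ O M) => M'; apply: H => //.
  - by move=> i hi; five i hi; rewrite /mul5 /rotation /delta5 /= ?f0 // /delta5 /=; lra.
  - by move=> i hi; five i hi; rewrite /mul5 /rotation /delta5 /= ?f4 // /delta5 /=; lra.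
  - by rewrite /mul5 /rotation /delta5 /= p q; ring.
have e0 := moebius_mx5_iso f 0 1 M isT isT; have e4 := moebius_mx5_iso f 4 1 M isT isT.
have e1 := moebius_mx5_iso f 1 1 M isT isT.
rewrite /lor !f0 // /delta5 /gram /= in e0; rewrite /lor !f4 // /delta5 /gram /= in e4.
rewrite /lor /gram /= in e1.
have [th [rho [rho0 [p q]]]] := polar (f 1%nat 1%nat) (f 3%nat 1%nat).
have z0 : f 0%nat 1%nat = 0 by lra.
have z4 : f 4%nat 1%nat = 0 by lra.
have cs := sin2_cos2 th; rewrite /Rsqr in cs.
rewrite z0 q0 p q in e1.
have r1 : rho = 1.
  have : rho * rho * (sin th * sin th + cos th * cos th) = 1 by lra.
  by rewrite cs; nra.
have [_ [O _]] := rotation_one_param.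
apply: (moebius_reduce _ th _ O M) => M'; apply: moebius_id_fix01 => // i hi; five i hi;
  rewrite /mul5 /rotation /delta5 /= ?f0 ?f4 // ?z0 ?q0 ?z4 ?p ?q ?r1 /delta5 /=; lra.
Qed.

(** Column 0 is a null vector whose coordinate 0 is 1. The inverted translations fix the vector of
    the origin, column 4, and one of them carries column 0 to the vector at infinity. *)
Lemma moebius_id_fix4 f : moebius_group (mx5 f) -> fix_col f 4 -> moebius_group_id (mx5 f).
Proof.
move=> M f4.
have e0 := moebius_mx5_iso f 0 4 M isT isT; have e1 := moebius_mx5_iso f 0 0 M isT isT.
rewrite /lor !f4 // /delta5 /gram /= in e0; rewrite /lor /gram /= in e1.
have w0 : f 0%nat 0%nat = 1 by lra.
rewrite w0 in e1.
have E4 : f 4%nat 0%nat = (f 1%nat 0%nat ^ 2 + f 2%nat 0%nat ^ 2 + f 3%nat 0%nat ^ 2) / 2 by lra.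
have O := inverted_translation_one_param (- f 1%nat 0%nat) (- f 2%nat 0%nat) (- f 3%nat 0%nat).
apply: (moebius_reduce _ 1 _ O M) => M'; apply: moebius_id_fix0 => // i hi; five i hi;
  rewrite /mul5 /inverted_translation /translation /delta5 /= ?f4 // ?w0 ?E4 /delta5 /=; lra.
Qed.

(** Column 4 represents the image of the origin. Positivity of [f 4 4] permits normalizing it to 1
    by a dilation, after which a translation brings the image back to the origin. *)
Theorem moebius_id_pos f : moebius_group (mx5 f) -> 0 < f 4%nat 4%nat -> moebius_group_id (mx5 f).
Proof.
move=> M.
wlog f44 : f M / f 4%nat 4%nat = 1.
  move=> H p; have O := dilation_one_param.
  apply: (moebius_reduce _ (- ln (f 4%nat 4%nat)) _ O M) => M'.
  have E : mul5 (dilation (- ln (f 4%nat 4%nat))) f 4%nat 4%nat = 1.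
    by rewrite /mul5 /dilation /delta5 /= exp_Ropp exp_ln //; field; lra.
  by apply: H => //; rewrite E; lra.
move=> _; have e4 := moebius_mx5_iso f 4 4 M isT isT; rewrite /lor /gram /= f44 in e4.
have O := translation_one_param (- f 1%nat 4%nat) (- f 2%nat 4%nat) (- f 3%nat 4%nat).
have E0 : f 0%nat 4%nat = (f 1%nat 4%nat ^ 2 + f 2%nat 4%nat ^ 2 + f 3%nat 4%nat ^ 2) / 2 by lra.
apply: (moebius_reduce _ 1 _ O M) => M'; apply: moebius_id_fix4 => // i hi; five i hi;
  rewrite /mul5 /translation /delta5 /= ?f44 ?E0; lra.
Qed.

(** * The determinant of the model frame *)

Definition mxn n (f : nat -> nat -> R) : 'M[R]_n := \matrix_(i < n, j < n) f i j.

Lemma det_mxn_rec n f : \det (mxn n.+1 f) =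
  \big[GRing.add/GRing.zero]_(j < n.+1) (f 0%nat j * ((-1) ^ j * \det (mxn n (fun i k => f i.+1 (bump j k))))).
Proof.
rewrite (expand_det_row _ ord0); apply: eq_bigr => j _.
rewrite mxE /cofactor RpowE add0n; congr (_ * (_ * determinant _)).
by apply/matrixP => i k; rewrite !mxE.
Qed.

Lemma CkLine_det m n (f : R -> nat -> nat -> R) :
  (forall i j, CkLine m (fun t => f t i j)) -> CkLine m (fun t => \det (mxn n (f t))).
Proof.
elim: n f => [|n IH] f H.
  by apply: (CkOn_ext _ _ (fun _ _ => 1)) => [x t|]; [rewrite det_mx00|apply: CkOn_const].
pose term t (j : 'I_n.+1) := f t 0%nat j * ((-1) ^ j * \det (mxn n (fun i k => f t i.+1 (bump j k)))).
have Ct j : CkLine m (term^~ j).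
  apply: (CkOn_mult _ _ (fun _ t => f t 0%nat j)); first exact: H.
  apply: (CkOn_mult _ _ (fun _ _ => (-1) ^ j)); first exact: CkOn_const.
  by apply: (IH (fun t i k => f t i.+1 (bump j k))) => i k; apply: H.
apply: (CkOn_ext _ _ (fun _ t => \big[GRing.add/GRing.zero]_(j < n.+1) term t j)).
  by move=> _ t; rewrite det_mxn_rec.
elim: (index_enum _) => [|j s IHs].
  by apply: (CkOn_ext _ _ (fun _ _ => 0)) => [x t|]; [rewrite big_nil|apply: CkOn_const].
apply: (CkOn_ext _ _ (fun _ t => term t j + \big[GRing.add/GRing.zero]_(j <- s) term t j)).
  by move=> _ t; rewrite big_cons.
exact: (CkOn_plus _ _ _ _ (Ct j) IHs).
Qed.

Lemma det_mxn1 f : \det (mxn 1 f) = f 0%nat 0%nat.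
Proof. by rewrite det_mx11 mxE. Qed.

Lemma det_mxn2 f : \det (mxn 2 f) = f 0%nat 0%nat * f 1%nat 1%nat - f 0%nat 1%nat * f 1%nat 0%nat.
Proof.
rewrite det_mxn_rec !big_ord_recl big_ord0 GRing.addr0 !det_mxn1 -!RplusE /= /bump /= ?(addn0,add0n,add1n); ring.
Qed.

Lemma det_mxn3 f : \det (mxn 3 f) =
  f 0%nat 0%nat * (f 1%nat 1%nat * f 2%nat 2%nat - f 1%nat 2%nat * f 2%nat 1%nat)
  - f 0%nat 1%nat * (f 1%nat 0%nat * f 2%nat 2%nat - f 1%nat 2%nat * f 2%nat 0%nat)
  + f 0%nat 2%nat * (f 1%nat 0%nat * f 2%nat 1%nat - f 1%nat 1%nat * f 2%nat 0%nat).
Proof.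
rewrite det_mxn_rec !big_ord_recl big_ord0 GRing.addr0 !det_mxn2 -!RplusE /= /bump /= ?(addn0,add0n,add1n); ring.
Qed.

(** The zero pattern of the model frame at [t = 0], where [kab'] and both sines vanish: rows 0, 1, 4
    meet columns 0, 3, 4, and rows 2, 3 meet columns 1, 2. *)
Lemma det_mxn5_blocks f :
  f 0%nat 1%nat = 0 -> f 0%nat 2%nat = 0 -> f 1%nat 1%nat = 0 -> f 1%nat 2%nat = 0 ->
  f 4%nat 1%nat = 0 -> f 4%nat 2%nat = 0 ->
  f 2%nat 0%nat = 0 -> f 2%nat 3%nat = 0 -> f 2%nat 4%nat = 0 ->
  f 3%nat 0%nat = 0 -> f 3%nat 3%nat = 0 -> f 3%nat 4%nat = 0 ->
  \det (mxn 5 f) =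
   (f 0%nat 0%nat * (f 1%nat 3%nat * f 4%nat 4%nat - f 1%nat 4%nat * f 4%nat 3%nat)
    - f 0%nat 3%nat * (f 1%nat 0%nat * f 4%nat 4%nat - f 1%nat 4%nat * f 4%nat 0%nat)
    + f 0%nat 4%nat * (f 1%nat 0%nat * f 4%nat 3%nat - f 1%nat 3%nat * f 4%nat 0%nat))
   * (f 2%nat 1%nat * f 3%nat 2%nat - f 2%nat 2%nat * f 3%nat 1%nat).
Proof.
move=> z01 z02 z11 z12 z41 z42 z20 z23 z24 z30 z33 z34.
rewrite det_mxn_rec !big_ord_recl big_ord0 GRing.addr0 !det_mxn_rec !big_ord_recl !big_ord0 !GRing.addr0.
rewrite !det_mxn3 -!RplusE /= /bump /= ?(addn0,add0n,add1n).
rewrite ?z01 ?z02 ?z11 ?z12 ?z41 ?z42 ?z20 ?z23 ?z24 ?z30 ?z33 ?z34; ring.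
Qed.

Definition vessiot_entry (k1 k2 : R) (i j : nat) : R :=
  match i, j with
  | 0, 1 => 1 | 1, 0 => k2 | 1, 4 => 1 | 2, 0 => 1 | 2, 3 => k1
  | 3, 2 => - k1 | 4, 1 => k2 | 4, 2 => 1
  | _, _ => 0
  end.

Lemma vessiot_matrix_mx5 k1 k2 : vessiot_matrix k1 k2 = mx5 (vessiot_entry k1 k2).
Proof.
by apply/matrixP => i j; rewrite !mxE; case: i j => [i hi] [j hj] /=; five i hi; five j hj.
Qed.

Section ModelFrameMatrix.
Variables a b : R.
Hypothesis adm : admissible a b.

Let b0 : 0 < b. Proof. by case: (admissible_pos _ _ adm). Qed.
Let ba : b < a. Proof. by case: (admissible_pos _ _ adm). Qed.

Definition model_frame (t : R) : 'M[R]_5 := mx5 (fun i j => frame_row a b i j t).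

Lemma model_frame_iso t : iso (fun i j => frame_row a b i j t).
Proof. by move=> i j hi hj; apply: frame_gram. Qed.

Let M := mu a b.
Let U := upsilon a b.
Let D := sqrt (M ^ 2 - U ^ 2).
Let k := kab a b.

Lemma det_model_frame_0 : \det (model_frame 0) = 1.
Proof.
have [h1 [h2 [M0 [U0 [D0 [D2 k0]]]]]] := model_gaps a b adm 0.
rewrite -/M -/U -/D -/k in h1 h2 M0 U0 D0 D2 k0.
have kp0 : kab' a b 0 = 0.
  by rewrite /kab' Rmult_0_r (am_0 _ (modulus_bound a b b0 ba)) sin_0; ring.
have AB := model_kp2 a b adm 0; rewrite kp0 -/M -/U -/k in AB.
have th1 : Theta1 a b 0 = 0 by apply: RInt_point.
have th2 : Theta2 a b 0 = 0 by apply: RInt_point.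
have s1 : 0 < sqrt (M ^ 2 - k 0 ^ 2) by apply: sqrt_lt_R0.
have s2 : 0 < sqrt (k 0 ^ 2 - U ^ 2) by apply: sqrt_lt_R0.
have s1' : sqrt (M ^ 2 - k 0 ^ 2) ^ 2 = M ^ 2 - k 0 ^ 2 by rewrite pow2_sqrt; lra.
have s2' : sqrt (k 0 ^ 2 - U ^ 2) ^ 2 = k 0 ^ 2 - U ^ 2 by rewrite pow2_sqrt; lra.
have r2 : 0 < sqrt 2 by apply: sqrt_lt_R0; lra.
have r22 : sqrt 2 ^ 2 = 2 by rewrite pow2_sqrt; lra.
pose f i j := frame_row a b i j 0.
have z i j : [&& i \in [:: 0; 1; 4]%nat & j \in [:: 1; 2]%nat] || [&& i \in [:: 2; 3]%nat & j \in [:: 0; 3; 4]%nat] -> f i j = 0.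
  move=> hij; rewrite /f /frame_row.
  case: i hij => [|[|[|[|[|i]]]]]; case: j => [|[|[|[|[|j]]]]] //= _;
  rewrite /rowT /row1_re /row1_im /row2_re /row2_im /time_row /block_re /block_im
    /phase1_re /phase1_im /phase2_re /phase2_im ?th1 ?th2 ?kp0 ?sin_0; rewrite /Rdiv; ring.
have E : \det (model_frame 0) =
   (f 0%nat 0%nat * (f 1%nat 3%nat * f 4%nat 4%nat - f 1%nat 4%nat * f 4%nat 3%nat)
    - f 0%nat 3%nat * (f 1%nat 0%nat * f 4%nat 4%nat - f 1%nat 4%nat * f 4%nat 0%nat)
    + f 0%nat 4%nat * (f 1%nat 0%nat * f 4%nat 3%nat - f 1%nat 3%nat * f 4%nat 0%nat))
   * (f 2%nat 1%nat * f 3%nat 2%nat - f 2%nat 2%nat * f 3%nat 1%nat).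
  by rewrite (_ : model_frame 0 = mxn 5 f) //; apply: det_mxn5_blocks; rewrite z.
rewrite E /f /frame_row /rowT /row1_re /row1_im /row2_re /row2_im /time_row /block_re /block_im
  /phase1_re /phase1_im /phase2_re /phase2_im th1 th2 kp0 sin_0 cos_0 -/M -/U -/k -/D.
set A := sqrt (M ^ 2 - k 0 ^ 2) in s1 s1' *; set B := sqrt (k 0 ^ 2 - U ^ 2) in s2 s2' *.
have EU : U ^ 2 - k 0 ^ 2 = - B ^ 2 by lra.
rewrite EU -s1'.
(* [p0] and [P0] are the column 0 entries of the two blocks. *)
pose p0 := (M ^ 2 * (U ^ 2 - M ^ 2) - U ^ 2 * k 0 ^ 2 + k 0 ^ 4) / 2.
pose P0 := (U ^ 2 * (M ^ 2 - U ^ 2) - M ^ 2 * k 0 ^ 2 + k 0 ^ 4) / 2.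
as_R.
transitivity (2 / (sqrt 2 ^ 2 * M ^ 2 * U ^ 2 * (D ^ 2) ^ 2 * A ^ 2 * B ^ 2) *
  ((k 0 * (M ^ 2 + U ^ 2 - k 0 ^ 2) / 2 * (- k 0 * (A ^ 2 + B ^ 2))
    - (P0 * A ^ 2 + B ^ 2 * p0) + k 0 ^ 2 * (p0 - P0)) * - (A ^ 2 + B ^ 2))).
  by rewrite /p0 /P0; field; lra.
(* Where [kab'] vanishes the first integral reads [A ^ 2 * B ^ 2 = 1]; thus [M ^ 2], [U ^ 2] and
   [B ^ 2] become rational in [k 0] and [A]. *)
have B2 : B ^ 2 = / A ^ 2.
  by apply: (Rmult_eq_reg_l (A ^ 2)); [rewrite Rinv_r; nra|nra].
have M2 : M ^ 2 = k 0 ^ 2 + A ^ 2 by lra.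
have U2 : U ^ 2 = k 0 ^ 2 - / A ^ 2 by lra.
have U20 : 0 < k 0 ^ 2 - / A ^ 2 by nra.
have kA : 0 < (k 0 * A) ^ 2 - 1.
  have -> : (k 0 * A) ^ 2 - 1 = A ^ 2 * (k 0 ^ 2 - / A ^ 2) by field; lra.
  by apply: Rmult_lt_0_compat => //; nra.
rewrite r22 D2 /p0 /P0 M2 U2 B2; field.
split; first lra.
split; last by split; nra.
have -> : (k 0 ^ 2 + A ^ 2) * A ^ 2 - ((k 0 * A) ^ 2 - 1) = A ^ 4 + 1 by ring.
by have := pow2_ge_0 (A ^ 2); nra.
Qed.

(** The determinant is differentiable with square 1, so its derivative vanishes and it keeps its
    value at 0. *)
Lemma det_model_frame t : \det (model_frame t) = 1.
Proof.
rewrite -det_model_frame_0; pose f t i j := frame_row a b i j t.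
have C : CkLine 1 (fun t => \det (mxn 5 (f t))).
  by apply: CkLine_det => i j; apply: CkLine_frame.
have S u : \det (mxn 5 (f u)) * \det (mxn 5 (f u)) = 1 by apply: (iso_det_sq (f u)); apply: model_frame_iso.
apply: (derive_zero_const (fun t => \det (mxn 5 (f t)))) => u.
have [d Hd] := CkLine_ex_derive _ _ u C.
have H := is_derive_Rmult _ _ _ _ _ Hd Hd.
suff E : d = 0 by rewrite -E.
have := is_derive_unique _ _ _ H; rewrite (Derive_ext _ (fun _ => 1)) // Derive_const.
have n0 : \det (mxn 5 (f u)) <> 0 by move=> E; have := S u; rewrite E; lra.
move=> E; apply: (Rmult_eq_reg_l (\det (mxn 5 (f u)))) => //.
by rewrite Rmult_0_r; apply: (Rmult_eq_reg_l 2); lra.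
Qed.

Lemma model_frame_moebius_id t : moebius_group_id (model_frame t).
Proof.
apply: moebius_id_pos; last exact: frame_44_pos.
by apply: moebius_group_mx5; [apply: model_frame_iso|apply: det_model_frame].
Qed.

Lemma model_vessiot_frame :
  vessiot_frame (model_string a b) model_frame (kab a b) (fun t => - (3 / 2) * kab a b t ^ 2 + (a + b) / 2).
Proof.
split.
  move=> i j; have := smooth_frame a b adm i j.
  by move=> H n t; apply: ex_derive_n_ext (H n t) => s; rewrite mxE.
move=> t; split; first exact: model_frame_moebius_id.
have E4 i : (i < 5)%nat -> entry (col (inord 4) (model_frame t)) i = frame_row a b i 4 t.
  by move=> hi; rewrite /entry !mxE !inordK.
split; first by rewrite E4 //; apply: Rgt_not_eq; apply: frame_44_pos.
split.
  by apply/matrixP => i j; rewrite (ord1 j) model_string_frame // mxE !E4 // ltnS; apply: leq_trans (ltn_ord i) _.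
have U1 : model_frame t \in unitmx by rewrite unitmxE det_model_frame; apply: GRing.unitr1.
rewrite eta_model_string // GRing.scale1r.
apply: (canLR (mulKmx U1)).
rewrite vessiot_matrix_mx5 mx5_mul; apply/matrixP => i j; rewrite !mxE.
rewrite (Derive_ext _ (frame_row a b i j)); last by move=> s; rewrite mxE.
have [d0 [d1 [d2 [d3 d4]]]] := frame_row_vessiot a b adm i t.
case: j => [j hj] /=; five j hj; apply: is_derive_unique; (apply: is_derive_val; first by eassumption);
  rewrite /mul5 /vessiot_entry /curvature2; ring.
Qed.

End ModelFrameMatrix.

(** * Closedness and uniqueness *)

From Stdlib Require Import Lia ZArith QArith Qreals.
Local Open Scope R_scope.

Lemma cos_sin_period_Z x z : cos (x + 2 * PI * IZR z) = cos x /\ sin (x + 2 * PI * IZR z) = sin x.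
Proof.
case: (Z_le_gt_dec 0 z) => hz.
- have E : 2 * PI * IZR z = 2 * INR (Z.to_nat z) * PI by rewrite INR_IZR_INZ Z2Nat.id //; ring.
  by rewrite E cos_period sin_period.
- have E : x = x + 2 * PI * IZR z + 2 * INR (Z.to_nat (- z)) * PI.
    by rewrite INR_IZR_INZ Z2Nat.id ?opp_IZR; [ring|lia].
  by rewrite {2 4}E cos_period sin_period.
Qed.

Lemma rational_common_multiple (q1 q2 : Q) : exists (n : nat) (z1 z2 : Z), (0 < n)%nat /\
  INR n * Q2R q1 = IZR z1 /\ INR n * Q2R q2 = IZR z2.
Proof.
case: q1 q2 => [m1 d1] [m2 d2]; rewrite /Q2R /=.
exists (Pos.to_nat (d1 * d2)), (m1 * Z.pos d2)%Z, (m2 * Z.pos d1)%Z; split.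
  by apply/ltP; apply: Pos2Nat.is_pos.
have n1 := IZR_lt _ _ (Pos2Z.is_pos d1); have n2 := IZR_lt _ _ (Pos2Z.is_pos d2).
by rewrite INR_IZR_INZ positive_nat_Z Pos2Z.inj_mul !mult_IZR; split; field; lra.
Qed.

Section ModelString.
Variables a b : R.
Hypothesis adm : admissible a b.

Let b0 : 0 < b. Proof. by case: (admissible_pos _ _ adm). Qed.
Let ba : b < a. Proof. by case: (admissible_pos _ _ adm). Qed.

Let quasi_period (th f : R -> R) (w : R) : (forall t, is_derive th t (f t)) ->
  (forall t, f (t + w) = f t) -> th 0 = 0 -> forall n t, th (t + INR n * w) = th t + INR n * th w.
Proof.
move=> dth per th0.
have step t : th (t + w) = th t + th w.
  have D s : is_derive (fun s => th (s + w) - th s) s 0.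
    have H : is_derive (fun z => z + w) s 1 by auto_derive.
    have D1 := is_derive_comp th (fun z => z + w) s _ _ (dth (s + w)) H.
    apply: is_derive_val (is_derive_minus (K := R_AbsRing) (V := R_NormedModule) _ _ _ _ _ D1 (dth s)) _.
    by rewrite per /minus /plus /opp /scal /= /mult /=; ring.
  by have := derive_zero_const _ D t 0; rewrite Rplus_0_l th0; lra.
elim=> [|n IH] t; first by rewrite /= !Rmult_0_l !Rplus_0_r.
rewrite S_INR (_ : t + (INR n + 1) * w = t + INR n * w + w); last ring.
by rewrite step IH; ring.
Qed.

Lemma closed_model_string (q1 q2 : Q) : Phi1 a b = - Q2R q1 -> Phi2 a b = Q2R q2 ->
  closed_curve (model_string a b).
Proof.
move=> H1 H2; have [w0 [psiw per]] := omega_spec a b b0 ba.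
(* [n] is a common denominator: after [n] periods of [kab] both angles have grown by integer
   multiples of [2 * PI]. *)
have [n [z1 [z2 [n0 [E1 E2]]]]] := rational_common_multiple q1 q2.
have INRn : 0 < INR n by apply: lt_0_INR; apply/ltP.
have pi0 := PI_RGT_0.
have gaps t := model_gaps a b adm t.
have dom t : continuous (kab a b) t by apply: ex_derive_continuous; eexists; apply: is_derive_kab.
have W1 : Theta1 a b (omega a b) = 2 * PI * Q2R q1.
  have -> : Q2R q1 = - Phi1 a b by lra.
  rewrite /Phi1 /Theta1; set I := RInt _ _ _; set I' := RInt _ _ _.
  have -> : I = - I'; last by field; lra.
  rewrite /I /I' -[- RInt _ _ _](RInt_opp (V := R_CompleteNormedModule)).
    by apply: RInt_ext => t _; rewrite /opp /=; field; have := gaps t; lra.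
  apply: ex_RInt_continuous => t _; apply: ex_derive_continuous.
  by auto_derive; split; [eexists; apply: is_derive_kab|split=> //; have := gaps t; rewrite /=; lra].
have W2 : Theta2 a b (omega a b) = 2 * PI * - Q2R q2.
  rewrite -H2 /Phi2 /Theta2; set I := RInt _ _ _; set I' := RInt _ _ _.
  have -> : I = - I'; last by field; lra.
  rewrite /I /I' -[- RInt _ _ _](RInt_opp (V := R_CompleteNormedModule)).
    by apply: RInt_ext => t _; rewrite /opp /=; field; have := gaps t; lra.
  apply: ex_RInt_continuous => t _; apply: ex_derive_continuous.
  by auto_derive; split; [eexists; apply: is_derive_kab|split=> //; have := gaps t; rewrite /=; lra].
have kn t : kab a b (t + INR n * omega a b) = kab a b t.
  elim: n {n0 E1 E2 INRn} => [|n IH]; first by rewrite /= Rmult_0_l Rplus_0_r.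
  rewrite S_INR (_ : t + (INR n + 1) * omega a b = t + INR n * omega a b + omega a b); last ring.
  by rewrite per.
have T1 t : Theta1 a b (t + INR n * omega a b) = Theta1 a b t + 2 * PI * IZR z1.
  rewrite (quasi_period _ _ _ (is_derive_Theta1 a b adm)) => [||]; last exact: RInt_point.
    by rewrite W1 -E1; ring.
  by move=> s; rewrite per.
have T2 t : Theta2 a b (t + INR n * omega a b) = Theta2 a b t + 2 * PI * IZR (- z2).
  rewrite (quasi_period _ _ _ (is_derive_Theta2 a b adm)) => [||]; last exact: RInt_point.
    by rewrite W2 opp_IZR -E2; ring.
  by move=> s; rewrite per.
exists (INR n * omega a b); split; first exact: Rmult_lt_0_compat.
move=> t; rewrite /model_string /radius kn T1 T2.
have [-> ->] := cos_sin_period_Z (Theta1 a b t) z1.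
by have [-> ->] := cos_sin_period_Z (Theta2 a b t) (- z2).
Qed.

(** For constant [kab] the second-order equation forces [kab ^ 2 = (a + b) / 2], while the first
    integral forces [kab ^ 2] to be [a] or [b]. *)
Lemma kab_not_constant c : ~ (forall t, kab a b t = c).
Proof.
move=> H.
have kp0 t : kab' a b t = 0.
  rewrite -(is_derive_unique _ _ _ (is_derive_kab a b b0 ba t)) (Derive_ext _ (fun _ => c)) //.
  exact: Derive_const.
have := is_derive_unique _ _ _ (is_derive_kab' a b b0 ba 0).
rewrite (Derive_ext _ (fun _ => 0)) // Derive_const => E.
have k0 := kab_pos a b b0 ba 0; have := kab'_sq a b b0 ba 0; rewrite kp0 => E'.
have : a + b - 2 * kab a b 0 ^ 2 = 0 by apply: (Rmult_eq_reg_l (kab a b 0)); lra.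
by nra.
Qed.

Lemma model_conformal_curvatures :
  conformal_curvatures (model_string a b) (kab a b) (fun t => - (3 / 2) * kab a b t ^ 2 + (a + b) / 2).
Proof.
split; first exact: generic_model_string.
by exists (model_frame a b); apply: model_vessiot_frame.
Qed.

Lemma model_has_parameters : has_parameters (model_string a b) a b.
Proof.
split; first exact: critical_model_string.
split; first by split; [apply: generic_model_string|apply: eta_model_string].
exists (model_string a b); split; last exact: model_conformal_curvatures.
exists 1, 0; split; first by left.
by left=> t; rewrite Rmult_1_l Rplus_0_r.
Qed.

Lemma conformal_string_model (q1 q2 : Q) : Phi1 a b = - Q2R q1 -> Phi2 a b = Q2R q2 ->
  conformal_string (model_string a b).
Proof.
move=> H1 H2; split; first exact: critical_model_string.
split; first exact: closed_model_string H1 H2.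
exists (kab a b), (fun t => - (3 / 2) * kab a b t ^ 2 + (a + b) / 2).
split; first exact: model_conformal_curvatures.
by case=> c1 [c2 H]; apply: (kab_not_constant c1) => t; case: (H t).
Qed.

Lemma model_has_modulus : has_modulus (model_string a b) (- Phi1 a b + Ci * Phi2 a b)%C.
Proof.
exists (fun t => t), a, b; split; last by split=> //; split=> //; apply: model_has_parameters.
split.
  apply/smooth_CkLine => n; exact: CkOn_snd.
split=> [t|s]; last by exists s.
by rewrite Derive_id; lra.
Qed.

End ModelString.

Lemma moebius_unit A : moebius_group A -> A \in unitmx.
Proof. by case=> _ d; rewrite unitmxE d; apply: GRing.unitr1. Qed.

Lemma moebius_mul A B : moebius_group A -> moebius_group B -> moebius_group (mulmx A B).
Proof.
case=> H d [H' d']; split=> [v w|]; first by rewrite -!mulmxA H H'.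
by rewrite det_mulmx d d'; apply: GRing.mulr1.
Qed.

Lemma moebius_inv A : moebius_group A -> moebius_group (invmx A).
Proof.
move=> M; have U := moebius_unit _ M; case: M => H d; split=> [v w|].
  by rewrite -H !(mulKVmx U).
by rewrite det_inv d; apply: GRing.invr1.
Qed.

Lemma entry_embed x i : (i < 5)%nat -> entry (embed x) i = euclid_lift x i.
Proof.
move=> hi; rewrite /entry mxE inordK //.
have E1 : inord 1 = GRing.one _ :> 'I_3 by apply: val_inj; rewrite /= inordK.
have E2 : inord 2 = (GRing.natmul (GRing.one _) 2) :> 'I_3 by apply: val_inj; rewrite /= inordK.
by case: i hi => [|[|[|[|[|i]]]]] // _ /=; rewrite ?E1 ?E2.
Qed.

Lemma null_vector_embed (v : 'cV[R]_5) : lor (entry v) (entry v) = 0 -> entry v 4 <> 0 ->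
  v = entry v 4 *: embed (proj3 v).
Proof.
move=> n v4; apply/matrixP => i j; rewrite (ord1 j) mxE.
have -> : v i ord0 = entry v i by rewrite /entry inord_val.
have -> : embed (proj3 v) i ord0 = euclid_lift (proj3 v) i by rewrite -entry_embed // /entry inord_val.
change (entry v i = entry v 4 * euclid_lift (proj3 v) i).
have p (k : nat) (hk : (k < 3)%nat) : proj3 v (inord k) ord0 = entry v k.+1 / entry v 4 by rewrite mxE inordK.
have p0 : proj3 v ord0 ord0 = entry v 1 / entry v 4 by rewrite mxE.
case: i => [[|[|[|[|[|//]]]]] hi] /=; rewrite ?p ?p0 //; try by field.
rewrite dot3E !p // p0; apply: (Rmult_eq_reg_l (2 * entry v 4)); last by move: v4; lra.
by transitivity (entry v 1 * entry v 1 + entry v 2 * entry v 2 + entry v 3 * entry v 3);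
  [move: n; rewrite /lor; lra|field].
Qed.

Lemma continuous_nonvanishing_pos (f : R -> R) : (forall t, continuous f t) -> (forall t, f t <> 0) ->
  0 < f 0 -> forall t, 0 < f t.
Proof.
move=> C n0 p t; case: (Rlt_le_dec 0 (f t)) => // h.
have cf : continuity f by move=> s; apply/continuity_pt_filterlim; apply: C.
have [|s [_ Es]] := IVT_gen f 0 t 0 cf; last by case: (n0 s).
by rewrite Rmin_right ?Rmax_left; lra.
Qed.

(** * Conformal invariance of the arclength element *)

Section EtaInvariance.
Variables (G h : curve) (A : 'M[R]_5) (e c : R).
Hypotheses (gG : generic G) (MA : moebius_group A) (e2 : e * e = 1)
  (act : acts_to A (fun t => G (e * t + c)) h).

(** [A] carries the lift of [G] to a unit null lift of [h] up to sign, since it may exchange the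
    nappes of the cone. Coordinate 4 of the image never vanishes because [h] stays in Euclidean
    space, so by continuity a single sign [eps] serves all parameters. Reversing the parameter
    multiplies the m-th derivative by [e ^ m], which the products do not see. *)
Lemma eta_moebius t : eta h t = eta G (e * t + c).
Proof.
have [sm [reg _]] := gG.
pose D (x : R) := True; have oD : open D by apply: open_true.
(* A constant family, so that the facts on families of lifts apply to the single curve [G]. *)
pose V (tau : R) := G.
have CV n (j : 'I_3) : CkOn D n (fun tau t => V tau t j ord0).
  by have /smooth_CkLine := sm j; apply.
have regV tau s : D tau -> Dcurve (V tau) s <> GRing.zero by move=> _; apply: reg.
pose L m := lift_dt V m 0.
have CL m : chain (L m) (L m.+1) by apply: (chain_lift_dt D oD V CV regV).
have [pos [null unit]] := lift_family_products D oD V CV regV 0 I.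
have EG s := eta_lift_family D oD V CV regV 0 s I.
have EL s i : L 0%nat s i = / speed G s * euclid_lift (G s) i by [].
have s0 s : 0 < speed G s by apply: speed_pos => u; apply: reg.
pose sg s := act5 (ent A) (L 0%nat (e * s + c)) 4.
have actE s : exists2 rho, rho <> 0 & forall i, (i < 5)%nat ->
    act5 (ent A) (L 0%nat (e * s + c)) i = rho * euclid_lift (h s) i.
  have [r [r0 E]] := act s; exists (/ speed G (e * s + c) * r).
    by apply: Rmult_integral_contrapositive_currified => //; apply: Rinv_neq_0_compat; have := s0 (e * s + c); lra.
  move=> i hi; have := congr1 (fun v => entry v i) E.
  rewrite -{1}(mx5_ent A) entry_mul // {2}/entry mxE -/(entry (embed (h s)) i) entry_embed // => Ei.
  have {}Ei : act5 (ent A) (entry (embed (G (e * s + c)))) i = r * euclid_lift (h s) i by exact: Ei.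
  rewrite Rmult_assoc -Ei /act5 !entry_embed // !EL; ring.
have Cchain m : chain (fun s => L m (e * s + c)) (fun s i => e * L m.+1 (e * s + c) i).
  move=> s i; have H : is_derive (fun s => e * s + c) s e by auto_derive => //; ring.
  exact: (is_derive_comp (fun u => L m u i) _ s _ _ (CL m (e * s + c) i) H).
have Cact eps e' m : chain (fun s i => eps * act5 (ent A) (fun l => e' * L m (e * s + c) l) i)
    (fun s i => eps * act5 (ent A) (fun l => e' * e * L m.+1 (e * s + c) l) i).
  move=> s i; apply: is_derive_Rscal; rewrite /act5.
  have term l : is_derive (fun s => ent A i l * (e' * L m (e * s + c) l)) s (ent A i l * (e' * e * L m.+1 (e * s + c) l)).
    by apply: is_derive_Rscal; rewrite Rmult_assoc; apply: is_derive_Rscal; apply: Cchain.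
  pose P := is_derive_plus (K := R_AbsRing) (V := R_NormedModule).
  exact: P _ _ _ _ _ (P _ _ _ _ _ (P _ _ _ _ _ (P _ _ _ _ _ (term 0%nat) (term 1%nat)) (term 2%nat)) (term 3%nat)) (term 4%nat).
have sg0 s : sg s <> 0.
  have [rho r0 E] := actE s; rewrite /sg E //=; lra.
have csg s : continuous sg s.
  apply: ex_derive_continuous; eexists.
  apply: is_derive_ext (Cact 1 1 0%nat s 4%nat) => u; rewrite /sg /act5; as_R; ring.
have [eps [eps2 epos]] : exists eps, eps * eps = 1 /\ forall s, 0 < eps * sg s.
  case: (Rlt_le_dec 0 (sg 0)) => h0.
    by exists 1; split; [ring|move=> s; rewrite Rmult_1_l; apply: continuous_nonvanishing_pos].
  exists (-1); split; [ring|apply: continuous_nonvanishing_pos].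
  - by move=> s; apply: (continuous_scal_r (-1) sg).
  - by move=> s; have := sg0 s; lra.
  - by have := sg0 0; lra.
pose Y m s i := eps * act5 (ent A) (fun l => e ^ m * L m (e * s + c) l) i.
have CY m : chain (Y m) (Y m.+1).
  by move=> s i; have := Cact eps (e ^ m) m s i; rewrite /Y /= (Rmult_comm e (e ^ m)).
have lorY m s : lor (Y m s) (Y m s) = (e * e) ^ m * lor (L m (e * s + c)) (L m (e * s + c)).
  transitivity (eps * eps * lor (act5 (ent A) (fun l => e ^ m * L m (e * s + c) l)) (act5 (ent A) (fun l => e ^ m * L m (e * s + c) l))).
    by rewrite /Y /lor; ring.
  rewrite eps2 Rmult_1_l iso_lor; last exact: moebius_iso.
  by rewrite Rpow_mult_distr /lor; ring.
have Y4 s : 0 < Y 0%nat s 4%nat by have := epos s; rewrite /Y /sg /act5 /=; lra.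
have nullY s : lor (Y 0%nat s) (Y 0%nat s) = 0 by rewrite lorY null; ring.
have unitY s : lor (Y 1%nat s) (Y 1%nat s) = 1 by rewrite lorY e2 unit; ring.
have ratio s (j : 'I_3) : h s j ord0 = Y 0%nat s j.+1 / Y 0%nat s 4%nat.
  have [rho r0 E] := actE s.
  have EY i : (i < 5)%nat -> Y 0%nat s i = eps * rho * euclid_lift (h s) i.
    by move=> hi; rewrite Rmult_assoc -E // /Y /act5 /=; ring.
  have ep0 : eps <> 0 by move=> z; rewrite z in eps2; lra.
  have ratio' (x : R) : x = eps * rho * x / (eps * rho * 1) by field.
  rewrite !EY //; last by rewrite ltnS; apply: leq_trans (ltn_ord j) _.
  case: j => [[|[|[|//]]] hj] /=.
  - by rewrite (_ : Ordinal hj = ord0); [exact: ratio'|apply: val_inj].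
  - by rewrite (_ : Ordinal hj = inord 1); [exact: ratio'|apply: val_inj; rewrite /= inordK].
  - by rewrite (_ : Ordinal hj = inord 2); [exact: ratio'|apply: val_inj; rewrite /= inordK].
rewrite (eta_lift _ _ _ _ (CY 0%nat) (CY 1%nat) (CY 2%nat) Y4 nullY unitY h ratio) EG /lift_E.
by rewrite !lorY e2 !pow1 !Rmult_1_l.
Qed.

End EtaInvariance.

(** * Frames with equal curvatures and Moebius equivalence *)

Definition frame_entry (F : R -> 'M[R]_5) (i j : nat) (t : R) : R := ent (F t) i j.

Lemma vessiot_frame_row g F k1 k2 i : vessiot_frame g F k1 k2 -> (forall t, eta g t = 1) ->
  vessiot_row k1 k2 (frame_entry F i).
Proof.
case=> sm VF E1 t; have [/moebius_id_sub M [_ [_]]] := VF t.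
rewrite E1 GRing.scale1r => /(canRL (mulKVmx (moebius_unit _ M))) E.
have d (j : nat) : is_derive (frame_entry F i j) t (mul5 (ent (F t)) (vessiot_entry (k1 t) (k2 t)) (inord i : 'I_5) j) \/ (5 <= j)%nat.
  case: (ltnP j 5) => hj; last by right.
  left; have := congr1 (fun B : 'M[R]_5 => B (inord i) (inord j)) E.
  rewrite vessiot_matrix_mx5 -{1}(mx5_ent (F t)) mx5_mul !mxE [X in _ = mul5 _ _ _ X]inordK // => <-.
  by apply: Derive_correct; exact: (sm (inord i) (inord j) 1%nat t).
have ei l : ent (F t) (inord i : 'I_5) l = frame_entry F i l t by rewrite /frame_entry /ent inord_val.
have D (j : nat) l : (j < 5)%nat -> mul5 (ent (F t)) (vessiot_entry (k1 t) (k2 t)) (inord i : 'I_5) j = l ->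
    is_derive (frame_entry F i j) t l.
  by move=> hj <-; case: (d j) => //; rewrite leqNgt hj.
split; [|split; [|split; [|split]]]; apply: D => //; rewrite /mul5 /vessiot_entry !ei; ring.
Qed.

(* Applied to rows of frames F and G, these products are the entries of F J G^T. *)
Lemma vessiot_rows_product k1 k2 f g : vessiot_row k1 k2 f -> vessiot_row k1 k2 g ->
  forall s t, lor (f^~ s) (g^~ s) = lor (f^~ t) (g^~ t).
Proof.
move=> Hf Hg; apply: (derive_zero_const (fun t => lor (f^~ t) (g^~ t))) => t.
have [f0 [f1 [f2 [f3 f4]]]] := Hf t; have [g0 [g1 [g2 [g3 g4]]]] := Hg t.
pose P := is_derive_plus (K := R_AbsRing) (V := R_NormedModule).
pose m := is_derive_Rmult.
have N := is_derive_opp (K := R_AbsRing) (V := R_NormedModule) _ _ _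
  (P _ _ _ _ _ (m _ _ _ _ _ f0 g4) (m _ _ _ _ _ f4 g0)).
have H := P _ _ _ _ _ (P _ _ _ _ _ (P _ _ _ _ _ N (m _ _ _ _ _ f1 g1)) (m _ _ _ _ _ f2 g2)) (m _ _ _ _ _ f3 g3).
by apply: is_derive_val H _; rewrite /plus /opp /=; ring.
Qed.

Theorem vessiot_frame_unique g h F G k1 k2 :
  vessiot_frame g F k1 k2 -> (forall t, eta g t = 1) ->
  vessiot_frame h G k1 k2 -> (forall t, eta h t = 1) ->
  exists A, moebius_group A /\ forall t, mulmx A (G t) = F t.
Proof.
move=> VF EF VG EG.
have MF t : moebius_group (F t) by case: VF => _ /(_ t) [/moebius_id_sub].
have MG t : moebius_group (G t) by case: VG => _ /(_ t) [/moebius_id_sub].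
pose J := mx5 gram; pose GT t := mx5 (fun i j => ent (G t) j i).
have inv t : mulmx (mulmx J (mulmx (GT t) J)) (G t) = (@scalar_mx R 5 (GRing.one _)).
  by rewrite -!mulmxA -{1}(mx5_ent (G t)) iso_gram ?gram_sq //; apply: moebius_iso.
(* By the Gram relation the inverse of [G] is [J G^T J], so this is [F] times the inverse of [G],
   written so that the constant row products appear. *)
pose A t := mulmx (mulmx (F t) (mulmx J (GT t))) J.
have AG t : mulmx (A t) (G t) = F t.
  have := congr1 (mulmx (F t)) (inv t); rewrite mulmx1 => E; rewrite -[RHS]E.
  by rewrite /A -!mulmxA.
have Ac s t : A s = A t.
  rewrite /A; congr mulmx; rewrite -(mx5_ent (F s)) -(mx5_ent (F t)) !mx5_mul; apply: mx5_ext => i j hi hj.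
  have := vessiot_rows_product _ _ _ _ (vessiot_frame_row _ _ _ _ i VF EF) (vessiot_frame_row _ _ _ _ j VG EG) s t.
  rewrite /lor /frame_entry => E; rewrite /mul5 /=; lra.
exists (A 0); split; last by move=> t; rewrite (Ac 0 t).
have -> : A 0 = mulmx (F 0) (invmx (G 0)).
  by rewrite -(AG 0) mulmxK //; apply: moebius_unit.
by apply: moebius_mul => //; apply: moebius_inv.
Qed.

Lemma vessiot_frame_embed g F k1 k2 t : vessiot_frame g F k1 k2 ->
  exists r, r <> 0 /\ col (inord 4) (F t) = r *: embed (g t).
Proof.
case=> _ /(_ t) [/moebius_id_sub M [n0 [<- _]]]; exists (entry (col (inord 4) (F t)) 4); split=> //.
apply: null_vector_embed => //.
have := moebius_iso _ M 4%nat 4%nat isT isT.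
by rewrite /lor /entry /ent !mxE.
Qed.

Lemma vessiot_frame_acts g h F G k1 k2 :
  vessiot_frame g F k1 k2 -> (forall t, eta g t = 1) ->
  vessiot_frame h G k1 k2 -> (forall t, eta h t = 1) ->
  exists A, moebius_group A /\ acts_to A g h.
Proof.
move=> VF EF VG EG; have [A [MA E]] := vessiot_frame_unique _ _ _ _ _ _ VG EG VF EF.
exists A; split=> // t.
have [r [r0 Er]] := vessiot_frame_embed _ _ _ _ t VF.
have [s [s0 Es]] := vessiot_frame_embed _ _ _ _ t VG.
exists (/ r * s); split.
  by apply: Rmult_integral_contrapositive_currified => //; apply: Rinv_neq_0_compat.
have C : mulmx A (r *: embed (g t)) = s *: embed (h t) by rewrite -Er -Es -E !colE mulmxA.
rewrite -scalemxAr in C.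
rewrite -[LHS]GRing.scale1r (_ : GRing.one _ = / r * r); last by symmetry; apply: Rinv_l.
by rewrite -GRing.scalerA C GRing.scalerA.
Qed.

Lemma acts_to_trans A B g h f : acts_to A g h -> acts_to B h f -> acts_to (mulmx B A) g f.
Proof.
move=> HA HB t; have [r [r0 Er]] := HA t; have [s [s0 Es]] := HB t.
exists (r * s); split; first exact: Rmult_integral_contrapositive_currified.
by rewrite -mulmxA Er -scalemxAr Es GRing.scalerA.
Qed.

Lemma acts_to_refl g : acts_to (@scalar_mx R 5 (GRing.one _)) g g.
Proof. by move=> t; exists 1; split; [exact: R1_neq_R0|rewrite mul1mx; symmetry; apply: GRing.scale1r]. Qed.

Lemma moebius_1 : moebius_group (@scalar_mx R 5 (GRing.one _)).
Proof. by split=> [v w|]; [rewrite !mul1mx|apply: det1]. Qed.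

Lemma congruent_acts g h : congruent_up_to_orientation g h ->
  exists A e c, moebius_group A /\ e * e = 1 /\ acts_to A (fun t => g (e * t + c)) h.
Proof.
case=> e [c [e1 H]].
have e2 : e * e = 1 by case: e1 => ->; ring.
case: H => [E|[A [MA [_ act]]]]; last by exists A, e, c.
exists (@scalar_mx R 5 (GRing.one _)), e, c; split; first exact: moebius_1.
by split=> // t; rewrite E; apply: acts_to_refl.
Qed.

Theorem moebius_equivalent_model g a b (phi : R -> R) : admissible a b -> reparametrization phi ->
  has_parameters (fun t => g (phi t)) a b -> moebius_equivalent g (model_string a b).
Proof.
move=> adm [_ [_ surj]] [_ [[gG EG] [h [cong [gh [F VF]]]]]].
have [B [e [c [MB [e2 actB]]]]] := congruent_acts _ _ cong.
have Eh t : eta h t = 1 by rewrite (eta_moebius _ h B e c gG MB e2 actB); apply: EG.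
have [A [MA actA]] := vessiot_frame_acts _ _ _ _ _ _ VF Eh (model_vessiot_frame a b adm) (eta_model_string a b adm).
exists (mulmx A B); split; first exact: moebius_mul.
have act := acts_to_trans _ _ _ _ _ actB actA.
split=> [t|s]; last by exists (phi (e * s + c)); apply: act.
(* The parameter of the model is the solution [s] of [e * s + c = u], where [e] is its own
   inverse. *)
have [u Eu] := surj t; exists (e * (u - c)).
have := act (e * (u - c)); rewrite (_ : e * (e * (u - c)) + c = u) ?Eu //.
by rewrite -Rmult_assoc e2; ring.
Qed.

Theorem theorem2 (q : C) (q1 q2 : Q) (a b : R)
  (hq : q = (Q2R q1 + Ci * Q2R q2)%C) (hOmega : Omega q)
  (ha : 0 < a) (hab : b < a) (hb : b <> 0) (hab1 : 1 < a * b)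
  (hPhi1 : Phi1 a b = - Q2R q1) (hPhi2 : Phi2 a b = Q2R q2) :
  (conformal_string (model_string a b) /\ has_modulus (model_string a b) q) /\
  (forall g : curve, conformal_string g -> has_modulus g q ->
     moebius_equivalent g (model_string a b)).
Proof.
have adm : admissible a b by [].
have Eq : q = (- Phi1 a b + Ci * Phi2 a b)%C.
  by rewrite hq hPhi1 hPhi2 -RtoC_opp Ropp_involutive.
split; first by split; [exact: conformal_string_model hPhi1 hPhi2|rewrite Eq; apply: model_has_modulus].
move=> g _ [phi [a' [b' [rep [adm' [par Eq']]]]]].
have [E1 E2] : Phi1 a b = Phi1 a' b' /\ Phi2 a b = Phi2 a' b'.
  by move: Eq'; rewrite Eq => /(f_equal (fun z : C => (fst z, snd z))) /= [] *; split; lra.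
have [-> ->] := Phi_injective _ _ _ _ adm adm' E1 E2.
exact: moebius_equivalent_model rep par.
Qed.
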